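(* Let $G$ be a cograph with no isolated vertices. Then $G$ is strongly even-cycle decomposable if and only if $G$ is $2$-connected and Eulerian and $G$ is (up to isomorphism) neither $K_5$ nor $K_5$ with an edge subdivided.
   Context: All graphs are finite and have at least one vertex. A cograph is a simple graph with no induced path of length $3$ (i.e. no induced path on four vertices). An Eulerian graph is a (not necessarily connected) graph in which every vertex has even degree. ''$K_5$ with an edge subdivided'' is the 6-vertex graph obtained from $K_5$ by replacing one edge by a path of length $2$. A graph is even-cycle decomposable if its edge set can be partitioned into (edge sets of) cycles of even length. A subdivision of a graph is obtained by replacing each edge by a path of length at least $1$ with the same ends (so a graph is a subdivision of itself). A graph $G$ is strongly even-cycle decomposable if every subdivision of $G$ with an even number of edges is even-cycle decomposable. Equivalently, for every $\Sigma\subseteq E(G)$ with $|\Sigma|$ even, $E(G)$ can be partitioned into cycles each containing an even number of edges of $\Sigma$. *)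

(* Defs.v *)
From mathcomp Require Import all_boot.

Set Implicit Arguments.
Unset Strict Implicit.
Unset Printing Implicit Defensive.

Record sgraph := SGraph {
  svertex :> finType;
  sedge : rel svertex;
  sedge_sym : symmetric sedge;
  sedge_irrefl : irreflexive sedge
}.

Arguments sedge {s}.
Notation "x -- y" := (sedge x y) (at level 30).

Definition edges (G : sgraph) : {set {set G}} :=
  [set [set e.1; e.2] | e : G * G & e.1 -- e.2].

Definition degree (G : sgraph) (x : G) : nat := #|[set y : G | x -- y]|.

Definition no_isolated_vertex (G : sgraph) : Prop :=
  forall x : G, 0 < degree x.

Definition eulerian (G : sgraph) : Prop := forall x : G, ~~ odd (degree x).

Definition isomorphic (G H : sgraph) : Prop :=
  exists f : G -> H, bijective f /\ forall x y : G, f x -- f y = x -- y.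

Definition has_induced (G F : sgraph) : Prop :=
  exists f : F -> G, injective f /\ forall x y : F, f x -- f y = x -- y.

Section PathGraph.
Variable n : nat.
Definition path_rel : rel 'I_n := fun i j => (i.+1 == j) || (j.+1 == i).
Lemma path_rel_sym : symmetric path_rel.
Proof. by move=> i j; rewrite /path_rel orbC. Qed.
Lemma path_rel_irrefl : irreflexive path_rel.
Proof. by move=> i; rewrite /path_rel orbb eqn_leq ltnn. Qed.
(* n is the number of vertices, so the path has length n - 1. *)
Definition path_graph : sgraph := SGraph path_rel_sym path_rel_irrefl.
End PathGraph.

Definition cograph (G : sgraph) : Prop := ~ has_induced G (path_graph 4).

Section CompleteGraph.
Variable n : nat.
Definition complete_rel : rel 'I_n := fun i j => i != j.
Lemma complete_rel_sym : symmetric complete_rel.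
Proof. by move=> i j; rewrite /complete_rel eq_sym. Qed.
Lemma complete_rel_irrefl : irreflexive complete_rel.
Proof. by move=> i; rewrite /complete_rel eqxx. Qed.
Definition complete_graph : sgraph :=
  SGraph complete_rel_sym complete_rel_irrefl.
End CompleteGraph.

(* The edge ab is replaced by the path a - None - b; this is only meaningful
   when a -- b. *)
Section SubdivideEdge.
Variables (G : sgraph) (a b : G).
Definition subdivide_edge_rel : rel (option G) := fun u v =>
  match u, v with
  | Some x, Some y => x -- y && ([set x; y] != [set a; b])
  | Some x, None | None, Some x => (x == a) || (x == b)
  | None, None => false
  end.
Lemma subdivide_edge_sym : symmetric subdivide_edge_rel.
Proof. by move=> [x|] [y|] //=; rewrite sedge_sym setUC. Qed.
Lemma subdivide_edge_irrefl : irreflexive subdivide_edge_rel.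
Proof. by move=> [x|] //=; rewrite sedge_irrefl. Qed.
Definition subdivide_edge : sgraph :=
  SGraph subdivide_edge_sym subdivide_edge_irrefl.
End SubdivideEdge.

Definition K5 : sgraph := complete_graph 5.

(* All edges of K5 are equivalent up to isomorphism; we take the edge {0, 4}. *)
Definition K5_subdivided : sgraph := @subdivide_edge K5 ord0 ord_max.

(* G - X is connected. *)
Definition connected_without (G : sgraph) (X : {set G}) : Prop :=
  forall x y : G, x \notin X -> y \notin X ->
    connect [rel u v | [&& u \notin X, v \notin X & u -- v]] x y.

Definition k_connected (k : nat) (G : sgraph) : Prop :=
  k < #|G| /\ forall X : {set G}, #|X| < k -> connected_without X.

Definition cycle_edges (G : sgraph) (c : seq G) : {set {set G}} :=
  [set [set x; next c x] | x in c].

Definition even_cycle (G : sgraph) (C : {set {set G}}) : Prop :=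
  exists c : seq G,
    [/\ 2 < size c, ucycle sedge c, ~~ odd (size c) & C = cycle_edges c].

Definition even_cycle_decomposable (G : sgraph) : Prop :=
  exists P : {set {set {set G}}},
    partition P (edges G) /\ forall C, C \in P -> even_cycle C.

(* H is a subdivision of G: f embeds the vertices of G in H, and, for each
   edge xy of G, p x y lists the internal vertices of the path of H (of length
   at least 1, from f x to f y) that replaces xy; p y x lists them backwards.
   The values of p x y for non-adjacent x, y are irrelevant. *)
Definition subdivision (G H : sgraph) : Prop :=
  exists (f : G -> H) (p : G -> G -> seq H),
    let walk x y := f x :: rcons (p x y) (f y) in
    [/\ injective f,
        forall x y, x -- y -> p y x = rev (p x y),
        forall x y, x -- y ->
          uniq (p x y) /\ forall z, f z \notin p x y,
        forall x y x' y' v, x -- y -> x' -- y' ->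
          v \in p x y -> v \in p x' y' -> [set x; y] = [set x'; y']
      & (forall v, (exists x, v = f x) \/
                   exists x y, x -- y /\ v \in p x y) /\
        (forall u v, u -- v <->
                     exists x y, x -- y /\ infix [:: u; v] (walk x y))].

Definition strongly_even_cycle_decomposable (G : sgraph) : Prop :=
  forall H : sgraph, subdivision G H -> ~~ odd #|edges H| ->
    even_cycle_decomposable H.

(* Main.v *)
(* A subdivision matters only through the parities of the lengths of the subdivided edges, so [G] is
   strongly even-cycle decomposable iff [secd [set: G]]: for each set of marked edges of even size,
   the edges of [G] are partitioned into cycles with an even number of marked edges.

   Necessity. With two marked edges, they lie on a common cycle, hence [G] is 2-connected; cycles have
   even degrees; and for [K5] and its subdivision the marked edges of the cycles are counted modulo 4.

   Sufficiency is proved by induction for the 2-connected Eulerian induced subgraphs [V] of [G]. By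
   Seinsche's theorem [V] is a join and contains twins [u], [v]. The edges at [u] and [v] form parallel
   paths of length at most 2 from [u] to [v]. A decomposition of [V - u - v] with at most one odd
   cycle, which can be required to contain a given edge, is combined with these paths by exchanging
   arcs ([secd_twins]). This fails only if [u -- v] have exactly three other neighbours; then two pairs
   of twins are removed at once, or [V] has a simple structure. If [V - u - v] is exceptional, or
   becomes so after two removals, then [V] is one of finitely many graphs. For each of them a list
   of cycle partitions is given, and linear algebra over F_2 shows that for every marking one of them
   is even. *)

(* Parity shapes the proof. Let [N] be the set of common neighbours of twins [u], [v], and suppose
   that the paths between them have odd total weight. Then the rest is odd as well; flipping one
   mark before decomposing it forces its only odd cycle O through the flipped edge. O and some of
   the paths must be recombined into even cycles. If all paths through [N] have the same parity, the
   edge [uv] has to be used, with paths through two vertices of [N] on O and through a third one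
   that avoids one of the two arcs; the marks dictate which arc. Five common neighbours leave enough
   choice; with three, all on O, there may be none. Therefore two nonadjacent pairs of twins are
   then removed together: if both bundles of paths are odd, their union is even, and it is one of
   two fixed graphs. Connectedness of [N] supplies the edge of O inside [N], so twins are sought
   inside one side of a join, the other side being part of [N]; where [N] is disconnected, a choice
   among three false twins can replace the exchange. The tables are there because a removal can
   produce an exceptional graph, for which the induction hypothesis gives no decomposition. *)
From Stdlib Require Import Ascii String.
Require Import Defs.
From mathcomp Require Import all_boot zify.

Set Implicit Arguments.
Unset Strict Implicit.
Unset Printing Implicit Defensive.

(** * Signed cycle decompositions *)

Section CycleEdges.
Variable T : finType.
Implicit Types (x y : T) (c s p : seq T) (l : seq {set T}) (w : pred {set T}).

Fixpoint walk_edges x s : seq {set T} :=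
  if s is y :: s' then [set x; y] :: walk_edges y s' else [::].

Definition cedges c : seq {set T} :=
  if c is x :: s then walk_edges x (rcons s x) else [::].

(** Length at least 3 keeps [cedges] free of repetitions: a cyclic sequence of two vertices would
    list its edge twice. *)
Definition cyc c := uniq c && (2 < size c).

Definition wodd w l := odd (count w l).

(* [w] marks the edges of the set Sigma of the paper. *)
Definition dec w l := exists2 cs : seq (seq T),
  all (fun c => cyc c && ~~ wodd w (cedges c)) cs &
  perm_eq (flatten (map cedges cs)) l.

Lemma walk_edges_cat x s1 s2 :
  walk_edges x (s1 ++ s2) = walk_edges x s1 ++ walk_edges (last x s1) s2.
Proof. by elim: s1 x => //= y s1 IH x; rewrite IH. Qed.

Lemma walk_edges_rcons x s y :
  walk_edges x (rcons s y) = rcons (walk_edges x s) [set last x s; y].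
Proof. by rewrite -cats1 walk_edges_cat cats1. Qed.

Lemma walk_edges_rev x s y :
  perm_eq (walk_edges y (rcons (rev s) x)) (walk_edges x (rcons s y)).
Proof.
elim: s x => [|z s IH] x /=; first by rewrite setUC.
rewrite rev_cons walk_edges_rcons last_rcons perm_rcons setUC perm_cons.
exact: IH.
Qed.

Lemma size_cedges c : size (cedges c) = size c.
Proof.
case: c => //= x s; suff H y t : size (walk_edges y t) = size t.
  by rewrite H size_rcons.
by elim: t y => //= z t IH y; rewrite IH.
Qed.

Lemma cedges_catC s1 s2 : perm_eq (cedges (s1 ++ s2)) (cedges (s2 ++ s1)).
Proof.
case: s1 s2 => [|x a] [|y b]; rewrite /= ?cats0 //.
rewrite -!cats1 -!catA !cat_cons /= !walk_edges_cat /= !walk_edges_cat /=.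
by apply/permP => q; rewrite !count_cat /= !count_cat /=; lia.
Qed.

Lemma perm_dec w l1 l2 : perm_eq l1 l2 -> dec w l1 -> dec w l2.
Proof. by move=> l12 [cs cs_ok csl]; exists cs => //; exact: perm_trans l12. Qed.

Lemma dec_cat w l1 l2 : dec w l1 -> dec w l2 -> dec w (l1 ++ l2).
Proof.
move=> [cs1 ok1 e1] [cs2 ok2 e2]; exists (cs1 ++ cs2); first by rewrite all_cat ok1.
by rewrite map_cat flatten_cat perm_cat.
Qed.

Lemma dec_nil w : dec w [::].
Proof. by exists [::]. Qed.

Lemma dec_cyc w c : cyc c -> ~~ wodd w (cedges c) -> dec w (cedges c).
Proof. by move=> cc ce; exists [:: c]; rewrite /= ?cc ?ce ?cats0. Qed.

Lemma wodd_cat w l1 l2 : wodd w (l1 ++ l2) = wodd w l1 (+) wodd w l2.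
Proof. by rewrite /wodd count_cat oddD. Qed.

Lemma wodd_cons w E l : wodd w (E :: l) = w E (+) wodd w l.
Proof. by rewrite -cat1s wodd_cat /wodd /= addn0 oddb. Qed.

Lemma wodd_perm w l1 l2 : perm_eq l1 l2 -> wodd w l1 = wodd w l2.
Proof. by rewrite /wodd => /permP ->. Qed.

Lemma wodd_toggle w E0 l : uniq l ->
  wodd (fun E => w E (+) (E == E0)) l = wodd w l (+) (E0 \in l).
Proof.
elim: l => //= E l IH /andP[El ul]; rewrite !wodd_cons IH // inE.
rewrite [E0 == E]eq_sym; case: eqP => [<-|_]; first by rewrite (negbTE El) addbF addbT addNb addbT.
by rewrite addbF addbA.
Qed.

Lemma eq_wodd w w' l : {in l, w =1 w'} -> wodd w l = wodd w' l.
Proof. by move=> ww'; rewrite /wodd (eq_in_count ww'). Qed.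

Lemma dec_even w l : dec w l -> ~~ wodd w l.
Proof.
case=> cs ok /(wodd_perm w) <-; elim: cs ok => //= c cs IH /andP[/andP[_ ce] ok].
by rewrite wodd_cat (negbTE ce) IH.
Qed.

Lemma mem_walk_edges x s E : E \in walk_edges x s ->
  exists y z, [/\ E = [set y; z], y \in x :: s & z \in s].
Proof.
elim: s x => //= y s IH x; rewrite inE => /orP[/eqP->|/IH[a [b [-> ha hb]]]].
  by exists x, y; rewrite !inE !eqxx.
by exists a, b; split=> //; rewrite inE ?ha ?hb orbT.
Qed.

Lemma mem_cedges_sub c E z : E \in cedges c -> z \in E -> z \in c.
Proof.
case: c => //= x s /mem_walk_edges[a [b [-> ha hb]]].
move: ha hb; rewrite -cats1 !(inE, mem_cat) => ha hb.
by case/orP=> /eqP->; move: ha hb;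
  case: (_ == x); case: (_ \in s) => //=; case: (_ == x); case: (_ \in s).
Qed.

Lemma cyc_rot_cons c x : cyc c -> x \in c ->
  exists s, [/\ cyc (x :: s), perm_eq (cedges (x :: s)) (cedges c) & c =i x :: s].
Proof.
move=> /andP[uc sc] xc; case/splitPr: xc uc sc => s1 s2 uc sc.
exists (s2 ++ s1); split.
- by rewrite /cyc -cat_cons uniq_catC uc size_cat addnC -size_cat.
- by rewrite -cat_cons; apply: cedges_catC.
- by move=> z; rewrite -cat_cons !mem_cat orbC.
Qed.

Lemma cyc_split c x y : cyc c -> x \in c -> y \in c -> x != y ->
  exists P Q, [/\ cyc (x :: P ++ y :: Q), perm_eq (cedges (x :: P ++ y :: Q)) (cedges c)
    & c =i x :: P ++ y :: Q].
Proof.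
move=> cc xc yc xy; have [s [cs es ms]] := cyc_rot_cons cc xc.
have: y \in s by move: yc; rewrite ms inE eq_sym (negbTE xy).
by move=> ys; case/splitPr: ys cs es ms => P Q; exists P, Q.
Qed.

Lemma cedges_split x P y Q : cedges (x :: P ++ y :: Q) =
  walk_edges x (rcons P y) ++ walk_edges y (rcons Q x).
Proof. by rewrite /cedges rcons_cat -cat_rcons walk_edges_cat last_rcons. Qed.

(* Toggling the sign of [E0] turns the cycle through [E0] into the unique odd one. *)
Lemma odd_dec w l E0 : uniq l -> E0 \in l ->
  dec (fun E => w E (+) (E == E0)) l ->
  exists c l', [/\ cyc c, E0 \in cedges c, wodd w (cedges c), dec w l'
    & perm_eq (cedges c ++ l') l].
Proof.
move=> ul E0l [cs ok e].
have ue : uniq (flatten (map cedges cs)) by rewrite (perm_uniq e).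
have /flatten_mapP[c cc Ec] : E0 \in flatten (map cedges cs) by rewrite (perm_mem e).
have ecs := perm_to_rem cc.
have e2 : perm_eq (cedges c ++ flatten (map cedges (rem c cs))) (flatten (map cedges cs)).
  rewrite perm_sym; change (perm_eq (flatten (map cedges cs)) (flatten (map cedges (c :: rem c cs)))).
  by apply: perm_flatten; apply: perm_map.
exists c, (flatten (map cedges (rem c cs))).
move: ok; rewrite (perm_all _ ecs) /= => /andP[/andP[cyc_c ec] ok].
move: (ue); rewrite -(perm_uniq e2) cat_uniq => /and3P[uc hn ur].
split=> //.
- by move: ec; rewrite wodd_toggle // Ec addbT negbK.
- exists (rem c cs) => //; apply/allP=> d dr.
  have /andP[-> /=] := allP ok d dr.
  have E0d : E0 \notin cedges d.
    apply: contra hn => Ed; apply/hasP; exists E0 => //.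
    by apply/flatten_mapP; exists d.
  have ud : uniq (cedges d).
    apply: (subseq_uniq _ ur); case/splitPr: dr => s1 s2.
    by rewrite map_cat flatten_cat /=; apply: (subseq_trans (prefix_subseq _ (flatten (map cedges s2)))); apply: suffix_subseq.
  by rewrite wodd_toggle // (negbTE E0d) addbF.
- exact: perm_trans e2 e.
Qed.

End CycleEdges.
Arguments cedges {T} c.
Arguments cyc {T} c.

(** * Certificates for labelled graphs *)

Definition norm_pair (i j : nat) := if i < j then (i, j) else (j, i).

Fixpoint pair_walk (i : nat) (s : seq nat) : seq (nat * nat) :=
  if s is j :: s' then norm_pair i j :: pair_walk j s' else [::].

Definition pair_cycle (c : seq nat) :=
  if c is i :: s then pair_walk i (rcons s i) else [::].

Definition label_dec (n : nat) (El : seq (nat * nat)) (cs : seq (seq nat)) :=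
  all (fun c => [&& uniq c, 2 < size c & all (gtn n) c]) cs &&
  perm_eq (flatten (map pair_cycle cs)) El.

Fixpoint dot (v w : seq bool) : bool :=
  if v is a :: v' then if w is b :: w' then (a && b) (+) dot v' w' else false else false.

Fixpoint vxor (v r : seq bool) : seq bool :=
  match v, r with
  | a :: v', b :: r' => (a (+) b) :: vxor v' r'
  | _, _ => [::]
  end.

(* A linear system over F_2 in echelon form: the entry [Some (r, p)] in position [k]
   is the equation [w_k + \sum_(i > k) r_i w_i = p]. *)
Definition system := seq (option (seq bool * bool)).

Fixpoint sat (B : system) (w : seq bool) : bool :=
  match B, w with
  | o :: B', b :: w' =>
      (if o is Some (r, p) then (size r == size w') && (b (+) dot r w' == p) else true) && sat B' w'
  | [::], [::] => true
  | _, _ => false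
  end.

(* The value that the system forces on the linear form [v], if any. *)
Fixpoint forced (B : system) (v : seq bool) (p : bool) : option bool :=
  match B, v with
  | o :: B', a :: v' =>
      if a then if o is Some (r, q) then forced B' (vxor v' r) (p (+) q) else None
      else forced B' v' p
  | _, _ => Some p
  end.

(** Gaussian elimination: what is left after reduction is stored at its leading position. An
    equation that reduces to [0 = p] is dropped even when [p] is true: only soundness matters, and a
    lost equation merely enlarges the solution set. *)
Fixpoint add_eqn (B : system) (v : seq bool) (p : bool) : system :=
  match B, v with
  | o :: B', a :: v' =>
      if a then if o is Some (r, q) then o :: add_eqn B' (vxor v' r) (p (+) q)
                else Some (v', p) :: B'
      else o :: add_eqn B' v' p
  | _, _ => B
  end.

(** The forms in [D] are the cycles of one partition. [None]: one of them is forced to be odd, so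
    the partition is hopeless; [Some None]: all are forced to be even; [Some (Some v)]: none is
    forced to be odd, and [v] is the first undecided one. *)
Fixpoint status (B : system) (D : seq (seq bool)) : option (option (seq bool)) :=
  if D is v :: D' then
    match forced B v false with
    | Some true => None
    | Some false => status B D'
    | None => if status B D' is None then None else Some (Some v)
    end
  else Some None.

(* Whether every solution of the system annihilates some member of [Ds]: branch on the value of the
   first linear form that is not forced. *)
Fixpoint solve (fuel : nat) (B : system) (Ds : seq (seq (seq bool))) : bool :=
  if fuel is fuel'.+1 then
    if Ds is D :: Ds' then
      match status B D with
      | None => solve fuel' B Ds'
      | Some None => true
      | Some (Some v) =>
          solve fuel' (add_eqn B v false) Ds && solve fuel' (add_eqn B v true) Ds'
      end
    else false
  else false.

Definition edge_mask (El l : seq (nat * nat)) : seq bool := [seq E \in l | E <- El].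

(** [B0] says that the total marking is even, and each [l] in [Os] adds that [l] is odd. The fuel
    suffices because every recursive call of [solve] discards a member of [Ds] or raises the rank of
    the system, which is at most [size El]; too little fuel could only make the check fail. *)
Definition label_check (n : nat) (El : seq (nat * nat)) (Os : seq (seq (nat * nat)))
    (Ds : seq (seq (seq nat))) :=
  [&& all (label_dec n El) Ds, uniq El, all (fun l => uniq l && all [in El] l) Os
    & let vs := map (map (fun c => edge_mask El (pair_cycle c))) Ds in
      let B0 := add_eqn (nseq (size El) None) (nseq (size El) true) false in
      let B := foldr (fun l B => add_eqn B (edge_mask El l) true) B0 Os in
      solve (size El + size Ds) B vs].

Lemma size_vxor v r : size v = size r -> size (vxor v r) = size r.
Proof. by elim: v r => [|a v IH] [|b r] //= [/IH->]. Qed.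

Lemma dot_vxor v r w : size v = size r -> dot (vxor v r) w = dot v w (+) dot r w.
Proof.
elim: v r w => [|a v IH] [|b r] [|c w] //= [/IH->].
by case: a; case: b; case: c; case: (dot v w); case: (dot r w).
Qed.

Lemma forcedP B v p w q : sat B w -> size v = size w ->
  forced B v p = Some q -> dot v w = p (+) q.
Proof.
elim: B v p w => [|o B IH] [|a v] p [|b w] //=; first by move=> _ _ [->]; rewrite addbb.
case/andP=> ho sB [sv]; case: a => [|/(IH _ _ _ sB sv)->//].
case: o ho => [[r c]|] // /andP[/eqP sr /eqP <-] /(IH _ _ _ sB).
rewrite size_vxor ?sv ?sr // dot_vxor ?sv ?sr // => /(_ erefl).
by case: (b); case: (dot v w); case: (dot r w); case: (p); case: (q).
Qed.

Lemma add_eqnP B v p w : sat B w -> size v = size w -> dot v w = p -> sat (add_eqn B v p) w.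
Proof.
elim: B v p w => [|o B IH] [|a v] p [|b w] //=.
case/andP=> ho sB [sv]; case: a => /= [|/(IH _ _ _ sB sv)->]; last by rewrite ho.
case: o ho => [[r c]|] /=; last by move=> _ <-; rewrite sv !eqxx sB.
case/andP=> /eqP sr /eqP e e2; rewrite sr e !eqxx /=; apply: IH => //.
  by rewrite size_vxor ?sv ?sr.
rewrite dot_vxor ?sv ?sr // -e -e2.
by case: b {e e2}; case: (dot v w); case: (dot r w).
Qed.

Lemma statusP B D w : sat B w -> all (fun v => size v == size w) D ->
  status B D = Some None -> all (fun v => ~~ dot v w) D.
Proof.
move=> sB; elim: D => //= v D IH /andP[/eqP sv sD].
case e: (forced B v false) => [[]|] //.
  by move=> /(IH sD)->; rewrite (forcedP sB sv e).
by case: (status B D).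
Qed.

Lemma status_mem B D v : status B D = Some (Some v) -> v \in D.
Proof.
elim: D => //= u D IH; rewrite inE.
case e: (forced B u false) => [[]|] //; first by move/IH->; rewrite orbT.
by case: (status B D) => // _ [->]; rewrite eqxx.
Qed.

Lemma solveP fuel B Ds w : solve fuel B Ds -> sat B w ->
  all (all (fun v => size v == size w)) Ds -> has (all (fun v => ~~ dot v w)) Ds.
Proof.
elim: fuel B Ds => // fuel IH B [|D Ds] //=.
case e: (status B D) => [[v|]|]; last first.
- by move=> h sB /andP[_ sDs]; rewrite (IH _ _ h) ?orbT.
- by move=> _ sB /andP[sD _]; rewrite (statusP sB sD e).
case/andP=> h0 h1 sB /andP[sD sDs].
have /eqP sv := allP sD _ (status_mem e).
(* An odd [v] rules out [D], so the witness is among [Ds]; an even [v] keeps [D] in play with one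
   more equation. *)
case dv: (dot v w).
  by rewrite (IH _ _ h1) ?orbT //; apply: add_eqnP.
by have := IH _ _ h0 (add_eqnP sB sv dv); rewrite /= sD => ->.
Qed.

Lemma dot_edge_mask (El l : seq (nat * nat)) (g : pred (nat * nat)) :
  uniq El -> uniq l -> {subset l <= El} ->
  dot (edge_mask El l) (map g El) = odd (count g l).
Proof.
move=> uE ul sub.
have -> : dot (edge_mask El l) (map g El) = odd (count g (filter [in l] El)).
  elim: El {uE sub} => //= E El ->; case: ifP => //= _.
  by rewrite oddD oddb.
congr (odd _); apply/permP: g; apply: uniq_perm; rewrite ?filter_uniq // => E.
by rewrite mem_filter; apply/andP/idP => [[]|El0] //; split=> //; apply: sub.
Qed.

Section Realize.
Variables (T : finType) (x0 : T) (xs : seq T).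
Hypothesis uxs : uniq xs.

Definition label_edges (El : seq (nat * nat)) : seq {set T} :=
  [seq [set nth x0 xs E.1; nth x0 xs E.2] | E <- El].

Lemma label_edges_cycle c :
  cedges (map (nth x0 xs) c) = label_edges (pair_cycle c).
Proof.
case: c => //= i s; rewrite -map_rcons.
move: (rcons s i) => p; elim: p i => //= j p IH i; rewrite IH /norm_pair.
by case: ifP => // _; rewrite /= setUC.
Qed.

(** The marks along [El] form a vector over F_2, and the parity of a cycle is its scalar product
    with the mask of the cycle. This vector solves the system of the check, so [solveP] yields a
    partition into even cycles. *)
Lemma label_checkP El Os Ds w : label_check (size xs) El Os Ds ->
  ~~ wodd w (label_edges El) -> all (fun l => wodd w (label_edges l)) Os ->
  dec w (label_edges El).
Proof.
case/and4P=> okDs uE okOs sol ev od.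
pose g : pred (nat * nat) := fun E => w [set nth x0 xs E.1; nth x0 xs E.2].
have wg l : wodd w (label_edges l) = odd (count g l) by rewrite /wodd count_map.
have uc D c : D \in Ds -> c \in D -> uniq (pair_cycle c) /\ {subset pair_cycle c <= El}.
  move=> DDs cD; have /andP[_ e] := allP okDs D DDs; split; last first.
    by move=> E Ec; rewrite -(perm_mem e); apply/flatten_mapP; exists c.
  have: uniq (flatten (map pair_cycle D)) by rewrite (perm_uniq e).
  by apply: subseq_uniq; case/splitPr: cD => s1 s2; rewrite map_cat flatten_cat /=;
    apply: (subseq_trans (prefix_subseq _ (flatten (map pair_cycle s2)))); apply: suffix_subseq.
have size_edge_mask l : size (edge_mask El l) = size (map g El) by rewrite !size_map.
have : has (all (fun v => ~~ dot v (map g El)))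
    (map (map (fun c => edge_mask El (pair_cycle c))) Ds).
  apply: (solveP sol); last first.
    by apply/allP=> I /mapP[D _ ->]; apply/allP=> v /mapP[c _ ->]; rewrite size_edge_mask.
  elim: {sol} Os okOs od => [_ _|l Os IH] /=.
    apply: add_eqnP; rewrite ?size_nseq ?size_map //.
      by elim: (El) => //= E l ->.
    rewrite wg in ev; apply: negbTE; move: ev; congr (~~ _).
    by elim: (El) => //= E l <-; rewrite oddD oddb.
  case/andP=> /andP[ul sl] okOs /andP[ol od]; apply: add_eqnP; first exact: IH.
    exact: size_edge_mask.
  by rewrite dot_edge_mask //; [rewrite -wg | apply/allP].
case/hasP=> I /mapP[D DDs ->] ok.
have /andP[okD eD] := allP okDs D DDs.
exists (map (map (nth x0 xs)) D).
  rewrite all_map; apply/allP=> c cD /=; have /and3P[uc1 sc bc] := allP okD c cD.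
  rewrite /cyc size_map sc andbT map_inj_in_uniq ?uc1 /=; last first.
    by move=> i j /(allP bc) ic /(allP bc) jc /eqP; rewrite nth_uniq // => /eqP.
  move: ok; rewrite all_map => /allP/(_ c cD) /=.
  by have [u s] := uc _ _ DDs cD; rewrite dot_edge_mask // label_edges_cycle wg.
have -> : flatten (map cedges (map (map (nth x0 xs)) D)) = label_edges (flatten (map pair_cycle D)).
  by elim: D {DDs okD eD ok} => //= c D ->; rewrite label_edges_cycle /label_edges map_cat.
by apply: perm_map.
Qed.

End Realize.

Record labelled_base := LabelledBase {
  base_order : nat;
  base_edges : seq (nat * nat);
  base_decs : seq (seq (seq nat))
}.

(* The vertices are single digits, and a word lists the vertices of an edge or of a cycle. *)
Fixpoint words (s : string) : seq (seq nat) :=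
  if s is String a s' then
    let ws := words s' in let d := nat_of_ascii a in
    if d < 48 then [::] :: ws else ((d - 48) :: head [::] ws) :: behead ws
  else [:: [::]].

Definition parse_base (n : nat) (es : string) (ds : seq string) :=
  LabelledBase n [seq (nth 0 e 0, nth 0 e 1) | e <- words es] (map words ds).

(** The names consist of [K5], or [K5s] for the subdivided graph, and the labels of the common
    neighbours of each added pair of twins. The twins are adjacent exactly when the number of these
    neighbours is odd, as even degrees demand. The edges come first; each further string is one
    partition. *)
Definition base_K501 := Eval vm_compute in parse_base 7
  "01 02 03 04 05 06 12 13 14 15 16 23 24 34"
  [:: "01423 0216 04315"; "01234 02413 0516"; "01324 0215 03416"; "015 024316 03214";
  "0142 0315 043216"; "0123 02415 04316"; "016 023415 03124"; "0134 02416 03215";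
  "01342 03216 0415"; "01423 02134 0516"; "01243 02315 0416"]%string.

Definition base_K5012 := Eval vm_compute in parse_base 7
  "01 02 03 04 05 06 12 13 14 15 16 23 24 25 26 34 56"
  [:: "0134265 02516 03214"; "0134256 02614 03215"; "0143256 02615 03124"; "0143265 0216 031524";
  "0165243 02315 04126"; "0165234 0213 051426"; "0156243 0214 052316"; "015234 02416 031265";
  "013426 02165 032514"; "01562 034216 041325"; "01243 023156 041625"; "013256 02143 042615";
  "013265 0243 0416 125"; "016243 02514 056 123"; "0143256 024 0315 126"; "0134256 0215 032614";
  "01562 034125 042316"]%string.

Definition base_K50123 := Eval vm_compute in parse_base 7
  "01 02 03 04 05 06 12 13 14 15 16 23 24 25 26 34 35 36"
  [:: "0163524 023415 03126"; "0152436 02613 041235"; "0152634 024135 03216";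
  "0153426 023614 03125"; "0153624 02143 052316"; "0162534 024136 03215"; "0143625 02153 042316";
  "0163425 02314 035126"; "015263 023416 042135"; "014253 021634 051326"; "012435 025136 032614";
  "0142635 02513 043216"; "013425 026153 041236"; "0162435 02136 032514"; "014325 021536 031624";
  "015342 036125 041326"; "0143526 024 03215 136"; "0162435 02514 036 123";
  "0163524 02315 034126"]%string.

Definition base_K501234 := Eval vm_compute in parse_base 7
  "01 02 03 04 05 06 12 13 14 15 16 23 24 25 26 34 35 36 45 46 56"
  [:: "0132564 0241635 0345126"; "0123456 0246135 0362514"; "0164523 0214356 0426315";
  "0146235 0215436 0316524"; "0145632 0315264 0534216"; "0152364 0245613 0534126";
  "0153246 0265413 0436125"; "0154632 0352416 0431265"; "0132465 0254163 0435126";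
  "0156432 0352614 0542136"; "0145362 0316425 0432156"; "0146325 0213456 0351624";
  "0145263 0216435 0423156"; "0123645 0261534 0314256"; "0135426 0251463 0432165";
  "0124365 0235146 0316254"; "0142635 0234516 0312564"; "0156243 023645 0416 1253";
  "0143625 021546 0324 1356"; "0123546 026134 0365 1425"; "0153264 025416 0365 1243";
  "0143562 0312546 0423615"; "0153462 031456 0425 1236"; "0165342 032546 0415 1263";
  "0135246 026543 0415 1236"]%string.

Definition base_K5s04 := Eval vm_compute in parse_base 8
  "01 02 03 05 06 07 12 13 14 23 24 34 45 46 47"
  [:: "012346 02413 0547"; "013245 02143 0647"; "012345 0246 03147"; "012347 0245 03146";
  "012346 0247 03145"; "012347 02413 0546"; "01243 023145 0647"; "01432 031245 0647";
  "01345 02147 03246"]%string.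

Definition base_K5s014 := Eval vm_compute in parse_base 8
  "01 02 03 05 06 07 12 13 14 16 17 23 24 34 45 46 47 67"
  [:: "0176432 031245 06147"; "0123476 024617 03145"; "016745 024317 032146";
  "0132467 02145 034716"; "0123467 02413 054716"; "0132476 021645 03417"; "0176423 021347 05416";
  "013245 021746 034167"; "017643 023145 061247"; "012346 0247613 05417"; "012347 024176 031645";
  "0167432 03146 054217"; "012476 02345 0317 146"; "0176423 0216 0547 134"; "01423 0213476 054617";
  "012345 0247613 06417"; "017645 02413 0612347"]%string.

Definition base_K5s045 := Eval vm_compute in parse_base 8
  "01 02 03 05 06 07 12 13 14 23 24 34 45 46 47 56 57 67"
  [:: "01234576 02413 05647"; "01234756 0245 031467"; "01324756 02143 05467";
  "01234657 02476 03145"; "0124657 02345 031476"; "01324576 02147 03465"; "01324576 021465 0347";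
  "01423 02134765 06457"; "01324657 02143 05476"; "0123467 024756 03145"; "0123467 02456 031475";
  "01234675 0247 031456"; "01432 03124567 05746"; "01234765 0246 031457"; "01234765 02413 06457";
  "014657 0243 05476 123"]%string.

Definition base_K5s0124 := Eval vm_compute in parse_base 8
  "01 02 03 05 06 07 12 13 14 16 17 23 24 26 27 34 45 46 47"
  [:: "0164327 024713 054126"; "0134726 024617 032145"; "0172346 02147 0316245";
  "0172645 021347 032416"; "0132647 027143 054216"; "0132746 026145 034217";
  "0174326 02413 0546127"; "0162345 027146 031247"; "0132645 021743 061427";
  "0162745 021346 032417"; "0172643 023145 061247"; "0174623 02416 0543127";
  "017245 021643 0623147"; "014623 024317 0547216"; "012647 0271345 032416";
  "016472 034126 0542317"; "0162745 023417 031246"; "0162347 02145 0317246";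
  "0132745 021643 062417"]%string.

Definition base_K5s1235 := Eval vm_compute in parse_base 8
  "01 02 03 05 12 13 14 16 17 23 24 26 27 34 36 37 45 56 57"
  [:: "01627543 02417365 123"; "01726543 0241375 1236"; "01627345 02413 123657";
  "01734562 0361275 1324"; "01624573 0271365 1234"; "01457362 0327165 1243";
  "01754362 0324165 1273"; "01437265 02163 132457"; "01427365 02613 123457";
  "01657243 0237145 1263"; "01637245 02143 132657"; "01456372 032175 13426";
  "01736245 023 12756 134"; "01426375 0216543 1327"; "0137245 02657143 1236";
  "0127563 0261345 14237"; "0143275 0245613 12637"; "01754263 02734165 123";
  "01657243 02145 137 236"]%string.

Definition base_K5s01234 := Eval vm_compute in parse_base 8
  "01 02 03 05 06 07 12 13 14 16 17 23 24 26 27 34 36 37 45 46 47 67"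
  [:: "01327645 0216347 0371426"; "01276345 0264137 0324716"; "01736245 0231647 0341276";
  "01326745 0217346 0361427"; "01273645 0231476 0342617"; "01726345 0237416 0312467";
  "01762345 0213647 0372416"; "01672345 0213746 0362417"; "01372645 0243617 0321476";
  "01723645 0243167 0374126"; "01362745 0214376 0324617"; "0134627 02163745 0324176";
  "0134762 03721645 0632417"; "01372645 0217436 0324167"; "01732645 0216743 0631427";
  "0164273 02367145 0621347"; "01673245 0274136 0346217"; "01237645 024713 0627 1436";
  "0147326 0271643 05421367"; "0134267 027463 05416 1237"; "0143627 02317645 0374216";
  "0173245 0274316 0367 1264"; "0126745 0241637 0346 1327"; "01637245 0213476 0326417";
  "0127645 023147 03716 2436"]%string.

Definition base_K5s01235 := Eval vm_compute in parse_base 8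
  "01 02 03 05 06 07 12 13 14 16 17 23 24 26 27 34 36 37 45 56 57 67"
  [:: "01432675 02456173 063127"; "01754362 03142765 061237"; "01423657 02761345 037126";
  "01276345 02413756 032617"; "01243756 02367145 031627"; "01457632 0371265 0613427";
  "01756243 027316 05412367"; "01345726 0241763 0561237"; "01263457 0237165 0314276";
  "01657342 036217 05413276"; "01243657 02376145 031726"; "01432675 021637 03172456";
  "01634572 03241765 062137"; "01263457 0241673 056 1327"; "01234576 026173 05631427";
  "01342756 023617 03762145"; "01756342 037216 05413267"; "01657243 021367 05417326"]%string.

Definition base_K5s012345 := Eval vm_compute in parse_base 8
  "01 02 03 05 06 07 12 13 14 16 17 23 24 26 27 34 36 37 45 46 47 56 57"
  [:: "01437562 0324617 05472136"; "01657342 03172645 0632147"; "01426375 0231746 03456127";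
  "01465723 02631745 0612437"; "01372456 02163475 0326417"; "01732465 02754316 0362147";
  "01365427 02346175 0374126"; "01475632 0346217 05427316"; "01756432 03612745 0624137";
  "01247365 02754613 0623417"; "01734265 02754136 0321647"; "01654237 02634175 0312746";
  "01274563 02614375 0642317"; "01236547 02461375 0341726"; "01732456 02136475 0341627";
  "01473265 02457163 0643127"; "01273456 0236417 03162475"; "01657342 0314627 05471236";
  "01465732 03162745 0634217"; "01246573 0236145 0627 1347"; "01345627 02416375 0321746";
  "0123657 02613745 0346 1427"; "01754326 0274163 05642137"]%string.

Definition base_K5012_012 := Eval vm_compute in parse_base 9
  "01 02 03 04 05 06 07 08 12 13 14 15 16 17 18 23 24 25 26 27 28 34 56 78"
  [:: "0178234 024165 031527 06218"; "0187234 025617 031428 05126"; "0143256 02618 031724 051287";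
  "0165234 02413 0517826 07218"; "0165243 023187 04126 051728"; "0156234 024178 031827 05216";
  "0178234 02413 056218 061527"; "0178234 026513 052416 07218"; "0156243 02178 041327 052816";
  "0143287 025613 042718 05126"; "0134278 028165 03214 062517"; "0178243 02314 056127 062518";
  "0187243 023156 041625 07128"; "0165278 024317 032814 05126"; "0134278 02817 032615 041256";
  "0178256 026143 042318 05127"; "0134265 025187 03214 061728"; "0156278 02416 031825 043217";
  "0156287 023418 03124 052716"; "0143265 028716 031527 04218"; "0134256 028715 032618 04127";
  "0134256 028714 03215 072618"; "0156243 023178 041825 06127"; "0187256 02143 042615 071328";
  "0134287 027156 03218 041625"; "0143265 027813 042516 07128"; "0143278 02816 0315624 05217";
  "0187234 02415 031256 071628"; "0134278 02516 03217 0418265"; "018265 023416 031527 042178";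
  "014327 0256178 031826 04215"; "0143278 02516 031265 042817"; "0165234 027815 031426 07128";
  "0143256 027813 042617 05128"; "014278 025613 0432815 06217"; "0156278 02817 032416 043125";
  "017825 0265134 032416 07218"; "0165234 028713 05127 062418"]%string.

Definition base_K5s014_014 := Eval vm_compute in parse_base 10
  "01 02 03 05 06 07 08 09 12 13 14 16 17 18 19 23 24 34 45 46 47 48 49 67 89"
  [:: "0198476 0234617 031245 08149"; "0198432 0316745 064217 08149";
  "0176432 031845 0612498 07419"; "0176498 0234819 031247 05416"; "0132498 0216743 054819 06417";
  "0132467 0219843 054718 06149"; "0198467 023145 034216 081749"; "0123467 0247198 03149 054816";
  "0198432 0317649 054218 06147"; "0189432 0312467 054716 08419"; "0198423 021345 067149 074618";
  "0176432 0319845 061249 07418"; "0189476 0234619 031245 07148"; "0189467 0234716 031248 05419";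
  "0123489 0247618 031946 05417"; "0167489 0234918 03146 054217"; "0167432 031245 064189 071948";
  "0167432 031849 0542198 06417"; "0189423 021467 054316 084719"; "012349 0247613 054198 064817";
  "0132476 0219845 034618 07149"; "0123498 024813 054176 074619"; "016748 02349817 031245 06419";
  "0189432 0312476 054617 08419"; "0176432 0318947 05416 084219"; "0123476 024198 031645 071849";
  "0198467 023416 031745 081249"; "013245 02167498 034819 06417"; "013498 0216745 032417 064819";
  "0176432 031498 054216 074819"; "0167498 0231846 03417 054219"; "0198432 031476 054618 071249";
  "0123489 024613 0549176 07418"; "0189423 0216748 054317 06419"; "019842 0321476 054617 081349";
  "0132489 0216743 054917 06418"; "0167489 0231946 0345 0718 124"; "0189476 023145 034617 084219";
  "0132489 021476 034917 054618"; "0176489 021347 03245 0618 149"]%string.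

Definition base_K5s014_045 := Eval vm_compute in parse_base 10
  "01 02 03 05 06 07 08 09 12 13 14 16 17 23 24 34 45 46 47 48 49 58 59 67 89"
  [:: "01324985 0217459 03467 06148"; "01234958 024167 031745 06489";
  "01764985 023147 0348 0612459"; "01324859 02176498 03416 0547"; "01234985 024713 061459 07648";
  "01674598 0213485 032417 0649"; "01324589 0216743 05948 06417"; "01674895 021349 03246 071458";
  "01234598 024613 058476 07149"; "01674985 023417 031246 08459"; "01234895 024716 031467 08549";
  "01764895 0213458 032416 0749"; "0123489 0247613 05417 064958"; "01674589 021346 03248 059417";
  "01324958 0216743 0546 071489"; "01764598 023485 031249 06147"; "01674958 0231489 0345 064217";
  "01674958 02143 0542317 06489"; "01764859 023145 0347 0612498"; "0167489 02134958 03245 06417";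
  "01764958 0213489 03247 05416"; "01234859 0247613 0546 071498"; "0124859 023167498 0346 05417";
  "01234589 02467 031495 061748"; "0176489 02314958 034216 0547"; "01324859 0217643 05498 06147";
  "01674958 02345 0312489 06417"; "0167498 0214859 03246 054317"; "01764958 023416 0312489 0547";
  "01764859 024316 032147 05498"; "01234958 02467 03145 0617489"; "01324895 0216749 03417 06458";
  "0174859 0234167 031245 06498"; "01764859 02413 0543216 07498"; "0176489 02134958 03247 05416";
  "0176459 0213498 03247 058416"; "01674895 02143 0642317 08549"; "01324958 0216489 03417 05476";
  "0176458 0213489 032416 05947"; "01324589 02176495 0348 06147"]%string.

Definition base_K5s045_045 := Eval vm_compute in parse_base 10
  "01 02 03 05 06 07 08 09 12 13 14 23 24 34 45 46 47 48 49 56 57 58 59 67 89"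
  [:: "0132476589 0214957 0345 0648"; "0132476598 021485 0346 07549";
  "0132498567 021459 0348 05746"; "0132489576 021458 03465 0749"; "0132467598 0214856 0349 0547";
  "0132467589 0214956 0347 0548"; "0123467589 024956 03145 0748"; "0123489576 02458 03147 05649";
  "0123498567 024759 03148 0546"; "0123498576 02413 05647 08459"; "0123476589 0245 03146 075948";
  "0132498576 02147 03459 05648"; "0123467598 0247 0314856 0549"; "012348567 0247598 03145 0649";
  "0132498576 021465 0348 07459"; "0123476589 0246 0314957 0548"; "012348956 02413 05749 076458";
  "0132467589 02143 05947 06548"; "0123467589 0248 0314956 0547"; "0123498567 02459 03146 05748";
  "0123476589 024957 03148 0546"; "013489576 024658 032145 0749"; "0123498567 02475 031459 0648";
  "0123476598 02457 03149 05846"; "0132498576 02148 034659 0547"; "0132467598 02145 0347 065849";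
  "0123489567 02413 05746 08549"; "013248567 0214759 03498 0546"; "012347589 024956 031467 0548";
  "0123498576 02459 031465 0748"; "0123498567 0248 031475 06459"; "012346598 024857 03149 05476";
  "012467589 0234956 03148 0547"; "0132467598 021456 03485 0749"; "0123489576 0249 031458 05647";
  "0132467589 02147 0348 056 459"; "0132489576 02147 0349 058 456";
  "012349576 0246589 03148 0547"]%string.

(** The union of the paths at two pairs of adjacent twins with three common neighbours each, all of
    them shared by the pairs; in [base_Q2] exactly two are shared. *)
Definition base_D1 := Eval vm_compute in parse_base 7
  "01 04 05 06 12 13 14 24 25 26 34 35 36 56"
  [:: "0143526 0421365"; "0136524 0534126"; "0134265 0412536"; "0124365 0413526"; "0134256 0412635";
  "0143625 0421356"; "014265 0436 1253"]%string.

Definition base_Q2 := Eval vm_compute in parse_base 8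
  "01 04 05 07 12 13 14 24 25 27 34 56 57 67"
  [:: "01342765 041257"; "0134257 0412765"; "0142567 0431275"; "01342567 041275";
  "0124 0527 134 567"]%string.

Definition single_table :=
  [:: base_K501; base_K5012; base_K50123; base_K501234; base_K5s04; base_K5s014;
   base_K5s045; base_K5s0124; base_K5s1235; base_K5s01234; base_K5s01235;
   base_K5s012345].

Definition double_table :=
  [:: base_K5012_012; base_K5s014_014; base_K5s014_045; base_K5s045_045].

Definition incident (El : seq (nat * nat)) (p q : nat) :=
  [seq E <- El | [|| E.1 == p, E.2 == p, E.1 == q | E.2 == q]].

Definition base_check (Os : nat -> seq (nat * nat) -> seq (seq (nat * nat))) (B : labelled_base) :=
  let El := base_edges B in let n := base_order B in
  all (fun E => E.1 < E.2 < n) El && label_check n El (Os n El) (base_decs B).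

Definition no_odd (n : nat) (El : seq (nat * nat)) : seq (seq (nat * nat)) := [::].

(* In the graphs of [double_table] the last four vertices form two pairs of true twins. *)
Definition last_pairs (n : nat) (El : seq (nat * nat)) :=
  [:: incident El (n - 4) (n - 3); incident El (n - 2) (n - 1)].

Lemma single_table_ok : all (base_check no_odd) single_table.
Proof. by vm_compute. Qed.

Lemma double_table_ok : all (base_check last_pairs) double_table.
Proof. by vm_compute. Qed.

Lemma base_D1_ok : base_check no_odd base_D1.
Proof. by vm_compute. Qed.

Lemma base_Q2_ok : base_check no_odd base_Q2.
Proof. by vm_compute. Qed.

(* Short-circuiting variants: call-by-value reduction evaluates both sides of [||] and [&&]. *)
Fixpoint lhas (T : Type) (p : pred T) (s : seq T) :=
  if s is x :: s' then if p x then true else lhas p s' else false.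

Fixpoint lall (T : Type) (p : pred T) (s : seq T) :=
  if s is x :: s' then if p x then lall p s' else false else true.

Lemma lhasE T (p : pred T) s : lhas p s = has p s.
Proof. by elim: s => //= x s ->; case: (p x). Qed.

Lemma lallE T (p : pred T) s : lall p s = all p s.
Proof. by elim: s => //= x s ->; case: (p x). Qed.

Definition label_adj (El : seq (nat * nat)) (i j : nat) :=
  lhas (fun E => (eqn E.1 i && eqn E.2 j) || (eqn E.1 j && eqn E.2 i)) El.

Definition adj_rows (n : nat) (El : seq (nat * nat)) : seq (seq bool) :=
  [seq [seq label_adj El i j | j <- iota 0 n] | i <- iota 0 n].

Definition row_adj (M : seq (seq bool)) (i j : nat) := nth false (nth [::] M i) j.

Definition has_p4 (n : nat) (M : seq (seq bool)) :=
  let vs := iota 0 n in let adj := row_adj M in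
  lhas (fun a => lhas (fun b => if adj a b then
    lhas (fun c => if adj b c && ~~ adj a c then
      lhas (fun d => [&& adj c d, ~~ adj a d & ~~ adj b d]) vs else false) vs else false) vs) vs.

Definition relabelling (n : nat) (M : seq (seq bool)) (El' : seq (nat * nat)) (p : seq nat) :=
  lall (fun i => lall (fun j => label_adj El' i j == row_adj M (nth 0 p i) (nth 0 p j))
      (iota 0 i)) (iota 0 n).

(** [m] is the number of edges; comparing the orders and sizes first saves most of the relabelling
    tests. *)
Definition in_table (tbl : seq labelled_base) (ps : seq (seq nat)) (n m : nat) (M : seq (seq bool)) :=
  lhas (fun B => if eqn (base_order B) n && eqn (size (base_edges B)) m then
    lhas (fun p => if [&& uniq p, size p == n & all (gtn n) p]
      then relabelling n M (base_edges B) p else false) ps else false) tbl.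

Fixpoint bitseqs (k : nat) : seq (seq bool) :=
  if k is k'.+1 then map (cons false) (bitseqs k') ++ map (cons true) (bitseqs k') else [:: [::]].

Definition twin_edges (n : nat) (N : seq nat) (t : bool) : seq (nat * nat) :=
  [seq (i, n) | i <- N] ++ [seq (i, n.+1) | i <- N] ++ (if t then [:: (n, n.+1)] else [::]).

Definition K5_labels : seq (nat * nat) :=
  [:: (0,1); (0,2); (0,3); (0,4); (1,2); (1,3); (1,4); (2,3); (2,4); (3,4)].

(* The vertices 0 and 4 are the ends of the edge that is subdivided by the vertex 5. *)
Definition K5s_labels : seq (nat * nat) :=
  [:: (0,1); (0,2); (0,3); (0,5); (1,2); (1,3); (1,4); (2,3); (2,4); (3,4); (4,5)].

(** As [K5] is fully symmetric, the table has one graph for each size of [N], attached to the first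
    labels; moving [N] to the front is the only relabelling to be tried. *)
Definition K5_perms (N : seq nat) := [:: N ++ filter [predC N] (iota 0 5)].

(** The twelve automorphisms of the subdivided graph: the ends 0 and 4 may be swapped, 1, 2, 3
    permuted, and 5 is fixed. *)
Definition K5s_perms : seq (seq nat) :=
  [seq a.1 :: b ++ [:: a.2; 5] | a <- [:: (0,4); (4,0)],
    b <- [:: [:: 1;2;3]; [:: 1;3;2]; [:: 2;1;3]; [:: 2;3;1]; [:: 3;1;2]; [:: 3;2;1]]].

(** Runs over all pairs of twins with at least two common neighbours. Even degrees make them
    adjacent exactly when [N] is odd, and a graph with an induced path on four vertices needs no
    entry in the table. *)
Definition single_ok (k : nat) (El : seq (nat * nat)) (ps : seq nat -> seq (seq nat)) :=
  lall (fun bs => let N := mask bs (iota 0 k) in if size N < 2 then true else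
    let El' := El ++ twin_edges k N (odd (size N)) in let M := adj_rows k.+2 El' in
    if has_p4 k.+2 M then true else
    in_table single_table [seq p ++ [:: k; k.+1] | p <- ps N] k.+2 (size El') M)
  (bitseqs k).

Lemma K5_single_ok : single_ok 5 K5_labels K5_perms.
Proof. by vm_compute. Qed.

Lemma K5s_single_ok : single_ok 6 K5s_labels (fun _ => K5s_perms).
Proof. by vm_compute. Qed.

Definition triples (k : nat) := [seq N <- [seq mask bs (iota 0 k) | bs <- bitseqs k] | size N == 3].

Definition double_edges (k : nat) (El : seq (nat * nat)) (N M : seq nat) :=
  El ++ twin_edges k N true ++ twin_edges k.+2 M true.

(** Only triples with two common members arise in the induction. The relabellings fix the four new
    vertices, so the two pairs are tried in both orders. *)
Definition double_ok (k : nat) (El : seq (nat * nat)) (ps : seq nat -> seq (seq nat)) :=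
  let in_tbl N N' := let El' := double_edges k El N N' in
    in_table double_table [seq p ++ [:: k; k.+1; k.+2; k.+3] | p <- ps N] k.+4 (size El')
      (adj_rows k.+4 El') in
  lall (fun N => lall (fun N' => if count [in N] N' < 2 then true else
    if has_p4 k.+4 (adj_rows k.+4 (double_edges k El N N')) then true else
    if in_tbl N N' then true else in_tbl N' N)
    (triples k)) (triples k).

Lemma K5_double_ok : double_ok 5 K5_labels K5_perms.
Proof. by vm_compute. Qed.

Lemma K5s_double_ok : double_ok 6 K5s_labels (fun _ => K5s_perms).
Proof. by vm_compute. Qed.

(** * Parallel paths and exchanges of arcs *)

Lemma uniq_flatten_map (A B : eqType) (F : A -> seq B) (s : seq A) :
  uniq s -> {in s, forall a, uniq (F a)} ->
  {in s &, forall a a' b, b \in F a -> b \in F a' -> a = a'} ->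
  uniq (flatten (map F s)).
Proof.
elim: s => //= a s IH /andP[as_ us] uF dF; rewrite cat_uniq uF ?mem_head //=.
rewrite IH // ?andbT; first last.
- by move=> c d cs ds; apply: dF; rewrite inE ?cs ?ds orbT.
- by move=> c cs; apply: uF; rewrite inE cs orbT.
apply/hasPn=> b /flatten_mapP[c cs bc]; apply: contra as_ => ba.
by rewrite (dF a c _ _ b) // inE ?eqxx ?cs ?orbT.
Qed.

Lemma set2_eq (T : finType) (a b c d : T) :
  [set a; b] = [set c; d] -> (a = c /\ b = d) \/ (a = d /\ b = c).
Proof.
move=> e; have ha : a \in [set c; d] by rewrite -e !inE eqxx.
have hb : b \in [set c; d] by rewrite -e !inE eqxx orbT.
have hc : c \in [set a; b] by rewrite e !inE eqxx.
have hd : d \in [set a; b] by rewrite e !inE eqxx orbT.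
move: ha hb hc hd; rewrite !inE.
by case/orP=> /eqP->; case/orP=> /eqP->; rewrite ?eqxx ?orbb; auto; move=> *;
  match goal with H : is_true (_ == _) |- _ => move/eqP: H => -> end; auto.
Qed.

Section Theta.
Variables (T : finType) (u v : T).
Hypothesis uv : u != v.
Implicit Types (w : pred {set T}) (o : option T) (L : seq (option T)).

(* [None] stands for the edge [uv] and [Some y] for the path [u y v]. *)
Definition path_edges o : seq {set T} :=
  if o is Some y then [:: [set u; y]; [set v; y]] else [:: [set u; v]].

Definition theta L : seq {set T} := flatten (map path_edges L).

Definition theta_ok L := uniq L /\ forall y, Some y \in L -> (y != u) && (y != v).

Lemma theta_cat L1 L2 : theta (L1 ++ L2) = theta L1 ++ theta L2.
Proof. by rewrite /theta map_cat flatten_cat. Qed.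

Lemma perm_theta L1 L2 : perm_eq L1 L2 -> perm_eq (theta L1) (theta L2).
Proof. by move=> L12; apply: perm_flatten; apply: perm_map. Qed.

(** The two paths close up to a cycle of length 3 or 4. *)
Lemma dec_theta2 w o1 o2 : theta_ok [:: o1; o2] ->
  wodd w (path_edges o1) = wodd w (path_edges o2) -> dec w (theta [:: o1; o2]).
Proof.
have vu : v != u by rewrite eq_sym.
move=> [u12 ok] e; have ev : ~~ wodd w (theta [:: o1; o2]).
  by rewrite /theta /= cats0 wodd_cat e addbb.
suff [c cc ec] : exists2 c, cyc c & perm_eq (cedges c) (theta [:: o1; o2]).
  by apply: (perm_dec ec); apply: dec_cyc => //; rewrite (wodd_perm _ ec).
have ok1 y : o1 = Some y -> (y != u) && (y != v) by move=> h; apply: ok; rewrite -h !inE eqxx.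
have ok2 y : o2 = Some y -> (y != u) && (y != v) by move=> h; apply: ok; rewrite -h !inE eqxx orbT.
case: o1 o2 u12 ok1 ok2 {e ev ok} => [y|] [z|] // u12 ok1 ok2.
- have /andP[yu yv] := ok1 _ erefl; have /andP[zu zv] := ok2 _ erefl.
  have yz : y != z by move: u12; rewrite /= inE andbT; apply: contraNneq => ->.
  exists [:: u; y; v; z].
    by rewrite /cyc /= !inE !negb_or uv yz yv ![u == _]eq_sym yu zu [v == z]eq_sym zv.
  rewrite /theta /= (setUC [set y]) (setUC [set z]).
  by apply/permP=> q; rewrite /= ?addn0; lia.
- have /andP[yu yv] := ok1 _ erefl.
  exists [:: u; y; v]; first by rewrite /cyc /= !inE !negb_or uv yv ![u == _]eq_sym yu.
  by rewrite /theta /= (setUC [set y]) (setUC [set v] [set u]).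
- have /andP[zu zv] := ok2 _ erefl.
  exists [:: u; z; v]; first by rewrite /cyc /= !inE !negb_or uv zv ![u == _]eq_sym zu.
  rewrite /theta /= (setUC [set z]) (setUC [set v] [set u]).
  by apply/permP=> q; rewrite /= ?addn0; lia.
Qed.

Lemma theta_ok_sub L1 L2 : subseq L1 L2 -> theta_ok L2 -> theta_ok L1.
Proof.
move=> s [uL ok]; split; first exact: subseq_uniq s uL.
by move=> y /(mem_subseq s); apply: ok.
Qed.

Lemma dec_theta_const w b L : theta_ok L -> ~~ odd (size L) ->
  all (fun o => wodd w (path_edges o) == b) L -> dec w (theta L).
Proof.
elim: {L}(size L) {-2}L (leqnn (size L)) => [|n IH] [|o1 [|o2 L]] //= sz ok od;
  try by move=> *; apply: dec_nil.
case/and3P=> /eqP e1 /eqP e2 eL; rewrite -[_ :: _]/([:: o1; o2] ++ L) theta_cat.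
apply: dec_cat.
  apply: dec_theta2; last by rewrite e1.
  by apply: theta_ok_sub ok; rewrite -[X in subseq _ X]/([:: o1; o2] ++ L) prefix_subseq.
apply: IH => //; first by lia.
  by apply: theta_ok_sub ok; rewrite -[X in subseq _ X]/([:: o1; o2] ++ L) suffix_subseq.
by rewrite negbK in od.
Qed.

Lemma wodd_theta w L :
  wodd w (theta L) = odd (count (fun o => wodd w (path_edges o)) L).
Proof. by elim: L => //= o L IH; rewrite /theta /= wodd_cat IH oddD oddb. Qed.

(** Paths of equal parity are paired off. The number of odd paths is even because the total weight
    is, and hence the number of even paths is even too. *)
Lemma dec_theta w L : theta_ok L -> ~~ odd (size L) -> ~~ wodd w (theta L) ->
  dec w (theta L).
Proof.
set p := fun o => wodd w (path_edges o); rewrite wodd_theta -/p => ok sz od.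
have e : perm_eq (filter p L ++ filter (predC p) L) L by rewrite perm_filterC.
apply: (perm_dec (perm_theta e)); rewrite theta_cat.
have szp : size (filter p L) = count p L by rewrite size_filter.
have szn : size (filter (predC p) L) = size L - count p L.
  by rewrite size_filter -(count_predC p L) addKn.
apply: dec_cat.
  apply: (@dec_theta_const w true); first exact: theta_ok_sub (filter_subseq _ _) ok.
    by rewrite szp.
  by apply/allP=> o; rewrite mem_filter => /andP[/eqP].
apply: (@dec_theta_const w false); first exact: theta_ok_sub (filter_subseq _ _) ok.
  by rewrite szn oddB ?count_size // (negbTE sz) (negbTE od).
by apply/allP=> o; rewrite mem_filter => /andP[/negbTE ho _]; rewrite -/(p o) ho.
Qed.

Lemma uniq_theta L : theta_ok L -> uniq (theta L).
Proof.
move=> [uL ok]; apply: uniq_flatten_map => //.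
  move=> [y|] // yL; rewrite /= inE andbT; apply/eqP=> /set2_eq[[e _]|[_ e]].
    by move: uv; rewrite e eqxx.
  by have := ok _ yL; rewrite e eqxx andbF.
have N y z : Some z \in L -> [set u; y] <> [set v; z].
  by move=> /ok/andP[zu zv] /set2_eq[[e _]|[e _]]; [move: uv; rewrite e eqxx | rewrite e eqxx in zu].
have N2 z : Some z \in L -> [set u; z] <> [set u; v].
  by move=> /ok/andP[zu zv] /set2_eq[[_ e]|[_ e]]; [rewrite e eqxx in zv | rewrite e eqxx in zu].
have N3 z : Some z \in L -> [set v; z] <> [set u; v].
  by move=> /ok/andP[zu zv] /set2_eq[[_ e]|[_ e]]; [rewrite e eqxx in zv | rewrite e eqxx in zu].
move=> [y|] [z|] yL zL E //=; rewrite !inE.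
- case/orP=> /eqP-> /orP[] /eqP.
  + by case/set2_eq=> [[_ ->]|[-> <-]].
  + by move/N => /(_ zL).
  + by move/esym/N => /(_ yL).
  + by case/set2_eq=> [[_ ->]|[-> <-]].
- by case/orP=> /eqP-> /eqP; [move/N2 => /(_ yL) | move/N3 => /(_ yL)].
- by move/eqP->; case/orP=> /eqP/esym; [move/N2 => /(_ zL) | move/N3 => /(_ zL)].
Qed.

End Theta.

Lemma has_mem_cons (T : eqType) (s l : seq T) x :
  has [in s] (x :: l) = (x \in s) || has [in s] l.
Proof. by []. Qed.

Lemma has_mem_nil (T : eqType) (s : seq T) : has [in s] [::] = false.
Proof. by []. Qed.

Ltac uniq_facts :=
  rewrite /cyc; repeat first
    [ rewrite in_nil | rewrite in_cons | rewrite mem_cat | rewrite cons_uniq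
    | rewrite cat_uniq | rewrite has_mem_nil | rewrite has_mem_cons | rewrite size_cat
    | rewrite orbF | rewrite andbT ]; rewrite ?negb_or /=.
Ltac uniq_done :=
  repeat match goal with H : is_true (_ && _) |- _ => case/andP: H => ? ? end;
  repeat (apply/andP; split); try done; try (by rewrite eq_sym); try (by rewrite size_cat /= ?addnS).

(** Two edge lists are permutations of each other if every predicate has the same count in both. The
    counts of the pieces become variables, and linear arithmetic finishes. *)
Ltac count_edges :=
  let q := fresh in
  apply/permP=> q; rewrite ?count_cat /= ?count_cat /= ?count_cat /= ?count_cat /=;
  repeat match goal with
  | |- context [count q ?l] => move: (count q l) => ?
  | |- context [nat_of_bool (q ?E)] => move: (nat_of_bool (q E)) => ?
  end; clear; lia.

Ltac bool_cases w :=
  repeat match goal with |- context [odd (count w ?l)] => case: (odd (count w l)) end;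
  repeat match goal with |- context [w ?E] => case: (w E) end.

Section Exchange.
Variables (T : finType) (w : pred {set T}).
Implicit Types (u v x y n : T) (P Q : seq T).

(** The 4-cycle [u y v y'] is cut open: [u] closes the arc [P], and [v] closes the arc [Q]. The new
    cycles have even total weight, since the old cycle and the 4-cycle are both odd; so it suffices
    that one of them is even. *)
Lemma dec_exchange2_half u v y P y' Q : u != v -> cyc (y :: P ++ y' :: Q) ->
  u \notin y :: P ++ y' :: Q -> v \notin y :: P ++ y' :: Q ->
  wodd w (cedges (y :: P ++ y' :: Q)) ->
  wodd w (path_edges u v (Some y)) != wodd w (path_edges u v (Some y')) ->
  ~~ wodd w (cedges (u :: y :: P ++ [:: y'])) ->
  dec w (cedges (y :: P ++ y' :: Q) ++ theta u v [:: Some y; Some y']).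
Proof.
move=> uv cO uO vO oO dp ev.
have e : perm_eq (cedges (u :: y :: P ++ [:: y']) ++ cedges (v :: y' :: Q ++ [:: y]))
    (cedges (y :: P ++ y' :: Q) ++ theta u v [:: Some y; Some y']).
  rewrite (cedges_split u (y :: P)) (cedges_split v (y' :: Q)) cedges_split /theta /=.
  rewrite (setUC [set y'] [set u]) (setUC [set y] [set v]).
  by count_edges.
apply: (perm_dec e); apply: dec_cat; apply: dec_cyc => //.
- by move: cO uO vO; uniq_facts; move=> *; uniq_done.
- by move: cO uO vO; uniq_facts; move=> *; uniq_done.
have : wodd w (cedges (u :: y :: P ++ [:: y'])) (+) wodd w (cedges (v :: y' :: Q ++ [:: y])) = false.
  rewrite -wodd_cat (wodd_perm _ e) wodd_cat oO.
  by move: dp; rewrite /path_edges /theta /= !wodd_cons /wodd /=; bool_cases w.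
by rewrite (negbTE ev) addFb => ->.
Qed.

Lemma theta_swap u v L : perm_eq (theta u v L) (theta v u L).
Proof.
rewrite /theta; elim: L => //= [[y|] L IH] /=.
  by rewrite (perm_catCA [:: _] [:: _]) /= !perm_cons.
by rewrite setUC perm_cons.
Qed.

(** The cycles that close [P] through [u] and through [v] differ by the odd 4-cycle [u y v y'], so
    exactly one of them is even. Swapping [u] and [v] if necessary makes it the one through [u]. *)
Lemma dec_exchange2 u v y P y' Q : u != v -> cyc (y :: P ++ y' :: Q) ->
  u \notin y :: P ++ y' :: Q -> v \notin y :: P ++ y' :: Q ->
  wodd w (cedges (y :: P ++ y' :: Q)) ->
  wodd w (path_edges u v (Some y)) != wodd w (path_edges u v (Some y')) ->
  dec w (cedges (y :: P ++ y' :: Q) ++ theta u v [:: Some y; Some y']).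
Proof.
move=> uv cO uO vO oO dp.
case: (boolP (wodd w (cedges (u :: y :: P ++ [:: y'])))) => [od|]; last exact: dec_exchange2_half.
apply: (@perm_dec _ _ (cedges (y :: P ++ y' :: Q) ++ theta v u [:: Some y; Some y'])).
  by rewrite perm_cat2l theta_swap.
apply: dec_exchange2_half => //; first by rewrite eq_sym.
  by move: dp; rewrite /path_edges !wodd_cons /wodd /= !addbF (addbC (w [set v; y])) (addbC (w [set v; y'])).
move: od dp; rewrite (cedges_split u (y :: P)) (cedges_split v (y :: P)) /= !wodd_cons !wodd_cat.
rewrite !wodd_cons /wodd /= (setUC [set y'] [set u]) (setUC [set y'] [set v]).
by bool_cases w.
Qed.

(** Closing [P] by [y' v u y] instead of [y' u y] flips its parity, because the path through [y']
    and the edge [uv] differ in parity. The second cycle runs along [Q] and returns from [y] to [y']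
    through [v], [n], [u], so [n] may lie on [P] but not on [Q]. *)
Lemma dec_exchange3_half u v y P y' Q n : u != v -> cyc (y :: P ++ y' :: Q) ->
  u \notin y :: P ++ y' :: Q -> v \notin y :: P ++ y' :: Q ->
  wodd w (cedges (y :: P ++ y' :: Q)) ->
  wodd w (path_edges u v (Some y)) = wodd w (path_edges u v (Some y')) ->
  wodd w (path_edges u v (Some y)) = wodd w (path_edges u v (Some n)) ->
  wodd w (path_edges u v (Some y)) != wodd w (path_edges u v None) ->
  [&& n != u, n != v, n != y, n != y' & n \notin Q] ->
  wodd w (cedges (u :: y :: P ++ [:: y'])) ->
  dec w (cedges (y :: P ++ y' :: Q) ++ theta u v [:: None; Some y; Some y'; Some n]).
Proof.
move=> uv cO uO vO oO p1 p2 p3 nok od.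
have e : perm_eq (cedges (u :: y :: P ++ [:: y'; v]) ++ cedges (u :: y' :: Q ++ [:: y; v; n]))
    (cedges (y :: P ++ y' :: Q) ++ theta u v [:: None; Some y; Some y'; Some n]).
  rewrite (cedges_split u (y :: P)) (cedges_split u (y' :: Q)) cedges_split /theta /=.
  rewrite (setUC [set y'] [set v]) (setUC [set y] [set v]) (setUC [set v] [set u]).
  by rewrite (setUC [set n] [set u]); count_edges.
have ev : ~~ wodd w (cedges (u :: y :: P ++ [:: y'; v])).
  move: od p1 p3; rewrite (cedges_split u (y :: P)) (cedges_split u (y :: P) y' [:: v]) /=.
  rewrite !wodd_cons !wodd_cat !wodd_cons (setUC [set y'] [set v]) (setUC [set v] [set u]).
  rewrite (setUC [set y'] [set u]) /wodd /=.
  by bool_cases w.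
apply: (perm_dec e); apply: dec_cat; apply: dec_cyc => //.
- by move: cO uO vO nok; uniq_facts; move=> *; uniq_done.
- by move: cO uO vO nok; uniq_facts; move=> *; uniq_done.
have : wodd w (cedges (u :: y :: P ++ [:: y'; v])) (+) wodd w (cedges (u :: y' :: Q ++ [:: y; v; n])) = false.
  rewrite -wodd_cat (wodd_perm _ e) wodd_cat oO.
  by move: p1 p2 p3; rewrite /path_edges /theta /= !wodd_cons /wodd /=; bool_cases w.
by rewrite (negbTE ev) addFb => ->.
Qed.

(** Closed through [u], exactly one of the arcs [P] and [Q] is odd, since the whole cycle is. The
    odd arc takes the edge [uv], and the third vertex has to avoid the other arc; hence one
    candidate for each arc. *)
Lemma dec_exchange3 u v y P y' Q n1 n2 : u != v -> cyc (y :: P ++ y' :: Q) ->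
  u \notin y :: P ++ y' :: Q -> v \notin y :: P ++ y' :: Q ->
  wodd w (cedges (y :: P ++ y' :: Q)) ->
  {in [:: y'; n1; n2], forall z, wodd w (path_edges u v (Some y)) = wodd w (path_edges u v (Some z))} ->
  wodd w (path_edges u v (Some y)) != wodd w (path_edges u v None) ->
  [&& n1 != u, n1 != v, n1 != y, n1 != y' & n1 \notin P] ->
  [&& n2 != u, n2 != v, n2 != y, n2 != y' & n2 \notin Q] ->
  exists2 n, n \in [:: n1; n2] &
    dec w (cedges (y :: P ++ y' :: Q) ++ theta u v [:: None; Some y; Some y'; Some n]).
Proof.
move=> uv cO uO vO oO pp p0 ok1 ok2.
have p1 := pp y'; have pn1 := pp n1; have pn2 := pp n2.
case: (boolP (wodd w (cedges (u :: y :: P ++ [:: y'])))) => od.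
  exists n2; rewrite ?inE ?eqxx ?orbT //.
  by apply: dec_exchange3_half => //; [apply: p1 | apply: pn2]; rewrite !inE eqxx ?orbT.
exists n1; rewrite ?inE ?eqxx ?orbT //.
have eO : perm_eq (cedges (y' :: Q ++ y :: P)) (cedges (y :: P ++ y' :: Q)).
  by rewrite -!cat_cons cedges_catC.
have mO : y' :: Q ++ y :: P =i y :: P ++ y' :: Q.
  by move=> z; rewrite -!cat_cons !mem_cat orbC.
apply: (@perm_dec _ _ (cedges (y' :: Q ++ y :: P) ++ theta u v [:: None; Some y'; Some y; Some n1])).
  apply: perm_cat => //; apply: perm_theta; rewrite perm_cons.
  by rewrite (perm_catCA [:: _] [:: _]).
have h : wodd w (path_edges u v (Some y')) = wodd w (path_edges u v (Some y)).
  by rewrite p1 // !inE eqxx.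
apply: dec_exchange3_half; rewrite ?mO ?(wodd_perm _ eO) ?h //.
- move: cO; rewrite /cyc -!cat_cons uniq_catC.
  by rewrite !size_cat addnC.
- by apply: pn1; rewrite !inE eqxx orbT.
- by case/and5P: ok1 => -> -> -> -> ->.
move: od oO h; rewrite (cedges_split u (y :: P)) (cedges_split u (y' :: Q)) cedges_split /=.
rewrite !wodd_cons !wodd_cat !wodd_cons /wodd /=.
rewrite (setUC [set y'] [set u]) (setUC [set y] [set u]).
by bool_cases w.
Qed.

End Exchange.

(** * Twins *)

Section Graph.
Variable G : sgraph.
Implicit Types (V N S A B : {set G}) (u v x y z : G) (w : pred {set G}).

Lemma sedge_neq x y : x -- y -> x != y.
Proof. by apply: contraTneq => ->; rewrite sedge_irrefl. Qed.

Definition elist V : seq {set G} := enum [set E in edges G | E \subset V].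

Lemma edgesP E : reflect (exists x y, E = [set x; y] /\ x -- y) (E \in edges G).
Proof.
apply: (iffP imsetP) => [[[x y] /= xy ->]|[x [y [-> xy]]]]; last by exists (x, y); rewrite ?inE.
by rewrite inE in xy; exists x, y.
Qed.

Lemma mem_edges x y : ([set x; y] \in edges G) = x -- y.
Proof.
apply/edgesP/idP => [[a [b [/set2_eq[] [-> ->]]]]|xy] //; first by rewrite sedge_sym.
by exists x, y.
Qed.

Lemma elistP V E :
  reflect (exists x y, [/\ E = [set x; y], x -- y, x \in V & y \in V]) (E \in elist V).
Proof.
rewrite mem_enum inE; apply: (iffP andP) => [[/edgesP[x [y [-> xy]]]]|[x [y [-> xy xV yV]]]].
  by rewrite subUset !sub1set => /andP[]; exists x, y.
by rewrite mem_edges xy subUset !sub1set xV.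
Qed.

Lemma mem_elist V x y : ([set x; y] \in elist V) = [&& x -- y, x \in V & y \in V].
Proof. by rewrite mem_enum inE mem_edges subUset !sub1set. Qed.

Lemma elist_uniq V : uniq (elist V).
Proof. exact: enum_uniq. Qed.

Definition secd V := forall w, ~~ wodd w (elist V) -> dec w (elist V).

Definition twins V u v :=
  [/\ u \in V, v \in V, u != v
    & forall z, z \in V -> z != u -> z != v -> u -- z = v -- z].

Definition rest V u v : {set G} := V :\: [set u; v].

Lemma mem_rest V u v z : (z \in rest V u v) = [&& z != u, z != v & z \in V].
Proof. by rewrite !inE negb_or andbA. Qed.

Definition nbr V u : {set G} := [set z in V | u -- z].

Lemma in_nbr V u z : (z \in nbr V u) = (z \in V) && (u -- z).
Proof. by rewrite inE. Qed.

Definition plist V u v : seq (option G) :=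
  (if u -- v then [:: None] else [::]) ++ map Some (enum (nbr (rest V u v) u)).

Lemma mem_plist V u v y :
  (Some y \in plist V u v) = [&& y != u, y != v, y \in V & u -- y].
Proof.
rewrite mem_cat mem_map ?mem_enum ?inE; last by move=> ? ? [].
by case: ifP => _; rewrite ?inE negb_or -!andbA.
Qed.

Lemma None_plist V u v : (None \in plist V u v) = u -- v.
Proof.
rewrite mem_cat; case: (u -- v) => //=; apply/negP => /mapP[]//.
Qed.

Lemma plist_ok V u v : theta_ok u v (plist V u v).
Proof.
split=> [|y]; last by rewrite mem_plist => /and3P[-> ->].
rewrite cat_uniq (map_inj_uniq (f := Some)) ?enum_uniq; last by move=> ? ? [].
by case: ifP => _ /=; rewrite ?andbT; apply/hasPn=> o /mapP[y _ ->]; rewrite ?inE.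
Qed.

Lemma size_plist V u v : size (plist V u v) = (u -- v) + #|nbr (rest V u v) u|.
Proof. by rewrite size_cat size_map -cardE; case: (u -- v). Qed.

Lemma elist_twins V u v : twins V u v ->
  perm_eq (elist (rest V u v) ++ theta u v (plist V u v)) (elist V).
Proof.
move=> [uV vV uv tw]; have vu : v != u by rewrite eq_sym.
have uniq_th := uniq_theta uv (plist_ok V u v).
have th E : E \in theta u v (plist V u v) -> u \in E \/ v \in E.
  by case/flatten_mapP=> [[y|] _]; rewrite /= !inE;
    [case/orP | ]; move/eqP->; rewrite !inE !eqxx; auto.
apply: uniq_perm; rewrite ?elist_uniq //.
  rewrite cat_uniq elist_uniq uniq_th andbT; apply/hasPn=> E /th h.
  apply/negP; rewrite mem_enum inE => /andP[_ /subsetP sub].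
  by case: h => /sub; rewrite !inE eqxx ?orbT.
move=> E; rewrite mem_cat; apply/orP/idP => [[]|].
- case/elistP=> x [y [-> xy]]; rewrite !mem_rest mem_elist xy.
  by case/and3P=> _ _ -> /and3P[_ _ ->].
- case/flatten_mapP=> [[y|]].
    rewrite mem_plist => /and4P[yu yv yV uy]; rewrite !inE => /orP[]/eqP->.
      by rewrite mem_elist uV yV uy.
    by rewrite mem_elist vV yV -tw ?uy.
  by rewrite None_plist inE => uv' /eqP->; rewrite mem_elist uv' uV.
case/elistP=> x [y [-> xy xV yV]].
have aux a b : a -- b -> b \in V -> (a == u) || (a == v) ->
    [set a; b] \in theta u v (plist V u v).
  move=> ab bV; case: (boolP ((b == u) || (b == v))) => bb aa.
    apply/flatten_mapP; exists None.
      rewrite None_plist; move: ab; case/orP: aa => /eqP->; case/orP: bb => /eqP->;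
        by rewrite ?sedge_irrefl // sedge_sym.
    rewrite inE /=; move: ab; case/orP: aa => /eqP->; case/orP: bb => /eqP->;
        by rewrite ?sedge_irrefl // ?eqxx // setUC eqxx.
  move: bb; rewrite negb_or => /andP[bu bv].
  apply/flatten_mapP; exists (Some b).
    rewrite mem_plist bu bv bV; case/orP: aa ab => /eqP->; first by [].
    by rewrite -tw.
  by case/orP: aa => /eqP->; rewrite !inE eqxx ?orbT.
case: (boolP ((x == u) || (x == v))) => hx; first by right; apply: aux.
case: (boolP ((y == u) || (y == v))) => hy.
  by right; rewrite setUC; apply: aux => //; rewrite sedge_sym.
left; rewrite mem_elist xy !mem_rest xV yV.
by move: hx hy; rewrite !negb_or => /andP[-> ->] /andP[-> ->].
Qed.

Lemma odd_secd V w E0 : secd V -> E0 \in elist V -> wodd w (elist V) ->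
  exists c l', [/\ cyc c, E0 \in cedges c, wodd w (cedges c), dec w l'
    & perm_eq (cedges c ++ l') (elist V)].
Proof.
move=> sV E0V od; apply: odd_dec => //; first exact: elist_uniq.
by apply: sV; rewrite wodd_toggle ?elist_uniq // od E0V.
Qed.

Lemma cedges_in V c l x : perm_eq (cedges c ++ l) (elist V) -> cyc c -> x \in c -> x \in V.
Proof.
move=> e cc xc; have [s [cs es _]] := cyc_rot_cons cc xc.
have : exists2 E, E \in cedges (x :: s) & x \in E.
  case: s {es cs} => [|y s]; first by exists [set x; x]; rewrite !inE eqxx.
  by exists [set x; y]; rewrite /= !inE eqxx.
case=> E Es xE; have : E \in elist V by rewrite -(perm_mem e) mem_cat -(perm_mem es) Es.
by rewrite mem_enum inE => /andP[_ /subsetP]; apply.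
Qed.

(** Connectedness stated through cuts: in this form it directly yields an edge between vertices
    whose paths differ in parity. The empty set and singletons count as connected. *)
Definition connS S := forall A, A \subset S -> A != set0 -> A != S ->
  exists a b, [/\ a \in A, b \in S, b \notin A & a -- b].

(* The theta part is even: decompose it separately. *)
Lemma dec_twins_even V u v w : twins V u v -> secd (rest V u v) ->
  ~~ odd (size (plist V u v)) -> ~~ wodd w (elist V) ->
  ~~ wodd w (theta u v (plist V u v)) -> dec w (elist V).
Proof.
move=> tw sV szp ev evt; have e := elist_twins tw; have [_ _ uv _] := tw.
apply: (perm_dec e); apply: dec_cat; last first.
  by apply: dec_theta => //; apply: plist_ok.
by apply: sV; move: ev; rewrite -(wodd_perm _ e) wodd_cat (negbTE evt) addbF.
Qed.

End Graph.

(** * Seinsche's theorem *)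

Section Seinsche.
Variable T : finType.
Implicit Types (r : rel T) (V A B C : {set T}).

(** For a symmetric irreflexive relation the adjacencies and non-adjacencies of an induced path
    already force its four vertices apart, so distinctness is not stated. *)
Definition p4_free r := forall a b c d,
  r a b -> r b c -> r c d -> ~~ r a c -> ~~ r a d -> r b d.

(** For adjacency this is a join, for non-adjacency a disconnection. One notion serves for both
    because the induction passes to complements. *)
Definition split_by r V := exists A : {set T},
  [/\ A \subset V, A != set0, A != V & forall a b, a \in A -> b \in V -> b \notin A -> r a b].

Definition corel r : rel T := fun a b => (a != b) && ~~ r a b.

Lemma split_by_sub r r' V : (forall a b, a != b -> r a b -> r' a b) ->
  split_by r V -> split_by r' V.
Proof.
move=> rr' [A [sA A0 AV h]]; exists A; split=> // a b aA bV bA.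
by apply: rr'; [apply: contraNneq bA => <- | exact: h].
Qed.

(** The complement of the path [a b c d] is the path [b d a c]. *)
Lemma corel_p4_free r : symmetric r -> p4_free r -> p4_free (corel r).
Proof.
move=> sr p4 a b c d /andP[ab rab] /andP[bc rbc] /andP[cd rcd].
rewrite /corel !negb_and !negbK.
case: (eqVneq a c) => [e|ac] /=; first by rewrite -e in cd rcd; rewrite (negbTE cd) (negbTE rcd).
move=> rac; case: (eqVneq a d) => [e|ad] /=; first by rewrite -e sr rac in rcd.
move=> rad; apply/andP; split; first by apply: contraNneq rab => ->.
apply: contra rcd => rbd; rewrite sr.
by apply: (p4 b d a c) => //; rewrite sr // .
Qed.

(** Suppose that [v] has a non-neighbour [x] and that every proper union of components contains a
    neighbour of [v]. The component [C] of [x] contains adjacent [z], [z'] of which only [z] is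
    adjacent to [v]; with a neighbour [y] of [v] outside [C] this gives the induced path
    [y v z z']. *)
Lemma split_extend r V v : symmetric r -> p4_free r -> v \notin V ->
  split_by (fun a b => ~~ r a b) V ->
  split_by r (v |: V) \/ split_by (fun a b => ~~ r a b) (v |: V).
Proof.
move=> sr p4 vV [A0 [sA A00 A0V hA]].
have [all_v|] := boolP [forall x in V, r v x].
  left; exists [set v]; split.
  - by rewrite sub1set !inE eqxx.
  - by apply/set0Pn; exists v; rewrite inE.
  - have [x xA] := set0Pn _ A00; apply: contraNneq vV => /setP/(_ x).
    by rewrite !inE (subsetP sA x xA) orbT => /eqP<-; apply: (subsetP sA).
  - by move=> a b; rewrite !inE => /eqP-> /orP[/eqP->|bV _]; rewrite ?eqxx //; exact: (forall_inP all_v).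
rewrite negb_forall_in => /exists_inP[x xV vx].
(* The closed sets are the nonempty unions of components of [V]; a minimal one containing [x] is its
   component. *)
pose closed C := [&& C \subset V, C != set0 & [forall a in C, forall b in V, (b \notin C) ==> ~~ r a b]].
have closedP C : closed C -> forall a b, a \in C -> b \in V -> b \notin C -> ~~ r a b.
  by case/and3P=> _ _ /forall_inP h a b /h/forall_inP h2 /h2/implyP; apply.
have closedI C : C \subset V -> C != set0 -> (forall a b, a \in C -> b \in V -> b \notin C -> ~~ r a b) -> closed C.
  move=> s0 n0 h; rewrite /closed s0 n0; apply/forall_inP=> a aC; apply/forall_inP=> b bV.
  by apply/implyP; apply: h.
have closedC C : closed C -> C != V -> closed (V :\: C).
  move=> cC CV; apply: closedI; first exact: subsetDl.
    by apply: contraNneq CV => /eqP; rewrite setD_eq0 eqEsubset => ->; case/and3P: cC => ->.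
  move=> a b; rewrite !inE => /andP[aC aV] bV; rewrite bV andbT negbK => bC.
  by rewrite sr; apply: closedP cC _ _ bC aV aC.
have cA : closed A0 by apply: closedI.
have [[C [cC CV nb]]|nbr_all] : (exists C, [/\ closed C, C != V & forall z, z \in C -> ~~ r v z]) \/
    (forall C, closed C -> C != V -> exists2 z, z \in C & r v z).
  case: (boolP [exists C : {set T}, [&& closed C, C != V & [forall z in C, ~~ r v z]]]).
    by case/existsP=> C /and3P[cC CV /forall_inP h]; left; exists C.
  rewrite negb_exists => /forallP h; right => C cC CV; have := h C.
  by rewrite cC CV negb_forall_in => /exists_inP[z zC]; rewrite negbK; exists z.
- right; exists C; have [sC C0 _] := and3P cC; split=> //.
  + exact: subset_trans sC (subsetUr _ _).
  + by apply: contraNneq vV => e; apply: (subsetP sC); rewrite e !inE eqxx.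
  + move=> a b aC; rewrite !inE => /orP[/eqP-> _|bV bC]; first by rewrite sr nb.
    exact: closedP cC _ _ aC bV bC.
have [D [cD DV xD]] : exists D, [/\ closed D, D != V & x \in D].
  case: (boolP (x \in A0)) => xA; first by exists A0.
  exists (V :\: A0); split; [exact: closedC | | by rewrite inE xA].
  have [y yA] := set0Pn _ A00; apply/eqP=> /setP/(_ y).
  by rewrite inE yA (subsetP sA).
have [C /minsetP[/andP[cC xC] minC] CD] : {C | minset [pred C | closed C & x \in C] C & C \subset D}.
  by apply: minset_exists; rewrite inE cD.
have CV : C != V by apply: contraNneq DV => e; rewrite eqEsubset -{2}e CD andbT; case/and3P: cD.
have sC : C \subset V by case/and3P: cC.
have [y0 y0C vy0] := nbr_all _ cC CV.
have [z [z' [zC z'C vz vz' zz']]] : exists z z', [/\ z \in C, z' \in C, r v z, ~~ r v z' & r z z'].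
  (* Without such a pair [z], [z'], the non-neighbours of [v] in [C] would be a smaller closed set
     containing [x]. *)
  pose C2 := [set c in C | ~~ r v c].
  have [|h] := boolP [exists z in C, exists z' in C, [&& r v z, ~~ r v z' & r z z']].
    by case/exists_inP=> z zC /exists_inP[z' z'C /and3P[? ? ?]]; exists z, z'.
  have cC2 : closed C2.
    apply: closedI.
    - by apply/subsetP=> c; rewrite inE => /andP[/(subsetP sC)].
    - by apply/set0Pn; exists x; rewrite inE xC.
    move=> a b; rewrite !inE => /andP[aC va] bV; case: (boolP (b \in C)) => bC; last first.
      by move=> _; apply: closedP cC _ _ aC bV bC.
    rewrite /= negbK => vb; apply: contra h => ab; apply/exists_inP; exists b => //.
    by apply/exists_inP; exists a => //; rewrite vb va sr.
  have : C2 = C.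
    apply: minC; first by rewrite /= cC2 inE xC.
    by apply/subsetP=> c; rewrite inE => /andP[].
  by move/setP/(_ y0); rewrite inE y0C vy0.
have VC : V :\: C != V.
  by apply: contraTneq xV => <-; rewrite inE xC.
have [y yC vy] := nbr_all _ (closedC _ cC CV) VC.
have yVC : (y \in V) && (y \notin C) by move: yC; rewrite inE andbC.
have [yV yC'] := andP yVC.
have yz : ~~ r y z by rewrite sr; apply: closedP cC _ _ zC yV yC'.
have yz' : ~~ r y z' by rewrite sr; apply: closedP cC _ _ z'C yV yC'.
by have := p4 y v z z'; rewrite sr vy vz zz' yz yz' (negbTE vz') => /(_ isT isT isT isT isT).
Qed.

(** Induction on the size of [V]. If [V] without a vertex is disconnected, [split_extend] applies;
    if it is a join, the same lemma is applied to the complement. *)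
Lemma seinsche r V : symmetric r -> p4_free r -> 1 < #|V| ->
  split_by r V \/ split_by (fun a b => ~~ r a b) V.
Proof.
move=> sr p4; elim: {V}#|V| {-2}V (leqnn #|V|) => [|n IH] V; first by lia.
move=> Vn V1; have [v vV] : exists v, v \in V by apply/set0Pn; rewrite -card_gt0 ltnW.
rewrite -(setD1K vV); have vV' : v \notin V :\ v by rewrite !inE eqxx.
have cV' : #|V| = #|V :\ v|.+1 by rewrite (cardsD1 v) vV.
case: (leqP #|V :\ v| 1) => V'1.
  have /cards1P[x ex] : #|V :\ v| == 1 by lia.
  have vx : v != x by apply: contraNneq vV' => e; rewrite ex e inE.
  have s : forall r' : rel T, r' v x -> split_by r' (v |: (V :\ v)).
    move=> r' h; exists [set v]; split.
    - by rewrite sub1set !inE eqxx.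
    - by apply/set0Pn; exists v; rewrite inE.
    - by apply: contraNneq vx => /setP/(_ x); rewrite ex !inE eqxx orbT => /eqP->.
    - by move=> a b; rewrite ex !inE => /eqP-> /orP[/eqP->|/eqP-> _]; rewrite ?eqxx.
  by case: (boolP (r v x)) => h; [left | right]; apply: s.
case: (IH (V :\ v)) => // [|h|h]; first by lia.
  have sc : symmetric (corel r) by move=> a b; rewrite /corel eq_sym sr.
  have [] := split_extend sc (corel_p4_free sr p4) vV' _.
  - apply: split_by_sub h => a b ab rab; by rewrite /corel ab rab.
  - by move=> h2; right; apply: split_by_sub h2 => a b _ /andP[].
  - by move=> h2; left; apply: split_by_sub h2 => a b ab; rewrite /corel ab negbK.
exact: split_extend.
Qed.

End Seinsche.

Lemma cograph_p4_free (G : sgraph) : cograph G -> p4_free (@sedge G).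
Proof.
move=> cog a b c d ab bc cd ac ad; apply/negPn/negP => bd; apply: cog.
pose f (i : 'I_4) := nth a [:: a; b; c; d] i.
have nac : a != c by apply: contraNneq ad => ->.
have nad : a != d by apply: contraNneq ac => ->; rewrite sedge_sym.
have nbd : b != d by apply: contraNneq ad => <-.
have u4 : uniq [:: a; b; c; d].
  by rewrite /= !inE !negb_or nac nad nbd (sedge_neq ab) (sedge_neq bc) (sedge_neq cd).
exists f; split=> [i j /eqP|].
  by rewrite /f nth_uniq // => /eqP; apply: val_inj.
move=> [[|[|[|[|i]]]] hi] [[|[|[|[|j]]]] hj] //=; rewrite /f /= ?sedge_irrefl //;
  by rewrite ?(ab, bc, cd, negbTE ac, negbTE ad, negbTE bd) // sedge_sym
    ?(ab, bc, cd, negbTE ac, negbTE ad, negbTE bd).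
Qed.

Lemma perm_sub_cat (T : eqType) (s1 s2 : seq T) : uniq s1 -> uniq s2 ->
  {subset s1 <= s2} -> exists s, perm_eq (s1 ++ s) s2.
Proof.
move=> u1 u2 sub; exists (filter [predC s1] s2).
apply: uniq_perm => //; first rewrite cat_uniq u1 filter_uniq // andbT.
  by apply/hasPn=> x; rewrite mem_filter => /andP[].
move=> x; rewrite mem_cat mem_filter /=.
by apply/orP/idP => [[/sub|/andP[]]|xs] //; rewrite xs andbT; case: (x \in s1); auto.
Qed.

(** The entry [y] is a middle one of three; on a cycle it becomes a vertex of [N] that has further
    vertices of [N] on both sides. *)
Lemma split_three (T : Type) (p : pred T) s : 2 < count p s ->
  exists s1 y s2, [/\ s = s1 ++ y :: s2, p y, has p s1 & has p s2].
Proof.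
suff H t : 1 < count p t -> exists t1 y t2, [/\ t = t1 ++ y :: t2, p y & has p t2].
  elim: s => //= x s IH; case px: (p x); last first.
    by move/IH=> [s1 [y [s2 [-> py h1 h2]]]]; exists (x :: s1), y, s2; rewrite /= h1 orbT.
  rewrite add1n ltnS => /H[t1 [y [t2 [-> py h]]]].
  by exists (x :: t1), y, t2; rewrite /= px.
elim: t => //= x t IH; case px: (p x); last first.
  by move/IH=> [t1 [y [t2 [-> py h]]]]; exists (x :: t1), y, t2.
by rewrite add1n ltnS -has_count => h; exists [::], x, t.
Qed.

(** * Removal of one pair of twins *)

Section Step.
Variable G : sgraph.
Implicit Types (V N S A B : {set G}) (u v x y z : G) (w : pred {set G}).

(** The edges in [c] absorb the paths of [L0]. The remaining paths are even in number, and even in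
    weight because all other pieces are, so [dec_theta] decomposes them. *)
Lemma dec_twins_finish V u v w (c l' : seq {set G}) L0 : twins V u v ->
  perm_eq (c ++ l') (elist (rest V u v)) ->
  uniq L0 -> {subset L0 <= plist V u v} ->
  ~~ odd (size (plist V u v)) -> ~~ odd (size L0) ->
  dec w (c ++ theta u v L0) -> dec w l' -> ~~ wodd w (elist V) -> dec w (elist V).
Proof.
move=> tw e uL0 sub szL szL0 d1 d2 ev; have [_ _ uv _] := tw.
have [uL okL] := plist_ok V u v; have [L' eL] := perm_sub_cat uL0 uL sub.
have e3 : perm_eq ((c ++ theta u v L0) ++ (l' ++ theta u v L')) (elist V).
  apply: perm_trans (elist_twins tw); rewrite perm_catACA.
  by apply: perm_cat => //; rewrite -theta_cat; apply: perm_theta.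
apply: (perm_dec e3); apply: dec_cat => //; apply: dec_cat => //; apply: dec_theta => //.
- split; first by move: uL; rewrite -(perm_uniq eL) cat_uniq => /and3P[].
  by move=> y yL; apply: okL; rewrite -(perm_mem eL) mem_cat yL orbT.
- by move: szL; rewrite -(perm_size eL) size_cat oddD (negbTE szL0).
move: ev; rewrite -(wodd_perm _ e3) wodd_cat (negbTE (dec_even d1)) wodd_cat.
by rewrite (negbTE (dec_even d2)).
Qed.

(* If the paths between [u] and [v] have odd total weight, then so has the rest, and its only odd
   cycle [O] can be taken through any given edge [ab] with [a], [b] in [N]. If the paths through [a]
   and [b] differ in parity, then [O] and the 4-cycle [u a v b] recombine into two even cycles. If no
   such [a] and [b] exist, then [uv] and the paths through [N] differ in parity, and both arcs of [O]
   between two vertices of [N] are completed to even cycles, one of them with the edge [uv]. *)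
Lemma secd_twins V u v (N := nbr (rest V u v) u) : twins V u v -> secd (rest V u v) ->
  connS N -> 1 < #|N| -> ~~ odd (u -- v + #|N|) -> ~~ (u -- v && (#|N| == 3)) -> secd V.
Proof.
move=> tw sV cN N1 oN N3 w ev; have [uV vV uv twz] := tw.
have szL : ~~ odd (size (plist V u v)) by rewrite size_plist.
case: (boolP (wodd w (theta u v (plist V u v)))) => evt; last exact: dec_twins_even tw _ _ _ _.
have od : wodd w (elist (rest V u v)).
  by move: ev; rewrite -(wodd_perm _ (elist_twins tw)) wodd_cat evt addbT negbK.
pose p o := wodd w (path_edges u v o).
have NL y : (y \in N) = (Some y \in plist V u v).
  by rewrite mem_plist in_nbr mem_rest -!andbA.
have Nuv y : y \in N -> [/\ y != u, y != v & y \in rest V u v].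
  by rewrite in_nbr mem_rest => /andP[/and3P[-> -> ->]].
have eL : plist V u v = (if u -- v then [:: None] else [::]) ++ map Some (enum N) by [].
clearbody N.
have uvR : (u \notin rest V u v) /\ (v \notin rest V u v) by rewrite !mem_rest !eqxx andbF.
have edge a b : a \in N -> b \in N -> a -- b -> [set a; b] \in elist (rest V u v).
  by move=> /Nuv[_ _ ha] /Nuv[_ _ hb] ab; rewrite mem_elist ab ha.
have outO c l' : perm_eq (cedges c ++ l') (elist (rest V u v)) -> cyc c ->
    u \notin c /\ v \notin c.
  move=> e cc; split.
    by apply: contra uvR.1; apply: cedges_in e cc.
  by apply: contra uvR.2; apply: cedges_in e cc.
have pL : odd (count p (plist V u v)) by rewrite -wodd_theta.
case: (boolP [exists a in N, exists b in N, p (Some a) && ~~ p (Some b)]).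
  case/exists_inP=> a0 a0N /exists_inP[b0 b0N /andP[pa0 pb0]].
  (* Both parities occur, so the connected set [N] has an edge from a vertex with an odd path to one
     with an even path. *)
  have [|||a [b [aX bN bX ab]]] := cN [set y in N | p (Some y)].
  - by apply/subsetP=> y; rewrite inE => /andP[].
  - by apply/set0Pn; exists a0; rewrite inE a0N.
  - by apply: contraNneq pb0 => /setP/(_ b0); rewrite inE b0N.
  move: aX bX; rewrite !inE bN /= => /andP[aN pa] pb.
  have [c [l' [cc Ec oc dl' e]]] := odd_secd sV (edge _ _ aN bN ab) od.
  have ac : a \in c by apply: mem_cedges_sub Ec (set21 _ _).
  have bc : b \in c by apply: mem_cedges_sub Ec (set22 _ _).
  have [P [Q [cO eO mO]]] := cyc_split cc ac bc (sedge_neq ab).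
  have [uc vc] := outO _ _ e cc.
  apply: (@dec_twins_finish V u v w (cedges (a :: P ++ b :: Q)) l' [:: Some a; Some b]) => //.
  - by apply: (perm_trans _ e); rewrite perm_cat2r.
  - by rewrite /= inE andbT; apply/eqP=> -[ab']; rewrite ab' sedge_irrefl in ab.
  - by move=> o; rewrite !inE => /orP[]/eqP->; rewrite -NL.
  apply: dec_exchange2; rewrite -?mO ?(wodd_perm _ eO) //.
  by rewrite -/(p _) -/(p (Some b)) pa (negbTE pb).
rewrite negb_exists_in => /forall_inP const.
have [n0 n0N] : exists n0, n0 \in N by apply/set0Pn; rewrite -card_gt0 ltnW.
have pN y z : y \in N -> z \in N -> p (Some y) = p (Some z).
  have H a b : a \in N -> b \in N -> p (Some a) -> p (Some b).
    move=> aN bN pa; have := const a aN; rewrite negb_exists_in => /forall_inP/(_ b bN).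
    by rewrite pa negbK.
  by move=> yN zN; apply/idP/idP; apply: H.
have cnt : count p (map Some (enum N)) = p (Some n0) * #|N|.
  rewrite count_map cardE; have : {subset enum N <= N} by move=> y; rewrite mem_enum.
  elim: (enum N) => [|y s IH] sub /=; first by rewrite muln0.
  rewrite IH => [|z zs]; last by apply: sub; rewrite inE zs orbT.
  by rewrite (pN y n0) ?mulnS // sub ?mem_head.
have uv' : u -- v.
  apply: contraTT pL => nuv; rewrite eL (negbTE nuv) /= cnt oddM.
  by move: oN; rewrite (negbTE nuv) add0n => /negbTE->; rewrite andbF.
have oN' : odd #|N| by move: oN; rewrite uv' add1n /= negbK.
have N5 : 4 < #|N|.
  by move: N3 oN' N1; rewrite uv' /=; case: #|N| => [|[|[|[|[|]]]]].
have pNone : p None != p (Some n0).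
  move: pL; rewrite eL uv' /= cnt oddD oddM oN' andbT !oddb.
  by case: (p None); case: (p (Some n0)).
suff [y [y' [n1 [n2 [P [Q [l' [[yN y'N n1N n2N] [e dl'] [cO oO] [ok1 ok2]]]]]]]]] :
  exists y y' n1 n2 P Q l', [/\ [/\ y \in N, y' \in N, n1 \in N & n2 \in N],
    perm_eq (cedges (y :: P ++ y' :: Q) ++ l') (elist (rest V u v)) /\ dec w l',
    cyc (y :: P ++ y' :: Q) /\ wodd w (cedges (y :: P ++ y' :: Q)) 
    & [&& n1 != y, n1 != y' & n1 \notin P] /\ [&& n2 != y, n2 != y' & n2 \notin Q]].
  have [uc vc] := outO _ _ e cO.
  have [[n1u n1v _] [n2u n2v _]] := (Nuv _ n1N, Nuv _ n2N).
  have [||||n nn d] := @dec_exchange3 _ w u v y P y' Q n1 n2 uv cO uc vc oO.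
  - by move=> z; rewrite !inE => /or3P[]/eqP->; apply: pN.
  - by rewrite -/(p _) -/(p None) eq_sym (pN y n0).
  - by rewrite n1u n1v.
  - by rewrite n2u n2v.
  have nN : n \in N by move: nn; rewrite !inE => /orP[]/eqP->.
  apply: (dec_twins_finish tw e _ _ szL _ d dl' ev) => //.
    have : uniq [:: y; y'; n].
      have yy' : y != y' by move: cO; uniq_facts; case/andP=> /andP[/and3P[]].
      rewrite /= !inE negb_or yy' /= andbT; move: nn; rewrite !inE => /orP[]/eqP->.
        by case/and3P: ok1 => h1 h2 _; rewrite !(eq_sym _ n1) h1 h2.
      by case/and3P: ok2 => h1 h2 _; rewrite !(eq_sym _ n2) h1 h2.
    by move=> h; rewrite -[_ :: _]/(None :: map Some [:: y; y'; n]) cons_uniq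
      (map_inj_uniq (f := Some)) ?h // => ? ? [].
  by move=> o; rewrite !inE => /or4P[]/eqP->; rewrite -?NL // None_plist.
have [|||a [b [aN bN ba ab]]] := cN [set n0].
- by rewrite sub1set.
- by apply/set0Pn; exists n0; rewrite inE.
- by apply: contraTneq N1 => <-; rewrite cards1.
have {}aN : a \in N by move: aN; rewrite inE => /eqP->.
have [c [l' [cc Ec oc dl' e]]] := odd_secd sV (edge _ _ aN bN ab) od.
have ac : a \in c by apply: mem_cedges_sub Ec (set21 _ _).
have bc : b \in c by apply: mem_cedges_sub Ec (set22 _ _).
(* A vertex of [N] off the cycle avoids both arcs and serves as [n1] and as [n2]. *)
case: (boolP [exists n in N, n \notin c]).
  case/exists_inP=> n nN nc; have [P [Q [cO eO mO]]] := cyc_split cc ac bc (sedge_neq ab).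
  exists a, b, n, n, P, Q, l'.
  have /and4P[na nP nb nQ] : [&& n != a, n \notin P, n != b & n \notin Q].
    by have : n \notin a :: P ++ b :: Q; [rewrite -mO | uniq_facts].
  rewrite na nb nP nQ aN bN nN (wodd_perm _ eO).
  by split=> //; split=> //; apply: (perm_trans _ e); rewrite perm_cat2r.
rewrite negb_exists_in => /forall_inP Nc.
have [s [cs es ms]] := cyc_rot_cons cc ac.
(* All of [N] lies on the cycle, so besides [a] at least four of its vertices do. A middle one of
   them becomes [y']; then [n1] can be taken on [Q], hence off [P], and [n2] on [P], hence off
   [Q]. *)
have cnts : 2 < count [in N] s.
  have us : uniq s by move: cs; rewrite /cyc cons_uniq -andbA => /and3P[].
  rewrite -size_filter; apply: (@leq_trans #|N :\ a|).
    by move: N5; rewrite (cardsD1 a) aN add1n ltnS; apply: ltnW.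
  rewrite cardE; apply: uniq_leq_size; first exact: enum_uniq.
  move=> z; rewrite mem_enum in_setD1 mem_filter => /andP[za zN]; rewrite zN /=.
  by have := Nc z zN; rewrite negbK ms inE (negbTE za).
have [P [y' [Q [es' y'N /hasP[n2 n2P n2N] /hasP[n1 n1Q n1N]]]]] := split_three cnts.
subst s; exists a, y', n1, n2, P, Q, l'.
split=> //; first by split=> //; apply: (perm_trans _ e); rewrite perm_cat2r.
  by rewrite (wodd_perm _ es).
have : cyc (a :: P ++ y' :: Q) by [].
uniq_facts; rewrite -!andbA => /and5P[aP ay' aQ uP /and5P[y'P /hasPn PQ y'Q uQ _]].
split.
  apply/and3P; split; [by apply: contraNneq aQ => <- | by apply: contraNneq y'Q => <- | exact: PQ].
apply/and3P; split; [by apply: contraNneq aP => <- | by apply: contraNneq y'P => <- |].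
by apply: contraTN n2P => h; exact: PQ h.
Qed.

End Step.

(** * The exceptional graphs *)

Lemma label_adjE El i j : label_adj El i j = ((i, j) \in El) || ((j, i) \in El).
Proof.
rewrite /label_adj lhasE -!has_pred1 -has_predU; apply: eq_has => -[a b] /=.
by rewrite !xpair_eqE !eqE.
Qed.

Lemma label_adjC El i j : label_adj El i j = label_adj El j i.
Proof. by rewrite !label_adjE orbC. Qed.

Lemma label_adj_cat El1 El2 i j :
  label_adj (El1 ++ El2) i j = label_adj El1 i j || label_adj El2 i j.
Proof. by rewrite /label_adj !lhasE has_cat. Qed.

Lemma row_adjE n El i j : i < n -> j < n -> row_adj (adj_rows n El) i j = label_adj El i j.
Proof.
move=> i_n j_n; rewrite /row_adj (nth_map 0) ?size_iota // nth_iota // add0n.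
by rewrite (nth_map 0) ?size_iota // nth_iota.
Qed.

Lemma mem_bitseqs bs : bs \in bitseqs (size bs).
Proof.
elim: bs => //= b bs IH; rewrite mem_cat.
by case: b; rewrite map_f ?orbT.
Qed.

Lemma mem_mask_iota bs m i : (i \in mask bs (iota m (size bs))) = (m <= i) && nth false bs (i - m).
Proof.
elim: bs m => [|b bs IH] m /=; first by rewrite nth_nil andbF.
case: b; rewrite ?inE IH; case: (ltngtP m i) => [mi|mi|<-]; rewrite ?subnn ?(subnSK mi) //=;
  try by rewrite -(subnSK mi).
Qed.

Lemma mem_twin_edges n N t i j : (i, j) \in twin_edges n N t =
  [|| (j == n) && (i \in N), (j == n.+1) && (i \in N) | [&& t, i == n & j == n.+1]].
Proof.
have H m : ((i, j) \in [seq (x, m) | x <- N]) = (j == m) && (i \in N).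
  apply/mapP/andP => [[x xN [-> ->]]|[/eqP-> iN]]; first by rewrite eqxx.
  by exists i.
rewrite !mem_cat !H; case: t => /=; rewrite ?orbF //.
by rewrite inE xpair_eqE.
Qed.

Section Labels.
Variables (G : sgraph) (x0 : G).
Implicit Types (V N S A B : {set G}) (u v x y z : G) (w : pred {set G}).

Definition labels V El (xs : seq G) :=
  [/\ uniq xs, V =i xs & forall i j, i < size xs -> j < size xs ->
        nth x0 xs i -- nth x0 xs j = label_adj El i j].

Lemma labels_elist V El xs : labels V El xs ->
  all (fun E => E.1 < E.2 < size xs) El -> uniq El ->
  perm_eq (label_edges x0 xs El) (elist V).
Proof.
move=> [ux Vx adj] /allP bnd uE; apply: uniq_perm; rewrite ?elist_uniq //.
  have nthI i j : i < size xs -> nth x0 xs i = nth x0 xs j -> j < size xs -> i = j.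
    by move=> i_n e j_n; apply/eqP; rewrite -(nth_uniq x0 i_n j_n ux) e.
  rewrite map_inj_in_uniq // => -[i j] [i' j'] /bnd/= h /bnd/= h'.
  have [ij jn] := andP h; have [ij' jn'] := andP h'.
  have [i_n i_n'] := (ltn_trans ij jn, ltn_trans ij' jn').
  case/set2_eq=> -[/(nthI _ _ i_n) e1 /(nthI _ _ jn) e2]; first by rewrite e1 ?e2.
  by move: ij'; rewrite -e1 // -e2 // ltnNge ltnW.
move=> E; apply/mapP/elistP => [[[i j] Eij ->]|[x [y [-> xy xV yV]]]].
  have /andP[ij jn] := bnd _ Eij; have i_n := ltn_trans ij jn.
  exists (nth x0 xs i), (nth x0 xs j).
  by rewrite !Vx !mem_nth ?adj // label_adjE Eij.
move: (xy); rewrite !Vx in xV yV; rewrite -[in X in X -> _](nth_index x0 xV) -[in X in X -> _](nth_index x0 yV).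
rewrite adj ?index_mem // label_adjE => /orP[] h; [exists (index x xs, index y xs) | exists (index y xs, index x xs)] => //=.
  by rewrite !nth_index.
by rewrite !nth_index // setUC.
Qed.

Lemma base_dec Os (B : labelled_base) V xs w : base_check Os B -> labels V (base_edges B) xs ->
  size xs = base_order B -> ~~ wodd w (elist V) ->
  all (fun l => wodd w (label_edges x0 xs l)) (Os (base_order B) (base_edges B)) ->
  dec w (elist V).
Proof.
case/andP=> bnd chk lab sz ev od; have [ux _ _] := lab.
have uE : uniq (base_edges B) by case/and4P: chk.
have e := labels_elist lab; rewrite sz in e; have {}e := e bnd uE.
apply: (perm_dec e); apply: (label_checkP ux _ _ od); first by rewrite sz; exact: chk.
by rewrite (wodd_perm _ e).
Qed.

Lemma labels_perm V El El' xs n p : labels V El xs -> size xs = n ->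
  [&& uniq p, size p == n & all (gtn n) p] -> relabelling n (adj_rows n El) El' p ->
  all (fun E => E.1 < E.2) El' ->
  labels V El' (map (nth x0 xs) p).
Proof.
move=> [ux Vx adj] sz /and3P[up /eqP szp /allP bp].
rewrite /relabelling lallE => /allP rel /allP bnd.
have inj : {in p &, injective (nth x0 xs)}.
  by move=> i j /bp/= hi /bp/= hj /eqP; rewrite nth_uniq ?sz // => /eqP.
have um : uniq (map (nth x0 xs) p) by rewrite map_inj_in_uniq.
split=> //.
  move=> x; rewrite Vx; have [||_ -> //] := uniq_min_size um (s2 := xs).
    by move=> y /mapP[i /bp/= hi ->]; rewrite mem_nth ?sz.
  by rewrite size_map szp sz.
have H i j : j < i -> i < n -> nth x0 (map (nth x0 xs) p) i -- nth x0 (map (nth x0 xs) p) j = label_adj El' i j.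
  move=> ji i_n; have j_n := ltn_trans ji i_n.
  have bi : nth 0 p i < n by apply: bp; rewrite mem_nth ?szp.
  have bj : nth 0 p j < n by apply: bp; rewrite mem_nth ?szp.
  rewrite !(nth_map 0) ?szp // adj ?sz //.
  have := rel i; rewrite mem_iota i_n lallE => /(_ isT)/allP/(_ j).
  by rewrite mem_iota ji => /(_ isT)/eqP->; rewrite row_adjE.
move=> i j; rewrite size_map szp => i_n j_n; case: (ltngtP i j) => [ij|ij|->].
- by rewrite sedge_sym H // label_adjC.
- exact: H.
rewrite sedge_irrefl label_adjE orbb; apply/esym/negP => /bnd /=.
by rewrite ltnn.
Qed.

Lemma labels_twins V El xs u v k : twins V u v -> labels (rest V u v) El xs -> size xs = k ->
  all (fun E => (E.1 < k) && (E.2 < k)) El ->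
  labels V (El ++ twin_edges k (mask [seq u -- x | x <- xs] (iota 0 k)) (u -- v)) (xs ++ [:: u; v]).
Proof.
move=> [uV vV uv tw] [ux Vx adj] sz /allP bnd.
have nx z : z \in xs -> [&& z != u, z != v & z \in V] by rewrite -Vx mem_rest.
split.
- rewrite cat_uniq ux /= orbF negb_or inE uv !andbT.
  by apply/andP; split; apply/negP=> /nx; rewrite eqxx ?andbF.
- move=> z; rewrite mem_cat -Vx mem_rest !inE.
  case: (eqVneq z u) => [->|zu] /=; first by rewrite uV.
  by case: (eqVneq z v) => [->|zv] /=; rewrite ?vV ?orbF.
have szm : size [seq u -- x | x <- xs] = k by rewrite size_map.
have inN i : (i \in mask [seq u -- x | x <- xs] (iota 0 k)) = (i < k) && (u -- nth x0 xs i).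
  rewrite -szm mem_mask_iota subn0 leq0n /= szm; case: (ltnP i k) => ik.
    by rewrite (nth_map x0) ?sz.
  by rewrite nth_default // szm.
have E0 i j : (k <= i) || (k <= j) -> ((i, j) \in El) = false.
  by move=> h; apply/negP => /bnd /=; case/andP=> ik jk; case/orP: h; rewrite leqNgt ?ik ?jk.
set N := mask _ _ in inN *.
have nth_l i : i < k -> nth x0 (xs ++ [:: u; v]) i = nth x0 xs i by move=> h; rewrite nth_cat sz h.
have nth_u : nth x0 (xs ++ [:: u; v]) k = u by rewrite nth_cat sz ltnn subnn.
have nth_v : nth x0 (xs ++ [:: u; v]) k.+1 = v by rewrite nth_cat sz ltnNge leqnSn /= subSnn.
have H i j : i < j -> j < k.+2 ->
    nth x0 (xs ++ [:: u; v]) i -- nth x0 (xs ++ [:: u; v]) j =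
    label_adj (El ++ twin_edges k N (u -- v)) i j.
  move=> ij; rewrite label_adj_cat !label_adjE !mem_twin_edges !inN ltnS leq_eqVlt => /orP[/eqP ej|].
    subst j; rewrite nth_v !E0 ?leqnSn ?orbT // (gtn_eqF (ltnSn k)) eqxx (ltn_eqF ij) /=.
    rewrite ?andbF ?orbF (ltnNge k.+1) leqnSn /= ?andbF ?orbF.
    have [->|ik] : i = k \/ i < k by move: ij; rewrite ltnS leq_eqVlt => /orP[/eqP|]; auto.
      by rewrite nth_u ltnn eqxx !andbT.
    rewrite nth_l // ik (ltn_eqF ik) /= ?andbF ?orbF.
    have : nth x0 xs i \in xs by rewrite mem_nth ?sz.
    by move=> /nx/and3P[h1 h2 h3]; rewrite sedge_sym -tw.
  rewrite ltnS leq_eqVlt => /orP[/eqP ej|jk].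
    subst j; rewrite nth_u nth_l // !E0 ?leqnn ?orbT // eqxx ij (ltn_eqF ij).
    by rewrite (ltn_eqF (ltnSn k)) ltnn ?andbF ?orbF /= sedge_sym (ltn_eqF (leqW ij)) andbF orbF.
  have ik := ltn_trans ij jk.
  rewrite !nth_l // adj ?sz // label_adjE (ltn_eqF ik) (ltn_eqF jk).
  by rewrite (ltn_eqF (leqW ik)) (ltn_eqF (leqW jk)) ?andbF ?orbF.
move=> i j; rewrite size_cat sz addn2 => i_n j_n; case: (ltngtP i j) => [ij|ij|->].
- exact: H.
- by rewrite sedge_sym H // label_adjC.
rewrite sedge_irrefl label_adj_cat !label_adjE !orbb mem_twin_edges inN.
have -> : ((j, j) \in El) = false.
  apply/negP=> jE; have /= := bnd _ jE; rewrite andbb => jk.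
  have := sedge_irrefl (nth x0 xs j); rewrite adj ?sz // label_adjE jE //.
case: eqP => [->|_]; first by rewrite ltnn (ltn_eqF (ltnSn k)) !andbF.
case: eqP => [->|_]; first by rewrite ltnNge leqnSn !andbF.
by rewrite !andbF.
Qed.

Lemma labels_p4 V El xs : cograph G -> labels V El xs ->
  has_p4 (size xs) (adj_rows (size xs) El) = false.
Proof.
set n := size xs => cog [ux Vx adj]; apply/negP; rewrite /has_p4 lhasE.
case/hasP=> a; rewrite mem_iota => a_n; rewrite lhasE => /hasP[b]; rewrite mem_iota => b_n.
case: ifP => // ab; rewrite lhasE => /hasP[c]; rewrite mem_iota => c_n.
case: ifP => // /andP[bc ac]; rewrite lhasE => /hasP[d]; rewrite mem_iota => d_n.
case/and3P=> cd ad bd; move: ab bc cd ac ad bd.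
rewrite !row_adjE // -!adj //.
move: (nth x0 xs a) (nth x0 xs b) (nth x0 xs c) (nth x0 xs d).
move=> {a_n b_n c_n d_n}{}a {}b {}c {}d ab bc cd ac ad.
by rewrite (cograph_p4_free cog ab bc cd ac ad).
Qed.

End Labels.

Lemma all_has_ex (T : Type) (a b : pred T) s : all a s -> has b s -> exists2 x, a x & b x.
Proof.
elim: s => //= x s IH /andP[ax as_] /orP[bx|]; last exact: IH.
by exists x.
Qed.

Section Exceptional.
Variables (G : sgraph) (x0 : G).
Hypothesis cog : cograph G.
Implicit Types (V N S A : {set G}) (u v x y z : G) (w : pred {set G}).

Definition exceptional V :=
  (exists2 xs, size xs = 5 & labels x0 V K5_labels xs) \/
  (exists2 xs, size xs = 6 & labels x0 V K5s_labels xs).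

Lemma in_tableP Os tbl V El xs n m ps : all (base_check Os) tbl -> labels x0 V El xs ->
  size xs = n -> in_table tbl ps n m (adj_rows n El) ->
  exists B p, [/\ base_check Os B, base_order B = n, p \in ps, size p = n
    & labels x0 V (base_edges B) (map (nth x0 xs) p)].
Proof.
move=> ok lab sz; rewrite /in_table lhasE => /(all_has_ex ok)[B okB].
case: ifP => // /andP[/eqP szB _]; rewrite lhasE => /hasP[p pps].
case: ifP => // okp rel; exists B, p; split=> //; first by case/and3P: okp => _ /eqP.
apply: (labels_perm lab sz okp rel).
by case/andP: okB => bnd _; apply: sub_all bnd => E /andP[].
Qed.

Lemma size_mask_nbr V El xs u v k : labels x0 (rest V u v) El xs -> size xs = k ->
  size (mask [seq u -- x | x <- xs] (iota 0 k)) = #|nbr (rest V u v) u|.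
Proof.
move=> [ux Vx _] sz; rewrite size_mask ?size_map ?size_iota // count_map.
rewrite -size_filter -(card_uniqP (filter_uniq _ ux)).
by apply: eq_card => z; rewrite mem_filter in_nbr Vx andbC.
Qed.

(** The neighbours of [u] form one of the masks that [single_ok] ran through, and even degrees fix
    whether [u] and [v] are adjacent. A cograph avoids the branch with an induced path, so the graph
    is in the table. *)
Lemma single_ext k El ps V xs u v : single_ok k El ps ->
  all (fun E => (E.1 < k) && (E.2 < k)) El ->
  labels x0 (rest V u v) El xs -> size xs = k -> twins V u v ->
  1 < #|nbr (rest V u v) u| -> ~~ odd (u -- v + #|nbr (rest V u v) u|) -> secd V.
Proof.
move=> ok bnd lab sz tw N1 oN w ev.
have szN := size_mask_nbr lab sz; have := labels_twins tw lab sz bnd.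
have bsk : [seq u -- x | x <- xs] \in bitseqs k by rewrite -sz -(size_map (sedge u)) mem_bitseqs.
move: ok; rewrite /single_ok lallE => /allP/(_ _ bsk) /=; rewrite szN.
have -> : odd #|nbr (rest V u v) u| = u -- v.
  by move: oN; rewrite oddD oddb; case: (u -- v); case: (odd _).
rewrite ltnNge N1 /= => + lab'; have sz' : size (xs ++ [:: u; v]) = k.+2 by rewrite size_cat sz addn2.
rewrite -sz' (labels_p4 cog lab') sz' => tbl.
have [B [p [okB oB _ szp labB]]] := in_tableP single_table_ok lab' sz' tbl.
by apply: (base_dec okB labB); rewrite ?size_map ?szp.
Qed.

Lemma exceptional_twins V u v : exceptional (rest V u v) -> twins V u v ->
  1 < #|nbr (rest V u v) u| -> ~~ odd (u -- v + #|nbr (rest V u v) u|) -> secd V.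
Proof.
case=> -[xs sz lab].
  exact: single_ext K5_single_ok _ lab sz.
exact: single_ext K5s_single_ok _ lab sz.
Qed.

(** Translates the odd weight of the paths between [u] and [v] into an equation of [last_pairs]. *)
Lemma theta_incident V El xs u v p q : labels x0 V El xs ->
  all (fun E => E.1 < E.2 < size xs) El -> uniq El -> twins V u v ->
  p < size xs -> q < size xs -> nth x0 xs p = u -> nth x0 xs q = v ->
  perm_eq (theta u v (plist V u v)) (label_edges x0 xs (incident El p q)).
Proof.
move=> lab bnd uE tw pn qn eu ev; have [_ _ uv _] := tw; have [ux _ _] := lab.
pose touch (E : {set G}) := (u \in E) || (v \in E).
apply: (@perm_trans _ (filter touch (elist V))).
  apply: uniq_perm; [by apply: uniq_theta (plist_ok _ _ _) | by rewrite filter_uniq // elist_uniq |].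
  move=> E; rewrite mem_filter -(perm_mem (elist_twins tw)) mem_cat.
  case h: (E \in theta _ _ _).
    rewrite orbT andbT; apply/esym; case/flatten_mapP: h => -[y|] _; rewrite !inE;
    by [case/orP=> /eqP->; rewrite /touch !inE !eqxx ?orbT | move/eqP->; rewrite /touch !inE !eqxx].
  rewrite orbF; apply/esym/negP=> /andP[tE]; rewrite mem_enum inE => /andP[_ /subsetP sub].
  by case/orP: tE => /sub; rewrite mem_rest eqxx ?andbF.
apply: (@perm_trans _ (filter touch (label_edges x0 xs El))).
  by rewrite perm_sym; apply: perm_filter; apply: labels_elist.
rewrite /label_edges filter_map; apply/seq.permP => a; congr (count a (map _ _)).
apply: eq_in_filter => -[i j] /(allP bnd) /= /andP[ij jn].
have i_n := ltn_trans ij jn.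
by rewrite /touch !inE -eu -ev !nth_uniq // ![p == _]eq_sym ![q == _]eq_sym !orbA.
Qed.

Definition positions u (xs : seq G) := mask [seq u -- x | x <- xs] (iota 0 (size xs)).

Lemma mem_positions u xs i : (i \in positions u xs) = (i < size xs) && (u -- nth x0 xs i).
Proof.
rewrite /positions -(size_map (sedge u) xs) mem_mask_iota subn0 leq0n /= size_map.
by case: ltnP => ik; [rewrite (nth_map x0) | rewrite nth_default // size_map].
Qed.

Section Double.
Variables (V : {set G}) (El : seq (nat * nat)) (xs : seq G) (k : nat).
Hypothesis sz : size xs = k.
Hypothesis bnd : all (fun E => (E.1 < k) && (E.2 < k)) El.

Definition double_pair u v u' v' :=
  [/\ labels x0 (rest (rest V u v) u' v') El xs, twins V u v /\ twins V u' v', u -- v /\ u' -- v',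
      u' \in rest V u v /\ v' \in rest V u v & ~~ u -- u'].

Lemma double_pairC u v u' v' : double_pair u v u' v' -> double_pair u' v' u v.
Proof.
case=> [[ux Vx adj] [tw tw'] [uv uv'] [u'V v'V] uu']; split=> //.
- split=> // z; rewrite -Vx !mem_rest.
  by case: (z == u); case: (z == v); case: (z == u'); case: (z == v').
- have [uV vV _ _] := tw; move: u'V v'V; rewrite !mem_rest uV vV !andbT.
  by rewrite !(eq_sym u) !(eq_sym v) => /and3P[-> -> _] /and3P[-> -> _].
by rewrite sedge_sym.
Qed.

(** The pair [u'], [v'] is appended first, as twins of [rest V u v]. Since [u] is adjacent to
    neither of them, the positions of its neighbours are not affected. *)
Lemma double_labels u v u' v' : double_pair u v u' v' ->
  labels x0 V (double_edges k El (positions u' xs) (positions u xs)) (xs ++ [:: u'; v'; u; v]).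
Proof.
case=> [lab [tw tw'] [uv uv'] [u'V v'V] uu'].
have tw1 : twins (rest V u v) u' v'.
  have [_ _ uv1 h] := tw'; split=> // z; rewrite mem_rest => /and3P[_ _ zV]; exact: h.
have := labels_twins tw1 lab sz bnd; rewrite uv' => lab1.
have sz1 : size (xs ++ [:: u'; v']) = k.+2 by rewrite size_cat sz addn2.
have := labels_twins tw lab1 sz1; rewrite uv -catA /=.
have -> : mask [seq u -- x | x <- xs ++ [:: u'; v']] (iota 0 k.+2) = positions u xs.
  have uv2 : u -- v' = false.
    have [_ _ _ h] := tw'; have [uV vV uv1 _] := tw; move: u'V v'V; rewrite !mem_rest.
    case/and3P=> h1 _ _ /and3P[h2 _ _]; rewrite sedge_sym -h // 1?eq_sym //.
    by rewrite sedge_sym (negbTE uu').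
  have -> : iota 0 k.+2 = iota 0 k ++ [:: k; k.+1] by rewrite -[k.+2]addn2 iotaD.
  rewrite map_cat [map _ [:: _; _]]/= (negbTE uu') uv2 mask_cat ?size_map ?size_iota //=.
  by rewrite cats0 /positions sz.
rewrite /positions sz /double_edges -catA; apply.
rewrite all_cat; apply/andP; split.
  by apply: sub_all bnd => E /andP[h1 h2]; rewrite !(leq_trans (leqW h1)) ?(leq_trans (leqW h2)).
apply/allP=> -[i j]; rewrite mem_twin_edges -/(positions _ _) => h.
have : (i < k.+1) && (j < k.+2).
  case/or3P: h => /andP[].
  - by move/eqP->; rewrite -sz -/(positions u' xs) mem_positions => /andP[h _]; rewrite (leqW h) !ltnS leqnSn.
  - by move/eqP->; rewrite -sz -/(positions u' xs) mem_positions => /andP[h _]; rewrite (leqW h) !ltnS leqnn.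
  - by move=> _ /andP[/eqP-> /eqP->]; rewrite !ltnS !leqnn.
by case/andP=> h1 h2; rewrite /= (leqW h1).
Qed.

Lemma double_table_dec ps u v u' v' m w : double_pair u v u' v' ->
  all (fun p => size p == k) ps ->
  in_table double_table [seq p ++ [:: k; k.+1; k.+2; k.+3] | p <- ps] k.+4 m
    (adj_rows k.+4 (double_edges k El (positions u' xs) (positions u xs))) ->
  wodd w (theta u v (plist V u v)) -> wodd w (theta u' v' (plist V u' v')) ->
  ~~ wodd w (elist V) -> dec w (elist V).
Proof.
move=> dp /allP szps tbl o1 o2 ev; have lab := double_labels dp.
have [_ [tw tw'] _ _ _] := dp.
have szX : size (xs ++ [:: u'; v'; u; v]) = k.+4 by rewrite size_cat sz addn4.
have [B [q [okB oB /mapP[p pps eq_q] szq labB]]] := in_tableP double_table_ok lab szX tbl.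
have szp : size p = k by apply/eqP/szps.
have szm : size (map (nth x0 (xs ++ [:: u'; v'; u; v])) q) = k.+4 by rewrite size_map.
have [uE bndB] : uniq (base_edges B) /\ all (fun E => E.1 < E.2 < k.+4) (base_edges B).
  by case/andP: okB => b /and4P[_ u0 _ _]; rewrite -oB.
have nthk j : j < 4 -> nth x0 (map (nth x0 (xs ++ [:: u'; v'; u; v])) q) (k + j) = nth x0 [:: u'; v'; u; v] j.
  move=> j4; have kj : k + j < k.+4 by rewrite -[k.+4]addn4 ltn_add2l.
  rewrite (nth_map 0) ?szq // eq_q (nth_cat 0 p) szp ltnNge leq_addr /= addKn.
  have -> : nth 0 [:: k; k.+1; k.+2; k.+3] j = k + j.
    by case: j j4 {kj} => [|[|[|[|j]]]] // _; rewrite ?addn0 ?addn1 ?addn2 ?addn3.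
  by rewrite nth_cat sz ltnNge leq_addr /= addKn.
apply: (base_dec okB labB); rewrite ?szm ?oB // /last_pairs !subSS !subn0 /= andbT.
have n0 := nthk 0 isT; have n1 := nthk 1 isT; have n2 := nthk 2 isT; have n3 := nthk 3 isT.
rewrite addn0 in n0; rewrite addn1 in n1; rewrite addn2 in n2; rewrite addn3 in n3.
have hs := theta_incident labB; rewrite szm in hs.
apply/andP; split.
  by rewrite -(wodd_perm _ (hs u' v' k k.+1 bndB uE tw' _ _ n0 n1)) // !ltnS ?leqnSn ?leqW.
rewrite -(wodd_perm _ (hs u v k.+2 k.+3 bndB uE tw _ _ n2 n3)) //.
Qed.

Lemma size_positions u v u' v' : double_pair u v u' v' ->
  size (positions u xs) = #|nbr (rest V u v) u|.
Proof.
case=> [[ux Vx adj] [tw tw'] [uv uv'] [u'V v'V] uu'].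
rewrite /positions size_mask ?size_map ?size_iota // count_map -size_filter.
rewrite -(card_uniqP (filter_uniq _ ux)); apply: eq_card => z.
rewrite mem_filter in_nbr -Vx (mem_rest (rest V u v)) andbC /=.
have [_ _ _ h] := tw'; have [uV vV uv1 _] := tw; move: u'V v'V; rewrite !(mem_rest V).
case/and3P=> h1 h1' _ /and3P[h2 h2' _].
case: (eqVneq z u') => [->|zu'] /=; first by rewrite (negbTE uu') !andbF.
case: (eqVneq z v') => [->|zv'] //=; rewrite (sedge_sym u) -h //; last by rewrite eq_sym.
  by rewrite sedge_sym (negbTE uu') !andbF.
by rewrite eq_sym.
Qed.

Lemma positions_triple u v u' v' : double_pair u v u' v' ->
  #|nbr (rest V u v) u| = 3 -> positions u xs \in triples k.
Proof.
move=> dp N3; rewrite mem_filter (size_positions dp) N3 /=.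
apply/mapP; exists [seq u -- x | x <- xs]; last by rewrite /positions sz.
by rewrite -sz -(size_map (sedge u)) mem_bitseqs.
Qed.

Lemma double_ext ps u v u' v' w : double_ok k El ps ->
  (forall l, l \in triples k -> all (fun p => size p == k) (ps l)) ->
  double_pair u v u' v' ->
  #|nbr (rest V u v) u| = 3 -> #|nbr (rest V u' v') u'| = 3 ->
  1 < #|nbr (rest V u v) u :&: nbr (rest V u' v') u'| ->
  wodd w (theta u v (plist V u v)) -> wodd w (theta u' v' (plist V u' v')) ->
  ~~ wodd w (elist V) -> dec w (elist V).
Proof.
move=> ok szps dp N3 N3' NN o1 o2 ev; have dp' := double_pairC dp.
have t := positions_triple dp N3; have t' := positions_triple dp' N3'.
move: ok; rewrite /double_ok lallE => /allP/(_ _ t'); rewrite lallE => /allP/(_ _ t) /=.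
have -> : (count [in positions u' xs] (positions u xs) < 2) = false.
  apply/negbTE; rewrite -leqNgt; apply: leq_trans NN _.
  have [[ux Vx _] [tw tw'] _ [u'V v'V] uu'] := dp.
  rewrite cardE -(size_map (index^~ xs)) -size_filter; apply: uniq_leq_size.
    rewrite map_inj_in_uniq ?enum_uniq // => a b.
    have mx z : z \in enum (nbr (rest V u v) u :&: nbr (rest V u' v') u') -> z \in xs.
      rewrite mem_enum in_setI !in_nbr !(mem_rest V) -Vx !mem_rest.
      by case/andP=> /andP[/and3P[-> -> _] _] /andP[/and3P[-> -> ->] _].
    by move=> /mx ax /mx bx e; rewrite -(nth_index x0 ax) e nth_index.
  move=> i /mapP[z]; rewrite mem_enum in_setI !in_nbr !(mem_rest V).
  case/andP=> /andP[/and3P[h1 h2 _] uz] /andP[/and3P[h3 h4 h5] uz'] ->.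
  have zx : z \in xs by rewrite -Vx !mem_rest h1 h2 h3 h4.
  by rewrite mem_filter !mem_positions index_mem zx nth_index // uz uz'.
have lab := double_labels dp.
have szX : size (xs ++ [:: u'; v'; u; v]) = k.+4 by rewrite size_cat sz addn4.
rewrite -szX (labels_p4 cog lab) szX.
(* The table may contain the graph with the two pairs in the opposite order. *)
case: ifP => [tbl _|_ tbl].
  exact: (double_table_dec dp (szps _ t') tbl o1 o2 ev).
exact: (double_table_dec dp' (szps _ t) tbl o2 o1 ev).
Qed.

End Double.

Lemma exceptional_two_twins V u v u' v' w : exceptional (rest (rest V u v) u' v') ->
  twins V u v -> twins V u' v' -> u -- v -> u' -- v' ->
  u' \in rest V u v -> v' \in rest V u v -> ~~ u -- u' ->
  #|nbr (rest V u v) u| = 3 -> #|nbr (rest V u' v') u'| = 3 ->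
  1 < #|nbr (rest V u v) u :&: nbr (rest V u' v') u'| ->
  wodd w (theta u v (plist V u v)) -> wodd w (theta u' v' (plist V u' v')) ->
  ~~ wodd w (elist V) -> dec w (elist V).
Proof.
move=> exc tw tw' uv uv' u'V v'V uu'.
case: exc => -[xs sz lab].
  apply: (double_ext sz _ K5_double_ok) => //.
  by apply/allP; vm_compute.
apply: (double_ext sz _ K5s_double_ok) => //.
Qed.

End Exceptional.

(** * Removal of two pairs of twins *)

Section TwoTwins.
Variables (G : sgraph) (x0 : G).
Hypothesis cog : cograph G.
Implicit Types (V N S A : {set G}) (u v x y z : G) (w : pred {set G}).

Lemma base_list_dec B xs (l : seq {set G}) w : base_check no_odd B -> uniq xs ->
  size xs = base_order B -> perm_eq (label_edges x0 xs (base_edges B)) l ->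
  ~~ wodd w l -> dec w l.
Proof.
case/andP=> _ chk ux sz e ev; apply: (perm_dec e).
apply: (label_checkP (Os := [::]) (Ds := base_decs B) ux) => //.
  by rewrite sz; exact: chk.
by rewrite (wodd_perm _ e).
Qed.

Ltac flip_edges a s :=
  match s with
  | ?x :: ?s' => rewrite ?(setUC [set a] [set x]); flip_edges a s'
  | _ => idtac
  end.

Lemma dec_two_thetas b1 b2 y y' u v u' v' w :
  uniq [:: b1; b2; y; u; v; u'; v'] -> (y' == y) || (y' \notin [:: b1; b2; y; u; v; u'; v']) ->
  let L := theta u v [:: None; Some b1; Some b2; Some y] ++
           theta u' v' [:: None; Some b1; Some b2; Some y'] in
  ~~ wodd w L -> dec w L.
Proof.
move=> un y'ok L; case/orP: y'ok => [/eqP ey|y'n].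
  apply: (base_list_dec base_D1_ok (xs := [:: b1; u; b2; y; v; u'; v'])) => //.
    by apply: etrans un; apply: perm_uniq; apply/permP=> q /=; lia.
  rewrite /L ey /theta /label_edges /=.
  flip_edges b1 [:: u; v; u'; v']; flip_edges b2 [:: u; v; u'; v'];
  flip_edges y [:: u; v; u'; v'].
  by count_edges.
apply: (base_list_dec base_Q2_ok (xs := [:: b1; u; b2; y; v; u'; y'; v'])) => //.
  have : uniq [:: y', b1, b2, y, u, v, u' & [:: v']] by rewrite cons_uniq y'n.
  by move=> h; apply: etrans h; apply: perm_uniq; apply/permP=> q /=; lia.
rewrite /L /theta /label_edges /=.
flip_edges b1 [:: u; v; u'; v']; flip_edges b2 [:: u; v; u'; v'];
flip_edges y [:: u; v]; flip_edges y' [:: u'; v'].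
by count_edges.
Qed.

Lemma theta_nbr V u v b1 b2 y : u -- v -> uniq [:: b1; b2; y] ->
  nbr (rest V u v) u =i [:: b1; b2; y] ->
  perm_eq (theta u v [:: None; Some b1; Some b2; Some y]) (theta u v (plist V u v)).
Proof.
move=> uv un e; rewrite /plist uv; apply: perm_theta; rewrite /= perm_cons.
rewrite -[[:: Some _; _; _]]/(map Some [:: b1; b2; y]); apply: perm_map.
by apply: uniq_perm => //; [exact: enum_uniq | move=> z; rewrite mem_enum e].
Qed.

Definition pair_of_twins V u v u' v' :=
  [/\ twins V u v /\ twins V u' v', u -- v /\ u' -- v',
      u' \in rest V u v /\ v' \in rest V u v & ~~ u -- u'].

Lemma nbr_pair V u v u' v' : pair_of_twins V u v u' v' ->
  nbr (rest (rest V u v) u' v') u' = nbr (rest V u' v') u'.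
Proof.
case=> [[[uV vV uv tw] [u'V v'V uv' tw']] [ad ad'] [u'R v'R] uu'].
apply/setP=> z; rewrite !in_nbr !mem_rest.
case: (eqVneq z u) => [->|_]; first by rewrite sedge_sym (negbTE uu') !andbF.
case: (eqVneq z v) => [->|_] //=; move: u'R; rewrite mem_rest => /and3P[h1 h2 h3].
by rewrite (sedge_sym u') -tw // (negbTE uu') !andbF.
Qed.

(** Both bundles of paths are odd, so together they are even, and so is the rest. The rest is
    decomposed by hypothesis; the bundles share two or three middle vertices and form one of the two
    graphs of [dec_two_thetas]. *)
Lemma dec_pair V u v u' v' w (N := nbr (rest V u v) u) (N' := nbr (rest V u' v') u') :
  pair_of_twins V u v u' v' -> secd (rest (rest V u v) u' v') ->
  #|N| = 3 -> #|N'| = 3 -> 1 < #|N :&: N'| ->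
  wodd w (theta u v (plist V u v)) -> wodd w (theta u' v' (plist V u' v')) ->
  ~~ wodd w (elist V) -> dec w (elist V).
Proof.
move=> pt sV N3 N3' NN o1 o2 ev; have eN := nbr_pair pt.
have [[tw tw'] [uv uv'] [u'R v'R] uu'] := pt.
have tw1 : twins (rest V u v) u' v'.
  have [_ _ uv1 h] := tw'; split=> // z; rewrite mem_rest => /and3P[_ _ zV]; exact: h.
have e1 := elist_twins tw1.
have ep : plist (rest V u v) u' v' = plist V u' v' by rewrite /plist eN.
rewrite ep in e1.
have e2 : perm_eq (elist (rest (rest V u v) u' v') ++
    (theta u v (plist V u v) ++ theta u' v' (plist V u' v'))) (elist V).
  apply: perm_trans (elist_twins tw); rewrite perm_catCA.
  by rewrite perm_catC perm_cat2r.
have evt : ~~ wodd w (theta u v (plist V u v) ++ theta u' v' (plist V u' v')).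
  by rewrite wodd_cat o1 o2.
apply: (perm_dec e2); apply: dec_cat.
  by apply: sV; move: ev; rewrite -(wodd_perm _ e2) wodd_cat (negbTE evt) addbF.
have [b1 [b2 [b1N b2N b12]]] : exists b1 b2, [/\ b1 \in N :&: N', b2 \in N :&: N' & b1 != b2].
  by case/card_gt1P: NN => b1 [b2 [h1 h2 h3]]; exists b1, b2.
have third (S : {set G}) : #|S| = 3 -> b1 \in S -> b2 \in S ->
    exists y, [/\ y != b1, y != b2 & S =i [:: b1; b2; y]].
  move=> S3 h1 h2; have : #|S :\ b1 :\ b2| = 1.
    by move: S3; rewrite (cardsD1 b1) h1 (cardsD1 b2 (S :\ b1)) !inE h2 eq_sym b12 => -[].
  move/eqP/cards1P=> [y ey]; have : y \in S :\ b1 :\ b2 by rewrite ey inE.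
  rewrite !inE => /and3P[y2 y1 yS]; exists y; split=> // z; rewrite !inE.
  move/setP/(_ z): ey; rewrite !inE; case: (eqVneq z b1) => [->|_]; first by rewrite h1.
  by case: (eqVneq z b2) => [->|_] //=; rewrite h2.
move: b1N b2N; rewrite !in_setI => /andP[b1N b1N'] /andP[b2N b2N'].
have [y [y1 y2 eNy]] := third _ N3 b1N b2N; have [y' [y1' y2' eNy']] := third _ N3' b1N' b2N'.
have un : uniq [:: b1; b2; y] by rewrite /= !inE negb_or b12 !(eq_sym _ y) y1 y2.
have un' : uniq [:: b1; b2; y'] by rewrite /= !inE negb_or b12 !(eq_sym _ y') y1' y2'.
have t1 := theta_nbr uv un eNy; have t2 := theta_nbr uv' un' eNy'.
have t12 := perm_cat t1 t2.
apply: (perm_dec t12).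
have inN z : z \in N -> [&& z != u, z != v, z != u' & z != v'].
  rewrite in_nbr mem_rest => /andP[/and3P[-> -> zV] uz] /=; apply/andP; split.
    by apply: contraTneq uz => ->.
  apply: contraTneq uz => ->; have [_ _ _ h] := tw'; have [uV _ _ _] := tw.
  move: u'R v'R; rewrite !mem_rest => /and3P[h1 _ _] /and3P[h2 _ _].
  by rewrite sedge_sym -h 1?eq_sym // sedge_sym.
have inN' z : z \in N' -> [&& z != u, z != v, z != u' & z != v'].
  rewrite /N' -eN in_nbr !mem_rest => /andP[/and3P[-> -> /and3P[-> -> _]] _] //.
have yN : y \in N by rewrite eNy !inE eqxx !orbT.
have yN' : y' \in N' by rewrite eNy' !inE eqxx !orbT.
have /and4P[hb1 hb2 hb3 hb4] := inN _ b1N; have /and4P[hc1 hc2 hc3 hc4] := inN _ b2N.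
have /and4P[hy1 hy2 hy3 hy4] := inN _ yN; have /and4P[hz1 hz2 hz3 hz4] := inN' _ yN'.
have [_ _ nuv _] := tw; have [_ _ nuv' _] := tw'.
move: u'R v'R; rewrite !mem_rest !(eq_sym _ u) !(eq_sym _ v) => /and3P[k1 k2 _] /and3P[k3 k4 _].
apply: dec_two_thetas.
- rewrite /= !inE !negb_or b12 (eq_sym b1 y) (eq_sym b2 y) y1 y2 hb1 hb2 hb3 hb4.
  by rewrite hc1 hc2 hc3 hc4 hy1 hy2 hy3 hy4 nuv nuv' k1 k2 k3 k4.
- by case: (eqVneq y' y) => //= ne; rewrite !inE !negb_or y1' y2' ne hz1 hz2 hz3 hz4.
by rewrite (wodd_perm _ t12).
Qed.

(** If one bundle of paths is even, its pair alone is removed by [dec_twins_even]; both pairs are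
    removed only when both bundles are odd. *)
Lemma secd_pair V u v u' v' (N := nbr (rest V u v) u) (N' := nbr (rest V u' v') u') :
  pair_of_twins V u v u' v' -> secd (rest V u v) -> secd (rest V u' v') ->
  exceptional x0 (rest (rest V u v) u' v') \/ secd (rest (rest V u v) u' v') ->
  #|N| = 3 -> #|N'| = 3 -> 1 < #|N :&: N'| -> secd V.
Proof.
move=> pt s1 s2 s3 N3 N3' NN w ev; have [[tw tw'] [uv uv'] [u'R v'R] uu'] := pt.
case: (boolP (wodd w (theta u v (plist V u v)))) => o1; last first.
  by apply: dec_twins_even tw s1 _ ev o1; rewrite size_plist uv -/N N3.
case: (boolP (wodd w (theta u' v' (plist V u' v')))) => o2; last first.
  by apply: dec_twins_even tw' s2 _ ev o2; rewrite size_plist uv' -/N' N3'.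
case: s3 => s3; last exact: (dec_pair pt s3).
exact: (exceptional_two_twins cog s3 tw tw').
Qed.

End TwoTwins.

(** * Joins and connectivity *)

Section Structure.
Variable G : sgraph.
Hypothesis cog : cograph G.
Implicit Types (V N S A B C D : {set G}) (u v x y z : G).

Definition join V A B := V = A :|: B /\ forall a b, a \in A -> b \in B -> a -- b.

Lemma joinC V A B : join V A B -> join V B A.
Proof.
by case=> -> h; split=> [|a b aB bA]; [rewrite setUC | rewrite sedge_sym h].
Qed.

Lemma join_notin V A B x : join V A B -> x \in A -> x \notin B.
Proof. by case=> _ h xA; apply/negP=> /(h x x xA); rewrite sedge_irrefl. Qed.

Lemma join_disjoint V A B : join V A B -> A :&: B = set0.
Proof.
move=> j; apply/setP=> x; rewrite !inE; case: (boolP (x \in A)) => //= xA.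
exact/negbTE/(join_notin j xA).
Qed.

Lemma card_join V A B : join V A B -> #|V| = #|A| + #|B|.
Proof. by move=> j; have [-> _] := j; rewrite cardsU (join_disjoint j) cards0 subn0. Qed.

Lemma connS_or S : connS S \/ split_by (fun a b => ~~ a -- b) S.
Proof.
case: (boolP [exists A : {set G}, [&& A \subset S, A != set0, A != S &
  [forall a in A, forall b in S, (b \notin A) ==> ~~ a -- b]]]).
  case/existsP=> A /and4P[s0 n0 nS /forall_inP h]; right; exists A; split=> // a b aA bS.
  by apply/implyP; move/forall_inP: (h a aA); apply.
rewrite negb_exists => /forallP h; left => A s0 n0 nS; have := h A.
rewrite s0 n0 nS negb_forall_in => /exists_inP[a aA].
rewrite negb_forall_in => /exists_inP[b bS]; rewrite negb_imply negbK => /andP[bA ab].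
by exists a, b.
Qed.

Lemma connS_split S : connS S -> ~ split_by (fun a b => ~~ a -- b) S.
Proof.
move=> c [A [s0 n0 nS h]]; have [a [b [aA bS bA]]] := c A s0 n0 nS.
by apply/negP; apply: h.
Qed.

Lemma split_join V : split_by sedge V -> exists A B, [/\ join V A B, 0 < #|A| & 0 < #|B|].
Proof.
case=> A [sA A0 AV h]; exists A, (V :\: A); split; rewrite ?card_gt0 //.
  split=> [|a b aA]; first by rewrite -{1}(setID V A) (setIidPr sA).
  by rewrite inE => /andP[bA bV]; apply: h.
by apply: contraNneq AV => /eqP; rewrite setD_eq0 eqEsubset sA => ->.
Qed.

Lemma connS_join V : connS V -> 1 < #|V| -> exists A B, [/\ join V A B, 0 < #|A| & 0 < #|B|].
Proof.
move=> cV V1; apply: split_join.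
have [//|/(connS_split cV)//] := seinsche (@sedge_sym G) (cograph_p4_free cog) V1.
Qed.

Lemma join_connS V A B : join V A B -> 0 < #|A| -> 0 < #|B| -> connS V.
Proof.
move=> j; have [-> h] := j; rewrite !card_gt0 => /set0Pn[a0 a0A] /set0Pn[b0 b0B] S sS S0 SV.
have jC := joinC j; have [_ h'] := jC.
case: (boolP [exists a in A, exists b in B, (a \in S) != (b \in S)]) => [|no].
  case/exists_inP=> a aA /exists_inP[b bB]; case: (boolP (a \in S)) => aS.
    by case: (boolP (b \in S)) => // bS _; exists a, b; rewrite inE bB orbT h.
  case: (boolP (b \in S)) => // bS _.
  by exists b, a; rewrite inE aA sedge_sym h.
have eqS a b : a \in A -> b \in B -> (a \in S) = (b \in S).
  move=> aA bB; move: no; rewrite negb_exists_in => /forall_inP/(_ a aA).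
  by rewrite negb_exists_in => /forall_inP/(_ b bB); rewrite negbK => /eqP.
have all x : x \in A :|: B -> (x \in S) = (a0 \in S).
  rewrite inE => /orP[xA|xB]; last by rewrite (eqS a0 x).
  by rewrite (eqS x b0) // (eqS a0 b0).
have [s sS0] := set0Pn _ S0; have sAB := subsetP sS s sS0.
case/negP: SV; rewrite eqEsubset sS; apply/subsetP=> x xAB.
by rewrite all // -(all s).
Qed.

Lemma connS_small S : #|S| <= 1 -> connS S.
Proof.
move=> S1 A sA A0 AS; case/negP: AS; rewrite eqEcard sA.
by apply: leq_trans S1 _; rewrite card_gt0.
Qed.

(** 2-connectedness in the language of cuts, so that it can be read off from joins. *)
Definition two_conn V := [/\ 2 < #|V|, connS V & forall x, x \in V -> connS (V :\ x)].

Lemma join_D1 V A B x : join V A B -> x \in A -> join (V :\ x) (A :\ x) B.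
Proof.
move=> j xA; have xB := join_notin j xA; have [-> h] := j; split=> [|a b].
  by apply/setP=> z; rewrite !inE; case: (eqVneq z x) => [->|]; rewrite ?(negbTE xB).
by rewrite inE => /andP[_ aA]; apply: h.
Qed.

(** Deleting a vertex leaves a join of two nonempty sides, unless [A] is that vertex alone; then [B]
    is left and has to be connected itself. *)
Lemma two_conn_join V A B : join V A B -> 0 < #|A| -> 1 < #|B| ->
  connS B \/ 1 < #|A| -> two_conn V.
Proof.
move=> j A0 B1 cB; have jC := joinC j; split.
- by rewrite (card_join j); case: cB => [cB|A1]; [rewrite -(addn1 1) addnC -addn1; apply: leq_add |
    apply: leq_add (ltnW A1) B1].
- by apply: join_connS j _ _ => //; apply: ltnW.
move=> x; have [eV _] := j; rewrite eV inE -eV => /orP[xA|xB]; last first.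
  apply: join_connS (join_D1 jC xB) _ A0; move: B1; rewrite (cardsD1 x) xB.
  by rewrite add1n ltnS.
have jx := join_D1 j xA; case: (posnP #|A :\ x|) => [A'0|A'].
  case: cB => [cB|]; last by rewrite (cardsD1 x) xA A'0.
  have [-> _] := jx; move/eqP: A'0; rewrite cards_eq0 => /eqP->.
  by rewrite set0U.
by apply: join_connS jx A' (ltnW B1).
Qed.

End Structure.

(** * Twins and modules in cographs *)

Section Twins.
Variable G : sgraph.
Hypothesis cog : cograph G.
Implicit Types (V N S A B C D M : {set G}) (u v x y z : G).

Definition module A V := A \subset V /\
  forall a a' b, a \in A -> a' \in A -> b \in V -> b \notin A -> a -- b = a' -- b.

Lemma twins_module A V u v : module A V -> twins A u v -> twins V u v.
Proof.
move=> [sA h] [uA vA uv tw]; split; rewrite ?(subsetP sA) // => z zV zu zv.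
by case: (boolP (z \in A)) => zA; [exact: tw | exact: h].
Qed.

Lemma nbr_module A V u v : A \subset V -> nbr (rest A u v) u \subset nbr (rest V u v) u.
Proof.
move=> sA; apply/subsetP=> z; rewrite !in_nbr !mem_rest.
by case/andP=> /and3P[-> -> /(subsetP sA)->].
Qed.

Lemma join_module V A B : join V A B -> module A V.
Proof.
case=> -> h; split=> [|a a' b aA a'A]; first exact: subsetUl.
by rewrite inE => /orP[->//|bB _]; rewrite !h.
Qed.

Lemma split_module V A : A \subset V ->
  (forall a b, a \in A -> b \in V -> b \notin A -> ~~ a -- b) -> module A V.
Proof.
by move=> sA h; split=> // a a' b aA a'A bV bA; rewrite (negbTE (h a b _ _ _)) // (negbTE (h a' b _ _ _)).
Qed.

Lemma setDC_split V A : A \subset V ->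
  (forall a b, a \in A -> b \in V -> b \notin A -> ~~ a -- b) ->
  forall a b, a \in V :\: A -> b \in V -> b \notin V :\: A -> ~~ a -- b.
Proof.
move=> sA h a b; rewrite !inE => /andP[aA aV] bV; rewrite bV andbT negbK => bA.
by rewrite sedge_sym; apply: h.
Qed.

(** By Seinsche's theorem [V] falls into two modules, being a join or disconnected. Twins of a
    module are twins of [V]; if both modules are single vertices, these two are the twins. *)
Lemma twins_exist V : 1 < #|V| -> exists u v, twins V u v.
Proof.
elim: {V}#|V| {-2}V (leqnn #|V|) => [|n IH] V; first by lia.
move=> Vn V1.
have [A [B [mA mB A0 B0 [eV cV]]]] : exists A B, [/\ module A V, module B V, 0 < #|A|, 0 < #|B|
    & V = A :|: B /\ #|V| = #|A| + #|B|].
  case: (seinsche (@sedge_sym G) (cograph_p4_free cog) V1) => [/split_join[A [B [j A0 B0]]]|].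
    exists A, B; split=> //; [exact: join_module j | exact: join_module (joinC j) |].
    by rewrite (card_join j); case: j.
  case=> A [sA A0 AV h]; exists A, (V :\: A); split; rewrite ?card_gt0 //.
  - exact: split_module.
  - by apply: split_module; [exact: subsetDl | exact: setDC_split].
  - by apply: contraNneq AV => /eqP; rewrite setD_eq0 eqEsubset sA => ->.
  split; first by rewrite -{1}(setID V A) (setIidPr sA).
  by rewrite -(cardsID A V) (setIidPr sA).
case: (ltnP 1 #|A|) => A1.
  have [|u [v tw]] := IH A _ A1; first by rewrite cV in Vn; clear -Vn B0; lia.
  by exists u, v; apply: twins_module tw.
case: (ltnP 1 #|B|) => B1.
  have [|u [v tw]] := IH B _ B1; first by rewrite cV in Vn; clear -Vn A0; lia.
  by exists u, v; apply: twins_module tw.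
have /cards1P[a eA] : #|A| == 1 by rewrite eqn_leq A1.
have /cards1P[b eB] : #|B| == 1 by rewrite eqn_leq B1.
exists a, b; split; rewrite ?eV ?eA ?eB ?inE ?eqxx ?orbT //.
  by apply: contraTneq V1 => ab; rewrite eV eA eB ab setUid cards1.
by move=> z; rewrite !inE => /orP[]->.
Qed.

(** In a join, twins of one side have the whole other side as common neighbours. In a disconnected
    graph one descends to the part that contains [x], where [x] keeps its degree. *)
Lemma twins_nbr_exist V x : x \in V -> 1 < #|nbr V x| ->
  exists u v, twins V u v /\ 0 < #|nbr (rest V u v) u|.
Proof.
elim: {V}#|V| {-2}V x (leqnn #|V|) => [|n IH] V x.
  by rewrite leqn0 cards_eq0 => /eqP->; rewrite inE.
move=> Vn xV dx; have sN : nbr V x \subset V by apply/subsetP=> z; rewrite in_nbr => /andP[].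
have V2 : 2 < #|V|.
  apply: leq_ltn_trans dx _; apply: proper_card; apply/properP; split=> //.
  by exists x; rewrite // in_nbr sedge_irrefl andbF.
have finish D : module D V -> #|D| < #|V| -> x \in D -> nbr V x \subset D ->
    exists u v, twins V u v /\ 0 < #|nbr (rest V u v) u|.
  move=> mD DV xD ND; have [||u [v [tw n0]]] := IH D x _ xD.
  - by rewrite -ltnS; apply: leq_trans DV Vn.
  - apply: leq_trans dx (subset_leq_card _); apply/subsetP=> z zN.
    by rewrite in_nbr (subsetP ND) //; move: zN; rewrite in_nbr => /andP[].
  exists u, v; split; first exact: twins_module tw.
  by apply: leq_trans n0 (subset_leq_card (nbr_module _ _ (proj1 mD))).
case: (seinsche (@sedge_sym G) (cograph_p4_free cog) (ltnW V2)) => [/split_join[A [B [j A0 B0]]]|].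
  wlog A1 : A B j A0 B0 / 1 < #|A|.
    move=> wl; case: (ltnP 1 #|A|) => A1; first exact: wl j A0 B0 A1.
    apply: (wl B A (joinC j) B0 A0).
    by move: V2; rewrite (card_join j); clear -A1; lia.
  have [u [v tw]] := twins_exist A1; exists u, v; split; first exact: twins_module (join_module j) tw.
  have [uA vA _ _] := tw; rewrite !card_gt0 in B0 *; have [b bB] := set0Pn _ B0.
  apply/set0Pn; exists b; have [eV h] := j; rewrite in_nbr mem_rest (h u b) // eV inE bB orbT !andbT.
  by apply/andP; split; apply: contraTneq bB => ->; apply: join_notin j _.
case=> A [sA A0 AV h].
have ltA : #|A| < #|V| by apply: proper_card; rewrite properEneq AV.
have ltA' : #|V :\: A| < #|V|.
  have [a aA] := set0Pn _ A0; apply: proper_card; apply/properP; split; first exact: subsetDl.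
  by exists a; rewrite ?inE ?aA ?(subsetP sA).
case: (boolP (x \in A)) => xA.
  apply: (finish A) => //; first exact: split_module.
  apply/subsetP=> z; rewrite in_nbr => /andP[zV]; apply: contraTT => zA; exact: h.
apply: (finish (V :\: A)) => //.
- by apply: split_module; [exact: subsetDl | exact: setDC_split].
- by rewrite inE xA.
apply/subsetP=> z; rewrite in_nbr inE => /andP[zV xz]; rewrite zV andbT.
by apply: contraL xz => zA; rewrite sedge_sym; apply: h.
Qed.

Definition euler V := forall x, x \in V -> ~~ odd #|nbr V x|.

Lemma nbr_twins V u v : twins V u v -> #|nbr V u| = u -- v + #|nbr (rest V u v) u|.
Proof.
move=> [uV vV uv tw]; rewrite (cardsD1 v) in_nbr vV; congr (_ + _).
apply: eq_card => z; rewrite !inE negb_or.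
by case: (eqVneq z u) => [->|_]; rewrite ?sedge_irrefl ?andbF //= andbA.
Qed.

Lemma nbr_rest V u v x : twins V u v -> x \in rest V u v ->
  #|nbr V x| = (u -- x).*2 + #|nbr (rest V u v) x|.
Proof.
move=> [uV vV uv tw]; rewrite mem_rest => /and3P[xu xv xV].
rewrite (cardsD1 u) (cardsD1 v) addnA !inE uV vV [v == u]eq_sym uv /=.
rewrite (sedge_sym x u) (sedge_sym x v) -tw // -addnn; congr (_ + _).
by apply: eq_card => z; rewrite !inE negb_or; case: (z == u); case: (z == v).
Qed.

Lemma euler_rest V u v : twins V u v -> euler V -> euler (rest V u v).
Proof.
move=> tw eu x xR; have := eu x; move: (xR); rewrite mem_rest => /and3P[_ _ ->] /(_ isT).
by rewrite (nbr_rest tw xR) oddD odd_double.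
Qed.

Lemma euler_twins V u v : twins V u v -> euler V -> ~~ odd (u -- v + #|nbr (rest V u v) u|).
Proof. by move=> tw eu; rewrite -nbr_twins //; apply: eu; case: tw. Qed.

Lemma nbr_join V A B x : join V A B -> x \in A -> #|nbr V x| = #|nbr A x| + #|B|.
Proof.
move=> j xA; have [eV h] := j.
have -> : nbr V x = nbr A x :|: B.
  apply/setP=> z; rewrite !inE eV inE; case: (boolP (z \in B)) => zB; rewrite ?orbT ?orbF //.
  by rewrite h.
rewrite cardsU (_ : _ :&: _ = set0) ?cards0 ?subn0 //; apply/setP=> z; rewrite !inE.
case: (boolP (z \in A)) => //= zA; by rewrite (negbTE (join_notin j zA)) andbF.
Qed.

(* Another pair of twins with a common neighbour, unless [u], [v], [y] form a triangle
   component and all other vertices are isolated; a vertex adjacent to [y] and one that is not,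
   joined by an edge, would give the induced path [u y d f]. *)
Lemma twins_triangle A u v y : euler A -> twins A u v -> u -- v ->
  nbr (rest A u v) u = [set y] ->
  (exists u' v', [/\ twins A u' v', u' \in rest A u v, v' \in rest A u v
     & 0 < #|nbr (rest A u' v') u'|]) \/
  (forall z, z \in rest A u v -> z != y -> nbr A z = set0).
Proof.
move=> eu tw uv Ny; have [uA vA nuv twz] := tw.
have uy : u -- y /\ y \in rest A u v.
  have yN : y \in nbr (rest A u v) u by rewrite Ny inE.
  by move: yN; rewrite in_nbr => /andP[].
have [{}uy yR] := uy; move: (yR); rewrite mem_rest => /and3P[yu yv yA].
have vy : v -- y by rewrite -twz.
have uz z : z \in A -> z != u -> z != v -> z != y -> (u -- z = false) * (v -- z = false).
  move=> zA zu zv zy; rewrite -twz //; suff -> : u -- z = false by [].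
  apply: contraNF zy => e; suff : z \in nbr (rest A u v) u by rewrite Ny inE.
  by rewrite in_nbr mem_rest zu zv zA.
have degz z : z \in A -> z != u -> z != v -> z != y -> #|nbr A z| = y -- z + #|nbr (rest A u v :\ y) z|.
  move=> zA zu zv zy; rewrite (cardsD1 y) in_nbr yA sedge_sym; congr (_ + _).
  apply: eq_card => t; rewrite !inE negb_or; case: (eqVneq t u) => [->|_] /=.
    by rewrite (sedge_sym z) (uz z) // !andbF.
  case: (eqVneq t v) => [->|_] /=; last by rewrite -!andbA.
  by rewrite (sedge_sym z) (uz z) // !andbF.
pose D := [set z in rest A u v | y -- z].
have memD z : (z \in D) = [&& z != u, z != v, z \in A & y -- z].
  by rewrite inE mem_rest -!andbA.
(* If [y] has neighbours besides [u] and [v], they form a module [D]. By parity a vertex of [D] has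
   a neighbour other than [y], which must lie in [D]; so [D] contains twins, and [y] is a common
   neighbour of them. *)
have [D0|] := eqVneq D set0; last first.
  case/set0Pn=> d dD; left.
  have apart d1 f : d1 \in D -> f \in A -> f != y -> f \notin D -> ~~ d1 -- f.
    rewrite memD => /and4P[du dv dA yd] fA fy; rewrite memD fA.
    have dy : d1 != y by rewrite eq_sym; apply: sedge_neq.
    case: (eqVneq f u) => [->|fu] /=; first by rewrite sedge_sym (uz d1).
    case: (eqVneq f v) => [->|fv] /=; first by rewrite sedge_sym (uz d1).
    move=> yf; apply/negP=> df; have := cograph_p4_free cog uy yd df.
    by rewrite (uz d1) // (uz f) // (negbTE yf) => /(_ isT isT).
  have mD : module D A.
    split; first by apply/subsetP=> z; rewrite memD => /and4P[].
    move=> a a' b aD a'D bA bD; case: (eqVneq b y) => [->|by_].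
      by move: aD a'D; rewrite !memD !(sedge_sym _ y) => /and4P[_ _ _ ->] /and4P[_ _ _ ->].
    by rewrite (negbTE (apart a b _ _ _ _)) // (negbTE (apart a' b _ _ _ _)).
  have D1 : 1 < #|D|.
    have := eu d; move: (dD); rewrite memD => /and4P[du dv dA yd] /(_ dA).
    have dy : d != y by rewrite eq_sym; apply: sedge_neq.
    rewrite degz // yd /= negbK; case: (posnP #|nbr (rest A u v :\ y) d|) => [->//|].
    rewrite card_gt0 => /set0Pn[f]; rewrite in_nbr in_setD1 mem_rest => /andP[/and4P[fy fu fv fA] df] _.
    have fD : f \in D by apply: contraTT df => h; apply: apart.
    by apply/card_gt1P; exists d, f; rewrite dD fD; split=> //; apply: sedge_neq.
  have [u' [v' tw']] := twins_exist D1; have [u'D v'D _ _] := tw'.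
  exists u', v'; split; first exact: twins_module tw'.
  - by move: u'D; rewrite memD mem_rest => /and4P[-> -> ->].
  - by move: v'D; rewrite memD mem_rest => /and4P[-> -> ->].
  rewrite card_gt0; apply/set0Pn; exists y; rewrite in_nbr mem_rest yA andbT.
  move: u'D v'D; rewrite !memD !(sedge_sym y) => /and4P[_ _ _ e1] /and4P[_ _ _ e2].
  by rewrite e1 !(eq_sym y) (sedge_neq e1) (sedge_neq e2).
(* Now [u], [v], [y] form a component and [F] is the rest of [A]. If no degree in [F] exceeds 1, all
   of them vanish by parity. *)
pose F := rest A u v :\ y.
have memF z : (z \in F) = [&& z != y, z != u, z != v & z \in A] by rewrite in_setD1 mem_rest.
have yF z : z \in F -> ~~ y -- z.
  rewrite memF => /and4P[zy zu zv zA]; apply/negP=> yz.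
  by move/setP/(_ z): D0; rewrite memD zu zv zA yz inE.
have eqN z : z \in F -> nbr A z = nbr F z.
  move=> zF; have := zF; rewrite memF => /and4P[zy zu zv zA]; apply/setP=> t.
  rewrite !in_nbr memF; case: (eqVneq t y) => [->|_]; first by rewrite sedge_sym (negbTE (yF _ zF)) !andbF.
  case: (eqVneq t u) => [->|_]; first by rewrite (sedge_sym z) (uz z) // !andbF.
  case: (eqVneq t v) => [->|_] //.
  by rewrite (sedge_sym z) (uz z) // !andbF.
case: (boolP [exists x in F, 1 < #|nbr F x|]).
  case/exists_inP=> x xF dx; left; have [u' [v' [tw' n0]]] := twins_nbr_exist xF dx.
  have mF : module F A.
    have sF : F \subset A by apply/subsetP=> z; rewrite memF => /and4P[].
    split=> // a a' b aF a'F bA bF.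
    have h c : c \in F -> c -- b = false.
      move=> cF; have : b \in nbr A c = false by rewrite eqN // in_nbr (negbTE bF).
      by rewrite in_nbr bA.
    by rewrite !h.
  have [u'F v'F _ _] := tw'.
  exists u', v'; split; first exact: twins_module tw'.
  - by move: u'F; rewrite in_setD1 => /andP[].
  - by move: v'F; rewrite in_setD1 => /andP[].
  by apply: leq_trans n0 (subset_leq_card (nbr_module _ _ (proj1 mF))).
rewrite negb_exists_in => /forall_inP small; right=> z zR zy.
have zF : z \in F by rewrite in_setD1 zy.
have := small z zF; have : ~~ odd #|nbr F z|.
  by rewrite -eqN //; apply: eu; move: zF; rewrite memF => /and4P[].
rewrite eqN // -leqNgt; case e: #|nbr F z| => [|[|k]] //= _ _.
by apply/eqP; rewrite -cards_eq0 e.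
Qed.

End Twins.

(** * The induction on the number of vertices *)

Section Driver.
Variables (G : sgraph) (x0 : G).
Hypothesis cog : cograph G.
Implicit Types (V W N S A B C D M F : {set G}) (u v x y z : G).

Definition good V := exceptional x0 V \/ secd V.

Definition good_below V := forall W, #|W| < #|V| -> two_conn W -> euler W -> good W.

Lemma card_rest V u v : twins V u v -> #|V| = #|rest V u v|.+2.
Proof.
case=> uV vV uv _; rewrite (cardsD1 u) uV (cardsD1 v) !inE (eq_sym v) uv vV /=.
by congr (_.+2); apply: eq_card => z; rewrite !inE negb_or; case: (z == u); case: (z == v).
Qed.

(** If the rest is exceptional, then [V] extends it by a pair of twins and is settled by the table
    at once. *)
Lemma rest_good V u v : good_below V -> euler V -> twins V u v ->
  two_conn (rest V u v) -> 1 < #|nbr (rest V u v) u| -> secd (rest V u v) \/ secd V.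
Proof.
move=> IH eu tw tc N1; have lt : #|rest V u v| < #|V| by rewrite (card_rest tw).
case: (IH _ lt tc (euler_rest tw eu)) => [exc|]; last by left.
by right; apply: (exceptional_twins cog exc tw N1 (euler_twins tw eu)).
Qed.

Lemma step V u v (N := nbr (rest V u v) u) : good_below V -> euler V -> twins V u v ->
  two_conn (rest V u v) -> connS N -> 1 < #|N| -> secd V \/ (u -- v /\ #|N| = 3).
Proof.
move=> IH eu tw tc cN N1; case: (rest_good IH eu tw tc N1) => [s|]; last by left.
have [/andP[uv /eqP N3]|h] := boolP (u -- v && (#|N| == 3)); first by right.
by left; apply: (secd_twins tw s cN N1 (euler_twins tw eu) h).
Qed.

Lemma edgeless_secd S : {in S &, forall x y, ~~ x -- y} -> secd S.
Proof.
move=> h w _; suff -> : elist S = [::] by exact: dec_nil.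
case e: (elist S) => [|E l] //; have : E \in elist S by rewrite e mem_head.
by case/elistP=> x [y [_ xy xS yS]]; rewrite (negbTE (h x y xS yS)) in xy.
Qed.

(** All edges lie on the paths between [u] and [v], so these carry the whole weight, which is
    even. *)
Lemma secd_theta V u v : twins V u v -> euler V ->
  {in rest V u v &, forall x y, ~~ x -- y} -> secd V.
Proof.
move=> tw eu h w ev; apply: (dec_twins_even tw (edgeless_secd h) _ ev).
  by rewrite size_plist; apply: euler_twins.
move: ev; rewrite -(wodd_perm _ (elist_twins tw)) (_ : elist _ = [::]) //.
case e: (elist _) => [|E l] //; have : E \in elist (rest V u v) by rewrite e mem_head.
by case/elistP=> x [y [_ xy xS yS]]; rewrite (negbTE (h x y xS yS)) in xy.
Qed.

(* Two of three pairwise false twins have stars of the same parity. *)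
Lemma three_false_twins V M x1 x2 x3 : euler V -> uniq [:: x1; x2; x3] ->
  (forall x, x \in [:: x1; x2; x3] -> x \in V /\ nbr V x = M) ->
  (forall x x', x \in [:: x1; x2; x3] -> x' \in [:: x1; x2; x3] -> x != x' -> secd (rest V x x')) ->
  secd V.
Proof.
move=> eu un hN hs w ev.
pose f x := wodd w [seq [set x; z] | z <- enum M].
have key x x' : x \in [:: x1; x2; x3] -> x' \in [:: x1; x2; x3] -> x != x' -> f x = f x' ->
    dec w (elist V).
  move=> hx hx' xx' ff; have [xV Nx] := hN x hx; have [x'V Nx'] := hN x' hx'.
  have adj z : z \in V -> x -- z = x' -- z.
    move=> zV; have e : (z \in nbr V x) = (z \in nbr V x') by rewrite Nx Nx'.
    by move: e; rewrite !in_nbr zV.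
  have tw : twins V x x' by split=> // z zV _ _; apply: adj.
  have nxx : x -- x' = false by rewrite adj // sedge_irrefl.
  have eR : nbr (rest V x x') x = M.
    rewrite -Nx; apply/setP=> z; rewrite !in_nbr mem_rest.
    case: (eqVneq z x) => [->|_]; first by rewrite sedge_irrefl !andbF.
    by case: (eqVneq z x') => [->|_] //; rewrite nxx !andbF.
  have ep : plist V x x' = map Some (enum M) by rewrite /plist nxx eR.
  apply: (dec_twins_even tw (hs x x' hx hx' xx') _ ev).
    by rewrite ep size_map -cardE -Nx; apply: eu.
  rewrite ep; suff -> : wodd w (theta x x' (map Some (enum M))) = f x (+) f x' by rewrite ff addbb.
  rewrite /f; elim: (enum M) => //= z s IH.
  rewrite -cat1s theta_cat wodd_cat IH /theta /= !wodd_cons /wodd /=.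
  by case: (w _); case: (w _); case: (odd _); case: (odd _).
move: un; rewrite /= !inE negb_or andbT => /andP[/andP[n12 n13] n23].
case: (boolP (f x1 == f x2)) => [/eqP|h12]; first by apply: key; rewrite ?inE ?eqxx ?orbT.
case: (boolP (f x1 == f x3)) => [/eqP|h13]; first by apply: key; rewrite ?inE ?eqxx ?orbT.
apply: (key x2 x3); rewrite ?inE ?eqxx ?orbT //.
by move: h12 h13; case: (f x1); case: (f x2); case: (f x3).
Qed.

Lemma rest_join V A B u v : join V A B -> u \in A -> v \in A -> join (rest V u v) (rest A u v) B.
Proof.
move=> j uA vA; have [eV h] := j; split=> [|a b]; last by rewrite mem_rest => /and3P[_ _]; apply: h.
apply/setP=> z; rewrite mem_rest inE mem_rest eV inE.
case: (boolP (z \in B)) => zB; rewrite ?orbT ?orbF // andbT.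
by apply/andP; split; apply: contraTneq zB => ->; apply: join_notin j _.
Qed.

Lemma nbr_rest_join V A B u v : join V A B -> u \in A -> v \in A ->
  join (nbr (rest V u v) u) (nbr (rest A u v) u) B.
Proof.
move=> j uA vA; have [eV h] := j; have [eR h'] := rest_join j uA vA; split=> [|a b].
  apply/setP=> z; rewrite in_nbr in_setU in_nbr eR in_setU.
  by case: (boolP (z \in B)) => zB; rewrite ?orbT ?orbF // h.
by rewrite in_nbr => /andP[aR _]; apply: h'.
Qed.

Lemma clique_connS S : {in S &, forall x y, x != y -> x -- y} -> connS S.
Proof.
move=> h A sA A0 AS; have [a aA] := set0Pn _ A0.
have /subsetPn[b bS bA] : ~~ (S \subset A) by apply: contra AS => sS; rewrite eqEsubset sA.
by exists a, b; split=> //; apply: h => //; [exact: (subsetP sA) | apply: contraNneq bA => <-].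
Qed.

Lemma connS_nbr S x : connS S -> 1 < #|S| -> x \in S -> 0 < #|nbr S x|.
Proof.
move=> c S1 xS; have [|||a [b [aA bS bA ab]]] := c [set x].
- by rewrite sub1set.
- by apply/set0Pn; exists x; rewrite inE.
- by apply: contraTneq S1 => <-; rewrite cards1.
rewrite card_gt0; apply/set0Pn; exists b; rewrite in_nbr bS.
by move: aA; rewrite inE => /eqP <-.
Qed.

Lemma nbr_lt S x : x \in S -> #|nbr S x| < #|S|.
Proof.
move=> xS; apply: proper_card; apply/properP; split.
  by apply/subsetP=> z; rewrite in_nbr => /andP[].
by exists x; rewrite // in_nbr sedge_irrefl andbF.
Qed.

Lemma full_nbr S x y : x \in S -> y \in S -> x != y -> #|nbr S x|.+1 = #|S| -> x -- y.
Proof.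
move=> xS yS xy e; suff : nbr S x = S :\ x.
  by move/setP/(_ y); rewrite in_nbr in_setD1 yS eq_sym xy.
apply/eqP; rewrite eqEcard; apply/andP; split.
  apply/subsetP=> z; rewrite in_nbr in_setD1 => /andP[-> xz].
  by rewrite andbT eq_sym sedge_neq.
by rewrite -ltnS e (cardsD1 x S) xS.
Qed.

(** The degrees are even, larger than 2 and smaller than 5, hence all equal to 4. *)
Lemma exceptional_clique V : #|V| = 5 -> euler V -> {in V, forall x, 2 < #|nbr V x|} -> exceptional x0 V.
Proof.
move=> V5 eu d; left; exists (enum V); first by rewrite -cardE.
have adj x y : x \in V -> y \in V -> x -- y = (x != y).
  move=> xV yV; apply/idP/idP; first exact: sedge_neq.
  move=> xy; apply: (full_nbr xV yV xy); rewrite V5.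
  have := d x xV; have := eu x xV; have := nbr_lt xV; rewrite V5.
  by case: #|nbr V x| => [|[|[|[|[|[|]]]]]].
have sz : size (enum V) = 5 by rewrite -cardE.
split; [exact: enum_uniq | by move=> z; rewrite mem_enum |].
have inV k : k < 5 -> nth x0 (enum V) k \in V by move=> k5; rewrite -mem_enum mem_nth // sz.
rewrite sz => i j i5 j5; rewrite adj ?inV // nth_uniq ?sz ?enum_uniq //.
by move: i j i5 j5 => [|[|[|[|[|i]]]]] [|[|[|[|[|j]]]]].
Qed.

(** The order follows [K5s_labels]: [b1] and [b2] are the ends of the subdivided edge, and [z] is
    its midpoint. *)
Lemma exceptional_labels6 V b1 b2 u v y z : uniq [:: b1; u; v; y; b2; z] ->
  V =i [:: b1; u; v; y; b2; z] -> b1 -- b2 = false ->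
  (forall t, t \in [:: u; v; y; z] -> b1 -- t /\ b2 -- t) ->
  u -- v -> u -- y -> v -- y -> z -- u = false -> z -- v = false -> z -- y = false ->
  exceptional x0 V.
Proof.
move=> un eV b12 hb uv uy vy zu zv zy; right; exists [:: b1; u; v; y; b2; z] => //.
split=> // i j i6 j6.
have [bu bu'] := hb u (mem_head _ _).
have [bv bv'] : b1 -- v /\ b2 -- v by apply: hb; rewrite !inE eqxx !orbT.
have [by_ by_'] : b1 -- y /\ b2 -- y by apply: hb; rewrite !inE eqxx !orbT.
have [bz bz'] : b1 -- z /\ b2 -- z by apply: hb; rewrite !inE eqxx !orbT.
by move: i j i6 j6 => [|[|[|[|[|[|i]]]]]] [|[|[|[|[|[|j]]]]]] //= _ _;
  rewrite ?sedge_irrefl ?b12 ?bu ?bu' ?bv ?bv' ?by_ ?by_' ?bz ?bz' ?uv ?uy ?vy ?zu ?zv ?zy //;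
  rewrite sedge_sym ?b12 ?bu ?bu' ?bv ?bv' ?by_ ?by_' ?bz ?bz' ?uv ?uy ?vy ?zu ?zv ?zy.
Qed.

Lemma matched_twins S x x' : {in S, forall z, #|nbr S z| = 1} -> x \in S -> x' \in S -> x -- x' ->
  forall z, z \in S -> z != x -> z != x' -> x -- z = x' -- z.
Proof.
move=> h xS x'S xx' z zS zx zx'.
have H a b : a \in S -> b \in S -> a -- b -> z != b -> a -- z = false.
  move=> aS bS ab zb; have /eqP/cards1P[c ec] := h a aS.
  have : b \in nbr S a by rewrite in_nbr bS.
  rewrite ec inE => /eqP eb; rewrite eb in zb.
  by rewrite -(negbTE zb) -(in_set1 z c) -ec in_nbr zS.
by rewrite (H x x') // (H x' x) // sedge_sym.
Qed.

Lemma matching_even S : {in S, forall x, #|nbr S x| = 1} -> ~~ odd #|S|.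
Proof.
elim: {S}#|S| {-2}S (leqnn #|S|) => [|n IH] S; first by rewrite leqn0 => /eqP->.
move=> Sn h; case: (set_0Vmem S) => [->|[x xS]]; first by rewrite cards0.
have /eqP/cards1P[x' ex] := h x xS; have : x' \in nbr S x by rewrite ex inE.
rewrite in_nbr => /andP[x'S xx']; have tw : twins S x x'.
  split=> //; first exact: sedge_neq.
  exact: matched_twins h xS x'S xx'.
rewrite (card_rest tw) /= negbK; apply: IH.
  by rewrite -ltnS; apply: leq_trans Sn; rewrite (card_rest tw).
move=> z zR; have := zR; rewrite mem_rest => /and3P[zx zx' zS].
have := nbr_rest tw zR; rewrite h // => ->; suff -> : x -- z = false by [].
by rewrite -(negbTE zx') -(in_set1 z x') -ex in_nbr zS.
Qed.

End Driver.

(** * Removals inside one side of a join *)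

Section Driver.
Variables (G : sgraph) (x0 : G).
Hypothesis cog : cograph G.
Implicit Types (V W N S A B C D M F : {set G}) (u v x y z : G).

(** Both pairs lie in [A] and are adjacent to all of [B], so they share at least two neighbours and
    [secd_pair] applies. *)
Lemma step_pair V A B u v u' v' : good_below x0 V -> euler V -> join V A B ->
  twins A u v -> twins A u' v' -> u -- v -> u' -- v' ->
  u' \in rest A u v -> v' \in rest A u v -> ~~ u -- u' -> 1 < #|B| ->
  two_conn (rest V u v) -> two_conn (rest V u' v') ->
  two_conn (rest (rest V u v) u' v') \/ secd (rest (rest V u v) u' v') ->
  #|nbr (rest V u v) u| = 3 -> #|nbr (rest V u' v') u'| = 3 -> secd V.
Proof.
move=> IH eu j tA tA' uv uv' u'R v'R uu' B1 tc tc' tc2 N3 N3'.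
have mA := join_module j; have tw := twins_module mA tA; have tw' := twins_module mA tA'.
have [uA vA _ _] := tA; have [u'A v'A _ _] := tA'.
have [eR _] := rest_join j uA vA.
have u'V : u' \in rest V u v by rewrite eR inE u'R.
have v'V : v' \in rest V u v by rewrite eR inE v'R.
have tw1 : twins (rest V u v) u' v'.
  have [_ _ uv1 h] := tw'; split=> // z; rewrite mem_rest => /and3P[_ _ zV]; exact: h.
have [n3 n3'] : 1 < #|nbr (rest V u v) u| /\ 1 < #|nbr (rest V u' v') u'| by rewrite N3 N3'.
have [s|//] := rest_good cog IH eu tw tc n3.
have [s'|//] := rest_good cog IH eu tw' tc' n3'.
have s2 : exceptional x0 (rest (rest V u v) u' v') \/ secd (rest (rest V u v) u' v').
  case: tc2 => [tc2|]; last by right.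
  apply: IH tc2 (euler_rest tw1 (euler_rest tw eu)).
  by rewrite (card_rest tw) (card_rest tw1); clear; lia.
apply: (secd_pair cog _ s s' s2 N3 N3') => //.
apply: leq_trans B1 (subset_leq_card _); apply/subsetP=> b bB.
have [eN _] := nbr_rest_join j uA vA; have [eN' _] := nbr_rest_join j u'A v'A.
by rewrite in_setI eN eN' !inE bB !orbT.
Qed.

Lemma two_rest_join V A B u v u' v' : join V A B -> u \in A -> v \in A ->
  u' \in rest A u v -> v' \in rest A u v ->
  join (rest (rest V u v) u' v') (rest (rest A u v) u' v') B.
Proof. by move=> j uA vA u'R v'R; apply: rest_join => //; apply: rest_join. Qed.

(** Twins of [A] with a common neighbour in [A] have a connected set of common neighbours, a join of
    two nonempty sets, so [step] applies. It fails only if [B] has size 2 and there is one common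
    neighbour in [A]; then [twins_triangle] gives a second pair for [step_pair] or the structure
    described at the end. *)
Lemma step_join V A B x : good_below x0 V -> euler V -> join V A B -> 1 < #|B| ->
  x \in A -> 1 < #|nbr A x| ->
  (forall u v, twins A u v -> 0 < #|nbr (rest A u v) u| -> two_conn (rest V u v)) ->
  (forall u v u' v' y, twins A u v -> twins A u' v' ->
     u' \in rest A u v -> v' \in rest A u v -> y \in rest (rest A u v) u' v' ->
     two_conn (rest (rest V u v) u' v')) ->
  secd V \/ #|B| = 2 /\ exists u v y, [/\ twins A u v, u -- v, nbr (rest A u v) u = [set y] &
     forall z, z \in rest A u v -> z != y -> nbr A z = set0].
Proof.
move=> IH eu j B1 xA dx tc1 tc2.
have mA := join_module j.
have st u v : twins A u v -> 0 < #|nbr (rest A u v) u| ->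
    secd V \/ [/\ u -- v, #|nbr (rest V u v) u| = 3, #|B| = 2 & #|nbr (rest A u v) u| = 1].
  move=> tA n0; have tw := twins_module mA tA; have [uA vA _ _] := tA.
  have jN := nbr_rest_join j uA vA; have cN := card_join jN.
  have kN := join_connS jN n0 (ltnW B1).
  have N1 : 1 < #|nbr (rest V u v) u| by rewrite cN; apply: leq_trans B1 (leq_addl _ _).
  case: (step cog IH eu tw (tc1 _ _ tA n0) kN N1) => [|[uv N3]]; first by left.
  by right; split=> //; move: N3; rewrite cN; clear -n0 B1; lia.
have [u [v [tA n0]]] := twins_nbr_exist cog xA dx.
case: (st u v tA n0) => [|[uv N3 B2 /eqP/cards1P[y Ny]]]; first by left.
have [uA vA nuv twz] := tA.
(* [B] has two vertices, so degrees keep their parity within [A]. *)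
have euA : euler A.
  move=> z zA; have := eu z; have [eV _] := j; rewrite eV inE zA -eV => /(_ isT).
  by rewrite (nbr_join j zA) B2 oddD addbF.
case: (twins_triangle cog euA tA uv Ny) => [[u' [v' [tA' u'R v'R n0']]]|iso]; last first.
  by right; split=> //; exists u, v, y.
left; case: (st u' v' tA' n0') => [//|[uv' N3' _ _]].
have yR : y \in rest A u v /\ u -- y.
  have yN : y \in nbr (rest A u v) u by rewrite Ny inE.
  by move: yN; rewrite in_nbr => /andP[].
have [u'A v'A nuv' twz'] := tA'.
have uu'v : u -- u' = u -- v'.
  move: u'R v'R; rewrite !mem_rest => /and3P[h1 _ _] /and3P[h2 _ _].
  by rewrite !(sedge_sym u) twz' // eq_sym.
(* Otherwise both [u'] and [v'] would equal the only common neighbour [y]. *)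
have uu' : ~~ u -- u'.
  apply/negP=> h; have h' : u -- v' by rewrite -uu'v.
  have : u' \in nbr (rest A u v) u by rewrite in_nbr u'R.
  have : v' \in nbr (rest A u v) u by rewrite in_nbr v'R.
  by rewrite Ny !inE => /eqP e1 /eqP e2; rewrite e1 e2 eqxx in nuv'.
have yu' : y != u' by apply: contraNneq uu' => <-; case: yR.
have yv' : y != v' by apply: contraNneq uu' => e; rewrite uu'v -e; case: yR.
apply: (step_pair IH eu j tA tA') => //.
- exact: tc1.
- exact: tc1.
left; apply: (tc2 _ _ _ _ y) => //; rewrite mem_rest yu' yv'.
by case: yR.
Qed.

(** Either [step_join] leaves a triangle and isolated vertices in [A], with two vertices in [B], or
    all degrees in [A] are at most 1. In the second case twins of [A] have exactly [B] as common
    neighbours, and [step] fails only if [B] has size 3, which makes [A] a perfect matching: one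
    matched pair gives [K5], and from two of them on [step_pair] applies. *)
Lemma case_connected V A B : good_below x0 V -> euler V -> join V A B -> 1 < #|A| -> 1 < #|B| ->
  connS B -> (forall u v, twins A u v -> two_conn (rest V u v)) -> good x0 V.
Proof.
move=> IH eu j A1 B1 cB tc; have mA := join_module j; have [eV adj] := j.
have inA z : z \in A -> z \in V by rewrite eV inE => ->.
have inB z : z \in B -> z \in V by rewrite eV inE orbC => ->.
have tcR u v u' v' y : twins A u v -> u' \in rest A u v -> v' \in rest A u v ->
    y \in rest (rest A u v) u' v' -> two_conn (rest (rest V u v) u' v').
  move=> [uA vA _ _] u'R v'R yR; apply: two_conn_join (two_rest_join j uA vA u'R v'R) _ B1 _; last by left.
  by apply/card_gt0P; exists y.
have degB b : b \in B -> #|A| < #|nbr V b|.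
  move=> bB; rewrite (nbr_join (joinC j) bB); have := connS_nbr cB B1 bB; clear; lia.
have cV := card_join j.
case: (boolP [exists x in A, 1 < #|nbr A x|]) => [/exists_inP[x xA dx]|].
  have tc' u v : twins A u v -> 0 < #|nbr (rest A u v) u| -> two_conn (rest V u v) by move=> /tc.
  have tcR' u v u' v' y : twins A u v -> twins A u' v' -> u' \in rest A u v -> v' \in rest A u v ->
    y \in rest (rest A u v) u' v' -> two_conn (rest (rest V u v) u' v') by move=> tA _; apply: tcR.
  case: (step_join IH eu j B1 xA dx tc' tcR') => [|[B2 [u [v [y [tA uv Ny iso]]]]]]; first by right.
  have [uA vA nuv twz] := tA; pose F := rest A u v :\ y.
  have yN : y \in nbr (rest A u v) u by rewrite Ny inE.
  have [yR uy] := andP (etrans (esym (in_nbr _ _ _)) yN).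
  have := yR; rewrite mem_rest => /and3P[yu yv yA]; have vy : v -- y by rewrite -twz.
  have cA : #|A| = #|F|.+3 by rewrite (card_rest tA) (cardsD1 y) yR.
  have oA : odd #|A|.
    have [b bB] : exists b, b \in B by apply/card_gt0P; apply: ltnW.
    have := eu b (inB _ bB); rewrite (nbr_join (joinC j) bB).
    have := connS_nbr cB B1 bB; have := nbr_lt bB; rewrite B2 => h1 h2.
    have -> : #|nbr B b| = 1 by clear -h1 h2; lia.
    by rewrite oddD /= negbK.
  (* Two isolated vertices of [A] are nonadjacent twins whose neighbourhood is the connected set
     [B], so [step] cannot fail for them. *)
  case: (ltnP 1 #|F|) => F1.
    right; have [z1 [z2 [z1F z2F z12]]] := card_gt1P F1.
    have hF z : z \in F -> z \in A /\ nbr A z = set0.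
      by rewrite in_setD1 => /andP[zy zR]; split; [move: zR; rewrite mem_rest => /and3P[] | exact: iso].
    have [z1A n1] := hF _ z1F; have [z2A n2] := hF _ z2F.
    have no z t : z \in F -> t \in A -> z -- t = false.
      move=> zF tA2; have [_ nz] := hF _ zF; move/setP/(_ t): nz.
      by rewrite in_nbr tA2 inE.
    have tz : twins A z1 z2 by split=> // t tA2 _ _; rewrite !no.
    have tw := twins_module mA tz.
    have [eN _] := nbr_rest_join j z1A z2A.
    have N0 : nbr (rest A z1 z2) z1 = set0.
      apply/setP=> t; rewrite in_nbr mem_rest inE; case: (boolP (t \in A)) => tA2; rewrite ?andbF //.
      by rewrite no ?andbF.
    rewrite N0 set0U in eN.
    have := step cog IH eu tw (tc _ _ tz); rewrite eN no // => /(_ cB B1).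
    by case=> // -[].
  (* [A] is odd and has three vertices outside [F], so [F] is even. *)
  have F0 : #|F| = 0 by move: oA; rewrite cA; clear -F1; case: #|F| F1 => [|[]].
  left; apply: exceptional_clique => //; first by rewrite cV cA F0 B2.
  have memA z : z \in A -> [|| z == u, z == v | z == y].
    move=> zA; apply: contraT; rewrite !negb_or => /and3P[zu zv zy].
    suff : z \in F by move/eqP: F0; rewrite cards_eq0 => /eqP->; rewrite inE.
    by rewrite in_setD1 zy mem_rest zu zv.
  move=> z; rewrite eV inE -eV => /orP[zA|/degB]; last by rewrite cA F0; apply: ltn_trans.
  rewrite (nbr_join j zA) B2 addn2 !ltnS card_gt0; apply/set0Pn.
  case/or3P: (memA z zA) => /eqP->; [exists v | exists u | exists u]; rewrite in_nbr.
  - by rewrite vA.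
  - by rewrite uA sedge_sym.
  - by rewrite uA sedge_sym.
rewrite negb_exists_in => /forall_inP small.
have d1 z : z \in A -> #|nbr A z| <= 1 by move=> zA; rewrite leqNgt small.
have [u [v tA]] := twins_exist cog A1; have [uA vA nuv twz] := tA.
have N0 u' v' : twins A u' v' -> nbr (rest A u' v') u' = set0.
  move=> [u'A v'A n' h']; apply/setP=> z; rewrite in_nbr mem_rest inE.
  apply/negP=> /andP[/and3P[zu zv zA] uz]; have := d1 z zA; rewrite leqNgt => /negP; apply.
  apply/card_gt1P; exists u', v'; split=> //; rewrite in_nbr; first by rewrite u'A sedge_sym.
  by rewrite v'A sedge_sym -h'.
have eN u' v' : twins A u' v' -> nbr (rest V u' v') u' = B.
  move=> t'; have [u'A v'A _ _] := t'; have [-> _] := nbr_rest_join j u'A v'A.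
  by rewrite N0 // set0U.
have := step cog IH eu (twins_module mA tA) (tc _ _ tA).
rewrite eN // => /(_ cB B1)[s|[uv B3]]; first by right.
have m1 : {in A, forall z, #|nbr A z| = 1}.
  move=> z zA; have := eu z (inA _ zA); rewrite (nbr_join j zA) B3 oddD /= addbT negbK.
  by have := d1 z zA; case: #|nbr A z| => [|[]].
case: (set_0Vmem (rest A u v)) => [R0|[x xR]].
  have A2 : #|A| = 2 by rewrite (card_rest tA) R0 cards0.
  left; apply: exceptional_clique => //; first by rewrite cV A2 B3.
  move=> z; rewrite eV inE -eV => /orP[zA|/degB]; last by rewrite A2.
  by rewrite (nbr_join j zA) m1 // B3.
right; have := xR; rewrite mem_rest => /and3P[xu xv xA].
have [x' x'N] : exists x', x' \in nbr A x by apply/card_gt0P; rewrite m1.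
move: x'N; rewrite in_nbr => /andP[x'A xx'].
have nox : u -- x = false.
  apply: contraNF xv => ux; have : x \in nbr A u by rewrite in_nbr xA.
  have : v \in nbr A u by rewrite in_nbr vA.
  by have /eqP/cards1P[c ->] := m1 u uA; rewrite !inE => /eqP-> /eqP->.
have x'u : x' != u by apply: contraTneq xx' => ->; rewrite sedge_sym nox.
have x'v : x' != v.
  by apply: contraTneq xx' => ->; rewrite sedge_sym -twz // nox.
have x'R : x' \in rest A u v by rewrite mem_rest x'u x'v.
have tx : twins A x x'.
  by split=> //; [exact: sedge_neq | exact: matched_twins m1 xA x'A xx'].
apply: (step_pair IH eu j tA tx) => //; rewrite ?eN ?nox //; try exact: tc.
have jR := two_rest_join j uA vA xR x'R; left.
(* If nothing is left of [A], the connected set [B] has three vertices and even degrees; it is a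
   triangle, hence 2-connected. *)
case: (posnP #|rest (rest A u v) x x'|) => [R0|R0]; last by apply: two_conn_join jR R0 B1 _; left.
have [-> _] := jR; move/eqP: R0; rewrite cards_eq0 => /eqP R0; rewrite R0 set0U.
have euB : euler B.
  have t1 : twins (rest V u v) x x'.
    have [_ _ n h] := twins_module mA tx.
    split=> // [||z]; last by rewrite mem_rest => /and3P[_ _]; apply: h.
      by have [-> _] := rest_join j uA vA; rewrite inE xR.
    by have [-> _] := rest_join j uA vA; rewrite inE x'R.
  have := euler_rest t1 (euler_rest (twins_module mA tA) eu).
  by have [-> _] := jR; rewrite R0 set0U.
have cl : {in B &, forall a b, a != b -> a -- b}.
  move=> a b aB bB ab; apply: (full_nbr aB bB ab); rewrite B3.
  have := euB a aB; have := connS_nbr cB B1 aB; have := nbr_lt aB; rewrite B3.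
  by case: #|nbr B a| => [|[|[|]]].
split; first by rewrite B3.
  exact: cB.
by move=> b bB; apply: clique_connS => a c; rewrite !in_setD1 => /andP[_ aB] /andP[_ cB2]; apply: cl.
Qed.

End Driver.

(** * Joins of two disconnected sides, and the conclusion of the induction *)

Section Main.
Variables (G : sgraph) (x0 : G).
Hypothesis cog : cograph G.
Implicit Types (V W N S A B C D M F P Q R : {set G}) (u v x y z : G).

Definition apart_split S := split_by (fun a b => ~~ a -- b) S.

Lemma apart_split_card S : apart_split S -> 1 < #|S|.
Proof.
case=> A [sA A0 AS h]; rewrite ltnNge; apply/negP=> S1.
have /connS_split := connS_small S1; apply; by exists A.
Qed.

(** A common neighbour of [u] and [v] remains, and so does a vertex on the other side of the
    disconnection. *)
Lemma apart_split_rest A u v : apart_split A -> twins A u v -> 0 < #|nbr (rest A u v) u| ->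
  1 < #|rest A u v|.
Proof.
case=> C [sC C0 CA h] [uA vA uv twz] /card_gt0P[n nN].
move: nN; rewrite in_nbr => /andP[nR un]; move: (nR); rewrite mem_rest => /and3P[nu nv nA].
have vn : v -- n by rewrite -twz.
have sep a b : a \in A -> b \in A -> a -- b -> (a \in C) = (b \in C).
  have H a' b' : b' \in A -> a' -- b' -> a' \in C -> b' \in C.
    by move=> b'A ab' a'C; apply: contraTT ab' => b'C; apply: h.
  by move=> aA bA ab; apply/idP/idP; [apply: H | apply: H => //; rewrite sedge_sym].
have [d dA dC] : exists2 d, d \in A & (d \in C) != (n \in C).
  case: (boolP (n \in C)) => nC; last by have [d dC] := set0Pn _ C0; exists d; rewrite ?(subsetP sC) ?dC.
  have /subsetPn[d dA dC] : ~~ (A \subset C) by apply: contra CA => sA; rewrite eqEsubset sC.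
  by exists d => //; rewrite (negbTE dC).
apply/card_gt1P; exists n, d; rewrite nR; split=> //.
  rewrite mem_rest dA andbT; apply/andP; split; apply: contraNneq dC => ->; by rewrite (sep _ n).
by apply: contraNneq dC => ->.
Qed.

Lemma three_isolated V A B z1 z2 z3 : good_below x0 V -> euler V -> join V A B -> 1 < #|B| ->
  uniq [:: z1; z2; z3] ->
  (forall z, z \in [:: z1; z2; z3] -> z \in A /\ nbr A z = set0) ->
  (forall z z', twins A z z' -> two_conn (rest V z z')) -> secd V.
Proof.
move=> IH eu j B1 un hz tc; have [eV adj] := j.
have eN z : z \in [:: z1; z2; z3] -> z \in V /\ nbr V z = B.
  move=> /hz[zA n0]; split; first by rewrite eV inE zA.
  apply/setP=> t; rewrite in_nbr eV inE; case: (boolP (t \in B)) => tB.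
    by rewrite orbT adj.
  by rewrite orbF; move/setP/(_ t): n0; rewrite in_nbr inE.
have tA z z' : z \in [:: z1; z2; z3] -> z' \in [:: z1; z2; z3] -> z != z' -> twins A z z'.
  move=> /hz[zA n0] /hz[z'A n0'] zz'; split=> // t tA' _ _.
  by move/setP/(_ t): n0; move/setP/(_ t): n0'; rewrite !in_nbr tA' !inE /= => -> ->.
have all z z' : z \in [:: z1; z2; z3] -> z' \in [:: z1; z2; z3] -> z != z' ->
    secd (rest V z z') \/ secd V.
  move=> h h' zz'; have t := tA z z' h h' zz'; have tw := twins_module (join_module j) t.
  apply: (rest_good cog IH eu tw (tc _ _ t)); have [zA _] := hz z h; have [z'A _] := hz z' h'.
  have [-> _] := nbr_rest_join j zA z'A; apply: leq_trans B1 (subset_leq_card _).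
  exact: subsetUr.
move: (un); rewrite /= !inE negb_or andbT => /andP[/andP[n12 n13] n23].
have m1 : z1 \in [:: z1; z2; z3] by rewrite !inE eqxx.
have m2 : z2 \in [:: z1; z2; z3] by rewrite !inE eqxx orbT.
have m3 : z3 \in [:: z1; z2; z3] by rewrite !inE eqxx !orbT.
have [n21 n31 n32] : [/\ z2 != z1, z3 != z1 & z3 != z2] by split; rewrite eq_sym.
case: (all z1 z2 m1 m2 n12) => // s12; case: (all z1 z3 m1 m3 n13) => // s13.
case: (all z2 z3 m2 m3 n23) => // s23; case: (all z2 z1 m2 m1 n21) => // s21.
case: (all z3 z1 m3 m1 n31) => // s31; case: (all z3 z2 m3 m2 n32) => // s32.
apply: (three_false_twins eu un eN) => z z'; rewrite !inE.
by case/or3P=> /eqP-> /or3P[]/eqP->; rewrite ?eqxx.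
Qed.

Lemma card3_seq (S : {set G}) : 2 < #|S| -> exists a b c, uniq [:: a; b; c] /\
  forall z, z \in [:: a; b; c] -> z \in S.
Proof.
move=> /card_gt2P[a [b [c [[aS bS cS] [ab bc ca]]]]]; exists a, b, c; split.
  by rewrite /= !inE negb_or ab bc (eq_sym a) ca.
by move=> z; rewrite !inE => /or3P[]/eqP->.
Qed.

(** If [B] does not have size 2, [step] cannot fail. Otherwise [B] is a nonadjacent pair, and
    [step_join] leaves a triangle and an odd number of isolated vertices in [A]. Three of these are
    settled by [three_isolated]; a single one is the midpoint of the subdivided edge of [K5], and
    the vertices of [B] are its ends. *)
Lemma case_apart_deg V A B x : good_below x0 V -> euler V -> join V A B ->
  apart_split A -> apart_split B -> x \in A -> 1 < #|nbr A x| -> good x0 V.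
Proof.
move=> IH eu j sA sB xA dx; have B1 := apart_split_card sB; have [eV adj] := j.
have inA z : z \in A -> z \in V by rewrite eV inE => ->.
have inB z : z \in B -> z \in V by rewrite eV inE orbC => ->.
have tc u v : twins A u v -> 1 < #|rest A u v| -> two_conn (rest V u v).
  move=> [uA vA _ _] R1; apply: (two_conn_join (rest_join j uA vA) (ltnW R1) B1).
  by right.
have tc1 u v : twins A u v -> 0 < #|nbr (rest A u v) u| -> two_conn (rest V u v).
  by move=> tA n0; apply: tc => //; apply: apart_split_rest.
(* A disconnected graph on two vertices has no edge, so the vertices of [B] have degree [#|A|]. *)
have B2even : #|B| = 2 -> ~~ odd #|A| /\ {in B &, forall b b', ~~ b -- b'}.
  move=> B2; have no b b' : b \in B -> b' \in B -> b -- b' = false.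
    case: sB => C [sC C0 CB h]; move=> bB b'B; apply/negP=> bb'.
    have /eqP eC : #|C| == 1.
      rewrite eqn_leq card_gt0 C0 andbT -ltnS -B2; apply: proper_card.
      by rewrite properEneq CB.
    have /cards1P[c ec] : #|C| == 1 by rewrite eC.
    have cB : c \in B by apply: (subsetP sC); rewrite ec inE.
    have /eqP : #|B :\ c| = 1 by move: B2; rewrite (cardsD1 c) cB => -[].
    case/cards1P=> d ed; have memB z : z \in B -> (z == c) || (z == d).
      by move=> zB; case: (eqVneq z c) => //= zc; rewrite -in_set1 -ed in_setD1 zc.
    have dB : d \in B /\ d != c by move/setP/(_ d): ed; rewrite in_setD1 inE eqxx => /andP[].
    have cd : ~~ c -- d by apply: h; [rewrite ec inE | case: dB | rewrite ec inE; case: dB].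
    move: bb'; case/orP: (memB b bB) => /eqP->; case/orP: (memB b' b'B) => /eqP->;
      by rewrite ?sedge_irrefl ?(negbTE cd) // sedge_sym (negbTE cd).
  split; last by move=> b b' bB b'B; rewrite no.
  have [b bB] : exists b, b \in B by apply/card_gt0P; apply: ltnW.
  have := eu b (inB b bB); rewrite (nbr_join (joinC j) bB).
  suff -> : nbr B b = set0 by rewrite cards0.
  by apply/setP=> z; rewrite in_nbr inE; case: (boolP (z \in B)) => //= zB; rewrite no.
have hB2 u v : twins A u v -> 0 < #|nbr (rest A u v) u| ->
    #|nbr (rest V u v) u| = 3 -> #|B| = 2.
  move=> [uA vA _ _] n0; rewrite (card_join (nbr_rest_join j uA vA)).
  by move: n0 B1; clear; lia.
have tc2 u v u' v' y : twins A u v -> twins A u' v' -> u' \in rest A u v -> v' \in rest A u v ->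
    y \in rest (rest A u v) u' v' -> #|B| = 2 -> two_conn (rest (rest V u v) u' v').
  move=> tA tA' u'R v'R yR B2; have [uA vA _ _] := tA.
  have t1 : twins (rest A u v) u' v'.
    by have [_ _ n h] := tA'; split=> // z; rewrite mem_rest => /and3P[_ _]; apply: h.
  have R1 : 1 < #|rest (rest A u v) u' v'|.
    have [oA _] := B2even B2; move: oA; rewrite (card_rest tA) (card_rest t1) /= !negbK.
    have : 0 < #|rest (rest A u v) u' v'| by apply/card_gt0P; exists y.
    by case: #|_| => [|[]].
  by apply: (two_conn_join (two_rest_join j uA vA u'R v'R) (ltnW R1) B1); right.
have [B2|B2] := eqVneq #|B| 2; last first.
  have [u [v [tA n0]]] := twins_nbr_exist cog xA dx.
  have [uA vA _ _] := tA; have jN := nbr_rest_join j uA vA; have cN := card_join jN.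
  have kN := join_connS jN n0 (ltnW B1).
  have N1 : 1 < #|nbr (rest V u v) u| by rewrite cN; apply: leq_trans B1 (leq_addl _ _).
  case: (step cog IH eu (twins_module (join_module j) tA) (tc1 _ _ tA n0) kN N1) => [|[uv N3]].
    by right.
  by rewrite (hB2 u v) ?eqxx in B2.
have tc2' u v u' v' y : twins A u v -> twins A u' v' -> u' \in rest A u v -> v' \in rest A u v ->
    y \in rest (rest A u v) u' v' -> two_conn (rest (rest V u v) u' v').
  by move=> tA tA' u'R v'R yR; apply: tc2 yR B2.
case: (step_join cog IH eu j B1 xA dx tc1 tc2') => [|[_ [u [v [y [tA uv Ny iso]]]]]]; first by right.
have [oA noB] := B2even B2; have [uA vA nuv twz] := tA; pose F := rest A u v :\ y.
have yN : y \in nbr (rest A u v) u by rewrite Ny inE.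
have [yR uy] := andP (etrans (esym (in_nbr _ _ _)) yN).
have := yR; rewrite mem_rest => /and3P[yu yv yA]; have vy : v -- y by rewrite -twz.
have cA : #|A| = #|F|.+3 by rewrite (card_rest tA) (cardsD1 y) yR.
have hF z : z \in F -> z \in A /\ nbr A z = set0.
  by rewrite in_setD1 => /andP[zy zR]; split; [move: zR; rewrite mem_rest => /and3P[] | exact: iso].
case: (ltnP 2 #|F|) => F2.
  right; have [z1 [z2 [z3 [un hz]]]] := card3_seq F2.
  apply: (three_isolated IH eu j B1 un) => [z /hz|z z' tz]; first exact: hF.
  apply: tc => //; move: cA; rewrite (card_rest tz); clear -F2; lia.
have /cards1P[z ez] : #|F| == 1.
  by move: oA F2; rewrite cA /=; case: #|F| => [|[|[|]]].
left; have zF : z \in F by rewrite ez inE.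
have [zA nz] := hF z zF; have := zF; rewrite in_setD1 mem_rest => /and4P[zy zu zv _].
have /card_gt1P[b1 [b2 [b1B b2B b12]]] := B1.
have memB t : t \in B -> (t == b1) || (t == b2).
  move=> tB; apply: contraT; rewrite negb_or => /andP[t1 t2].
  suff : 2 < #|B| by rewrite B2.
  by apply/card_gt2P; exists t, b1, b2; split=> //; split=> //; rewrite eq_sym.
have notB t : t \in A -> (t != b1) * (t != b2).
  move=> tA'; have := join_notin j tA' => h.
  by split; apply: contraNneq h => ->.
have nz' t : t \in A -> z -- t = false by move=> tA'; move/setP/(_ t): nz; rewrite in_nbr tA' inE.
apply: (@exceptional_labels6 _ _ V b1 b2 u v y z); rewrite ?nz' //.
- have [ub1 ub2] := notB u uA; have [vb1 vb2] := notB v vA.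
  have [yb1 yb2] := notB y yA; have [zb1 zb2] := notB z zA.
  by rewrite /= !inE !negb_or; uniq_done.
- move=> t; rewrite eV !inE; apply/idP/idP.
    case/orP=> [tA'|/memB/orP[]->]; rewrite ?orbT //.
    case: (eqVneq t u) => [->|tu]; first by rewrite !orbT.
    case: (eqVneq t v) => [->|tv]; first by rewrite !orbT.
    case: (eqVneq t y) => [->|ty]; first by rewrite !orbT.
    suff : t \in F by rewrite ez inE => ->; rewrite !orbT.
    by rewrite in_setD1 ty mem_rest tu tv.
  by case/or4P=> [/eqP->|/eqP->|/eqP->|/or3P[]/eqP->]; rewrite ?b1B ?b2B ?uA ?vA ?yA ?zA ?orbT.
- exact/negbTE/noB.
by move=> t ht; rewrite !(sedge_sym _ t) !adj //; move: ht; rewrite !inE => /or4P[]/eqP->.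
Qed.

(** The degrees in [A] make [B] odd. From five vertices on, [three_isolated] applies to [B]. If [B]
    has three vertices, two matched pairs of [A] are removed together; if [A] is a single matched
    pair, its removal leaves no edge. *)
Lemma matched_isolated V A B : good_below x0 V -> euler V -> join V A B -> 1 < #|A| -> 1 < #|B| ->
  {in A, forall z, #|nbr A z| = 1} -> {in B, forall z, nbr B z = set0} -> secd V.
Proof.
move=> IH eu j A1 B1 mA iB; have [eV adj] := j; have jC := joinC j.
have inA z : z \in A -> z \in V by rewrite eV inE => ->.
have eA := matching_even mA.
have oB : odd #|B|.
  have [a aA] : exists a, a \in A by apply/card_gt0P; apply: ltnW.
  by have := eu a (inA a aA); rewrite (nbr_join j aA) mA //= negbK.
have [B3|B3] := eqVneq #|B| 3; last first.
  have B5 : 4 < #|B| by move: B1 oB B3; case: #|B| => [|[|[|[|[|]]]]].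
  have B2 : 2 < #|B| by apply: leq_trans B5.
  have [z1 [z2 [z3 [un hz]]]] := card3_seq B2.
  apply: (three_isolated IH eu jC A1 un) => [z /hz zB|z z' tz]; first by split=> //; apply: iB.
  have [zB z'B _ _] := tz; have R1 : 1 < #|rest B z z'| by move: B5; rewrite (card_rest tz); clear; lia.
  by apply: (two_conn_join (rest_join jC zB z'B) (ltnW R1) A1); right.
have edgelessB : {in B &, forall x y, ~~ x -- y}.
  by move=> b b' bB b'B; have := iB b bB => /setP/(_ b'); rewrite in_nbr b'B inE => /= ->.
have [u uA] : exists u, u \in A by apply/card_gt0P; apply: ltnW.
have partner x : x \in A -> exists x', [/\ x' \in A, x -- x' & twins A x x'].
  move=> xA; have [x' x'N] : exists x', x' \in nbr A x by apply/card_gt0P; rewrite mA.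
  move: x'N; rewrite in_nbr => /andP[x'A xx']; exists x'; split=> //.
  by split=> //; [exact: sedge_neq | exact: matched_twins mA xA x'A xx'].
have [v [vA uv tA]] := partner u uA; have tw := twins_module (join_module j) tA.
case: (set_0Vmem (rest A u v)) => [R0|[x xR]].
  apply: (secd_theta tw eu); have [-> _] := rest_join j uA vA.
  by rewrite R0 set0U.
have := xR; rewrite mem_rest => /and3P[xu xv xA].
have [x' [x'A xx' tx]] := partner x xA.
have [_ _ nuv twz] := tA.
have nox : u -- x = false.
  apply: contraNF xv => ux; have : x \in nbr A u by rewrite in_nbr xA.
  have : v \in nbr A u by rewrite in_nbr vA.
  by have /eqP/cards1P[c ->] := mA u uA; rewrite !inE => /eqP-> /eqP->.
have x'u : x' != u by apply: contraTneq xx' => ->; rewrite sedge_sym nox.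
have x'v : x' != v.
  by apply: contraTneq xx' => ->; rewrite sedge_sym -twz // nox.
have x'R : x' \in rest A u v by rewrite mem_rest x'u x'v.
have A4 : 3 < #|A|.
  by have := card_rest tA; rewrite (cardsD1 x (rest A u v)) xR
    (cardsD1 x' (rest A u v :\ x)) in_setD1 x'R (eq_sym x') (sedge_neq xx') => ->.
have tc a a' : twins A a a' -> two_conn (rest V a a').
  move=> ta; have [aA a'A _ _] := ta.
  have R1 : 1 < #|rest A a a'| by move: A4; rewrite (card_rest ta).
  by apply: (two_conn_join (rest_join j aA a'A) (ltnW R1) B1); right.
have N0 a a' : twins A a a' -> a -- a' -> nbr (rest A a a') a = set0.
  move=> [aA a'A n' h'] aa'; apply/setP=> z; rewrite in_nbr mem_rest inE.
  apply/negP=> /andP[/and3P[zu zv zA] uz]; have /eqP/cards1P[c ec] := mA a aA.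
  have : z \in nbr A a by rewrite in_nbr zA.
  have : a' \in nbr A a by rewrite in_nbr a'A.
  by rewrite ec !inE => /eqP e1 /eqP e2; rewrite e1 e2 eqxx in zv.
have eN a a' : twins A a a' -> a -- a' -> nbr (rest V a a') a = B.
  move=> t' aa'; have [aA a'A _ _] := t'; have [-> _] := nbr_rest_join j aA a'A.
  by rewrite N0 // set0U.
apply: (step_pair cog IH eu j tA tx) => //; rewrite ?eN ?nox //; try exact: tc.
have jR := two_rest_join j uA vA xR x'R.
case: (set_0Vmem (rest (rest A u v) x x')) => [R0|[t tR]].
  by right; apply: edgeless_secd; have [-> _] := jR; rewrite R0 set0U.
left; have R1 : 1 < #|rest (rest A u v) x x'|.
  have t1 : twins (rest A u v) x x'.
    by have [_ _ n h] := tx; split=> // z; rewrite mem_rest => /and3P[_ _]; apply: h.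
  move: eA; rewrite (card_rest tA) (card_rest t1) /= !negbK.
  have : 0 < #|rest (rest A u v) x x'| by apply/card_gt0P; exists t.
  by case: #|_| => [|[]].
by apply: (two_conn_join jR (ltnW R1) B1); right.
Qed.

(** The degrees within one side have the parity of the size of the other, so each side is edgeless
    or perfectly matched. A matched side is even, which makes the other side edgeless. *)
Lemma case_small_degrees V A B : good_below x0 V -> euler V -> join V A B -> 1 < #|A| -> 1 < #|B| ->
  {in A, forall z, #|nbr A z| <= 1} -> {in B, forall z, #|nbr B z| <= 1} -> secd V.
Proof.
move=> IH eu j A1 B1 dA dB; have [eV adj] := j; have jC := joinC j.
have inA z : z \in A -> z \in V by rewrite eV inE => ->.
have inB z : z \in B -> z \in V by rewrite eV inE orbC => ->.
have hA z : z \in A -> #|nbr A z| = odd #|B|.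
  move=> zA; have := eu z (inA z zA); rewrite (nbr_join j zA) oddD.
  by have := dA z zA; case: #|nbr A z| => [|[]] //=; case: (odd #|B|).
have hB z : z \in B -> #|nbr B z| = odd #|A|.
  move=> zB; have := eu z (inB z zB); rewrite (nbr_join jC zB) oddD.
  by have := dB z zB; case: #|nbr B z| => [|[]] //=; case: (odd #|A|).
have iso S z : #|nbr S z| = 0 -> nbr S z = set0 by move/eqP; rewrite cards_eq0 => /eqP.
case oB: (odd #|B|) hA => hA.
  have oA := matching_even hA; apply: (matched_isolated IH eu j) => // z zB.
  by apply: iso; rewrite hB // (negbTE oA).
case oA: (odd #|A|) hB => hB.
  by apply: (matched_isolated IH eu jC) => // z zA; apply: iso; rewrite hA.
have big C D : join V C D -> 1 < #|C| -> 1 < #|D| -> ~~ odd #|C| -> 2 < #|C| ->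
    {in C, forall z, #|nbr C z| = 0} -> secd V.
  move=> j' C1 D1 oC C2 iC; have [z1 [z2 [z3 [un hz]]]] := card3_seq C2.
  apply: (three_isolated IH eu j' D1 un) => [z /hz zC|z z' tz].
    by split=> //; apply: iso; apply: iC.
  have [zC z'C _ _] := tz; have R1 : 1 < #|rest C z z'|.
    by move: C2 oC; rewrite (card_rest tz) /= negbK; case: #|_| => [|[]].
  by apply: (two_conn_join (rest_join j' zC z'C) (ltnW R1) D1); right.
(* Both sides are edgeless and even. If [A] has only two vertices, all edges lie on paths between
   them. *)
case: (ltnP 2 #|A|) => A2; first by apply: (big A B) => //; rewrite oA.
have [u [v tA]] := twins_exist cog A1; have [uA vA _ _] := tA.
apply: (secd_theta (twins_module (join_module j) tA) eu).
have R0 : rest A u v = set0.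
  by apply/eqP; rewrite -cards_eq0; move: A2; rewrite (card_rest tA); case: #|_|.
have [-> _] := rest_join j uA vA; rewrite R0 set0U => x y xB yB.
by move/iso/setP/(_ y): (hB x xB); rewrite in_nbr yB inE => /= ->.
Qed.

Lemma case_disconnected V A B : good_below x0 V -> euler V -> join V A B ->
  apart_split A -> apart_split B -> good x0 V.
Proof.
move=> IH eu j sA sB.
case: (boolP [exists x in A, 1 < #|nbr A x|]) => [/exists_inP[x xA dx]|].
  exact: (case_apart_deg IH eu j sA sB xA dx).
rewrite negb_exists_in => /forall_inP dA.
case: (boolP [exists x in B, 1 < #|nbr B x|]) => [/exists_inP[x xB dx]|].
  exact: (case_apart_deg IH eu (joinC j) sB sA xB dx).
rewrite negb_exists_in => /forall_inP dB; right.
apply: (case_small_degrees IH eu j (apart_split_card sA) (apart_split_card sB)) => z.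
  by move/dA; rewrite -leqNgt.
by move/dB; rewrite -leqNgt.
Qed.

(** The join of two parts is connected, so [case_connected] settles a part with at least three
    vertices. Among the other sizes, 1, 1, 2 is excluded by parity, 1, 2, 2 gives [K5], and 1, 1, 1
    is a triangle; for 2, 2, 2 [case_connected] applies again, since two parts form a 2-connected
    join. *)
Lemma three_parts V P Q R : good_below x0 V -> euler V -> join V P (Q :|: R) -> join (Q :|: R) Q R ->
  0 < #|P| -> 0 < #|Q| -> 0 < #|R| -> good x0 V.
Proof.
have rot X Y Z : join V X (Y :|: Z) -> join (Y :|: Z) Y Z ->
    join V Y (Z :|: X) /\ join (Z :|: X) Z X.
  move=> [eV h] [_ h']; split; [split=> [|a b aY] | split=> // a b aZ bX].
  - by rewrite eV setUC -setUA.
  - by rewrite inE => /orP[bZ|bX]; [exact: h' | rewrite sedge_sym h // inE aY].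
  - by rewrite sedge_sym h // inE aZ orbT.
have big X Y Z : good_below x0 V -> euler V -> join V X (Y :|: Z) -> join (Y :|: Z) Y Z ->
    0 < #|X| -> 0 < #|Y| -> 0 < #|Z| -> 2 < #|X| \/ (#|X| = 2 /\ two_conn (Y :|: Z)) -> good x0 V.
  move=> IH eu j j' X0 Y0 Z0 hX.
  have YZ : 1 < #|Y :|: Z| by rewrite (card_join j') (leq_add Y0 Z0).
  have cYZ := join_connS j' Y0 Z0.
  apply: (case_connected cog IH eu j _ YZ cYZ) => [|u v tX]; first by case: hX => [/ltnW|[->]].
  have [uX vX _ _] := tX; have jR := rest_join j uX vX.
  case: hX => [X2|[X2 tc]].
    by apply: (two_conn_join jR _ YZ); [move: X2; rewrite (card_rest tX); case: #|_| | left].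
  have R0 : rest X u v = set0.
    by apply/eqP; rewrite -cards_eq0; move: X2; rewrite (card_rest tX) => -[->].
  by case: jR => -> _; rewrite R0 set0U.
move=> IH eu j1 j1' P0 Q0 R0; have [j2 j2'] := rot _ _ _ j1 j1'; have [j3 j3'] := rot _ _ _ j2 j2'.
case: (ltnP 2 #|P|) => P2; first by apply: (big P Q R) => //; left.
case: (ltnP 2 #|Q|) => Q2; first by apply: (big Q R P) => //; left.
case: (ltnP 2 #|R|) => R2; first by apply: (big R P Q) => //; left.
have cV : #|V| = #|P| + (#|Q| + #|R|) by rewrite (card_join j1) (card_join j1').
have dP x : x \in P -> #|nbr V x| = #|nbr P x| + (#|Q| + #|R|).
  by move=> xP; rewrite (nbr_join j1 xP) (card_join j1').
have dQ x : x \in Q -> #|nbr V x| = #|nbr Q x| + (#|R| + #|P|).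
  by move=> xQ; rewrite (nbr_join j2 xQ) (card_join j2').
have dR x : x \in R -> #|nbr V x| = #|nbr R x| + (#|P| + #|Q|).
  by move=> xR; rewrite (nbr_join j3 xR) (card_join j3').
have memV x : x \in V -> [|| x \in P, x \in Q | x \in R] by case: j1 => -> _; rewrite !inE.
have inV x : [|| x \in P, x \in Q | x \in R] -> x \in V by case: j1 => -> _; rewrite !inE.
have single S x : #|S| = 1 -> x \in S -> #|nbr S x| = 0.
  by move=> S1 xS; have := nbr_lt xS; rewrite S1; case: #|nbr S x|.
have [p pP] := card_gt0P P0; have [q qQ] := card_gt0P Q0; have [r rR] := card_gt0P R0.
have ep := eu p (inV p _); have eq := eu q (inV q _); have er := eu r (inV r _).
rewrite pP in ep; rewrite qQ orbT in eq; rewrite rR !orbT in er.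
move: (ep isT) (eq isT) (er isT); rewrite dP // dQ // dR // => {}ep {}eq {}er.
have five : #|V| = 5 -> #|P| + #|Q| + #|R| = 5 -> 2 < #|P| + #|Q| -> 2 < #|Q| + #|R| -> 2 < #|R| + #|P| -> good x0 V.
  move=> V5 _ h1 h2 h3; left; apply: exceptional_clique => // x /memV/or3P[] h.
  - by rewrite dP //; apply: leq_trans h2 (leq_addl _ _).
  - by rewrite dQ //; apply: leq_trans h3 (leq_addl _ _).
  - by rewrite dR //; apply: leq_trans h1 (leq_addl _ _).
have [P1|P1] : #|P| = 1 \/ #|P| = 2 by move: P0 P2; case: #|P| => [|[|[|]]]; auto.
all: have [Q1|Q1] : #|Q| = 1 \/ #|Q| = 2 by move: Q0 Q2; case: #|Q| => [|[|[|]]]; auto.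
all: have [R1|R1] : #|R| = 1 \/ #|R| = 2 by move: R0 R2; case: #|R| => [|[|[|]]]; auto.
all: rewrite ?(single _ _ P1 pP) ?(single _ _ Q1 qQ) ?(single _ _ R1 rR) P1 Q1 R1 // in ep eq er cV five.
all: try by apply: five.
  right; have /eqP/cards1P[p' eP] := P1; have /eqP/cards1P[q' eQ] := Q1; have /eqP/cards1P[r' eR] := R1.
  have j12 : p -- q by case: j1 => _; apply; rewrite // inE qQ.
  have tw : twins V p q.
    split; rewrite ?inV ?pP ?qQ ?orbT //; first exact: sedge_neq.
    move=> z /memV/or3P[]; first by move: pP; rewrite eP !inE => /eqP-> ->.
      by move: qQ; rewrite eQ !inE => /eqP-> /eqP->; rewrite eqxx.
    move=> zR _ _; case: j1 => _ h1; case: j1' => _ h2.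
    by rewrite h1 ?h2 // inE zR orbT.
  apply: (secd_theta tw eu) => x y; rewrite !mem_rest.
  have inR z : [&& z != p, z != q & z \in V] -> z = r'.
    case/and3P=> zp zq /memV/or3P[]; rewrite ?eP ?eQ ?eR !inE => /eqP ez //.
      by move: pP zp; rewrite eP inE => /eqP->; rewrite ez eqxx.
    by move: qQ zq; rewrite eQ inE => /eqP->; rewrite ez eqxx.
  by move=> /inR-> /inR->; rewrite sedge_irrefl.
apply: (big P Q R) => //; right; split=> //; apply: (two_conn_join j1') => //; rewrite ?Q1 ?R1 //.
by right.
Qed.

(** A connected side of the join with at least two vertices is itself a join, so [three_parts]
    applies. The side opposite to a single vertex is connected by 2-connectedness. What remains is a
    join of two disconnected sides. *)
Theorem two_conn_good V : two_conn V -> euler V -> good x0 V.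
Proof.
elim: {V}#|V| {-2}V (leqnn #|V|) => [|n IHn] V; first by rewrite leqn0 => /eqP V0 []; rewrite V0.
move=> Vn [V2 cV cV1] eu.
have IH : good_below x0 V.
  by move=> W WV; apply: IHn; rewrite -ltnS; apply: leq_trans WV Vn.
have [A [B [j A0 B0]]] := connS_join cog cV (ltnW V2).
have one X Y : join V X Y -> 0 < #|X| -> 1 < #|Y| -> connS Y -> good x0 V.
  move=> j' X0 Y1 cY; have [Q [R [jY Q0 R0]]] := connS_join cog cY Y1.
  have [eY _] := jY; subst Y; exact: (three_parts IH eu j' jY X0 Q0 R0).
have single X Y : join V X Y -> #|X| = 1 -> 0 < #|Y| -> good x0 V.
  move=> j' X1 Y0; have /eqP/cards1P[x eX] := X1.
  have Y1 : 1 < #|Y| by move: V2; rewrite (card_join j') X1.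
  apply: (one _ _ j' _ Y1); first by rewrite X1.
  suff <- : V :\ x = Y by apply: cV1; case: j' => -> _; rewrite eX !inE eqxx.
  have xX : x \in X by rewrite eX inE.
  by have [-> _] := join_D1 j' xX; rewrite eX setDv set0U.
have [A1|A1] := eqVneq #|A| 1; first exact: (single _ _ j A1 B0).
have [B1|B1] := eqVneq #|B| 1; first exact: (single _ _ (joinC j) B1 A0).
have {}A1 : 1 < #|A| by rewrite ltn_neqAle eq_sym A1.
have {}B1 : 1 < #|B| by rewrite ltn_neqAle eq_sym B1.
case: (connS_or B) => sB; first exact: (one _ _ j A0 B1 sB).
case: (connS_or A) => sA; first exact: (one _ _ (joinC j) B0 A1 sA).
exact: (case_disconnected IH eu j sA sB).
Qed.

End Main.

(** * Subdivisions *)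

Section Walks.
Variable T : finType.
Implicit Types (x y : T) (c s : seq T) (E F : {set T}).

Lemma walk_edgesP x s F : reflect
  (exists a b, F = [set a; b] /\ infix [:: a; b] (x :: s)) (F \in walk_edges x s).
Proof.
elim: s x => [|y s IH] x.
  by apply: (iffP idP) => // -[a [b [_ /size_infix]]].
rewrite [walk_edges _ _]/= inE; apply: (iffP orP) => [[/eqP->|/IH[a [b [-> h]]]]|[a [b [eF]]]].
- by exists x, y; split=> //; rewrite infix_consl /= !eqxx ?prefix0s.
- by exists a, b; split=> //; rewrite infix_consl h orbT.
rewrite infix_consl => /orP[/=/and3P[/eqP ea /eqP eb _]|h]; first by left; rewrite eF ea eb.
by right; apply/IH; exists a, b.
Qed.

Lemma uniq_walk_edges x s : uniq (x :: s) -> uniq (walk_edges x s).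
Proof.
elim: s x => //= y s IH x /andP[xs us]; rewrite IH // andbT.
apply: contra xs => /mem_walk_edges[a [b [e ha hb]]].
case: (set2_eq e) => -[-> _]; first by [].
by rewrite inE hb orbT.
Qed.

(** Links the edge lists used here with [cycle_edges], which is defined through [next]. *)
Lemma map_next c : uniq c -> [seq [set x; next c x] | x <- c] = cedges c.
Proof.
case: c => // x s us; rewrite /cedges.
have H y p d : size (walk_edges y p) = size p /\ forall i, i < size p ->
    nth d (walk_edges y p) i = [set nth x (y :: p) i; nth x p i].
  elim: p y => //= z p IH y; have [sz nt] := IH z; split; first by rewrite sz.
  by case=> [|i] //= ip; rewrite nt.
apply: (@eq_from_nth _ set0).
  by rewrite size_map (proj1 (H _ _ set0)) size_rcons.
rewrite size_map => i ix; rewrite (nth_map x) // (proj2 (H _ _ set0)) ?size_rcons //.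
rewrite next_nth mem_nth // index_uniq //.
congr [set _; _]; last first.
  rewrite nth_rcons; case: (ltngtP i (size s)) => [//|h|->]; last by rewrite nth_default.
  by move: ix; rewrite /= ltnS leqNgt h.
by rewrite -rcons_cons nth_rcons ix.
Qed.

Lemma uniq_cedges c : cyc c -> uniq (cedges c).
Proof.
case: c => // x [|y s] // /andP[us ss].
have {}us : uniq (x :: y :: s) := us; have {}ss : 2 < size [:: x, y & s] := ss.
have -> : cedges [:: x, y & s] = [set x; y] :: walk_edges y (rcons s x) by [].
have /= /andP[xs /andP[ys us']] := us.
rewrite /= uniq_walk_edges ?andbT; last by rewrite -rcons_cons rcons_uniq xs /= ys us'.
apply/negP; case: s ss us xs ys us' => // z s _ us xs ys us' h.
have : [set x; y] \in [set y; z] :: walk_edges z (rcons s x) by [].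
rewrite inE => /orP[/eqP/set2_eq[][e1 e2]|].
- by move: xs; rewrite e1 !inE eqxx.
- by move: xs; rewrite e1 !inE eqxx orbT.
case/mem_walk_edges=> a [b [e ha hb]]; move: xs ys; rewrite !inE !negb_or => /and3P[xy xz xs] /andP[yz ys].
have yN : y \notin z :: rcons s x by rewrite inE mem_rcons inE !negb_or yz eq_sym xy ys.
case: (set2_eq e) => -[_ e2].
  by move: yN; rewrite e2 inE hb orbT.
move: yN; rewrite e2 inE; move: ha; rewrite inE mem_rcons inE => /orP[->//|->].
by rewrite !orbT.
Qed.

Lemma cycle_edgesE c : uniq c -> [set [set x; next c x] | x in c] = [set F in cedges c].
Proof.
move=> uc; apply/setP=> F; rewrite inE -map_next //.
by apply/imsetP/mapP => -[x xc ->]; exists x.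
Qed.

Lemma uniq_flatten_inj (A B : eqType) (F : A -> seq B) (s : seq A) a a' b :
  uniq (flatten (map F s)) -> a \in s -> a' \in s -> b \in F a -> b \in F a' -> a = a'.
Proof.
elim: s => //= c s IH; rewrite cat_uniq => /and3P[_ /hasPn dis us].
have no d : d \in s -> b \in F d -> b \notin F c.
  by move=> ds bd; apply: dis; apply/flatten_mapP; exists d.
rewrite !inE => /orP[/eqP->|aS] /orP[/eqP->|a'S] //.
- by move=> bc ba'; have := no _ a'S ba'; rewrite bc.
- by move=> ba bc; have := no _ aS ba; rewrite bc.
exact: IH.
Qed.
Lemma map_inj_mem (A B : eqType) (g : A -> B) (l : seq A) a a' : uniq (map g l) -> a \in l -> a' \in l ->
  g a = g a' -> a = a'.
Proof.
elim: l => //= b l IH /andP[gb ul]; rewrite !inE => /orP[/eqP->|al] /orP[/eqP->|a'l] // e.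
- by rewrite e map_f in gb.
- by rewrite -e map_f in gb.
exact: IH.
Qed.

End Walks.

(** * Partitions of the edge set and lists of cycles *)

Section Decomposition.
Variable H : sgraph.

Lemma path_walk (x : H) s : path sedge x s = all [in edges H] (walk_edges x s).
Proof. by elim: s x => //= y s IH x; rewrite IH mem_edges. Qed.

Lemma cycle_cedges (c : seq H) : cycle sedge c = all [in edges H] (cedges c).
Proof. by case: c => //= x s; exact: path_walk. Qed.

Lemma dec_even_cycle_decomposable (cs : seq (seq H)) :
  all (fun c => cyc c && ~~ odd (size c)) cs ->
  perm_eq (flatten (map cedges cs)) (elist [set: H]) -> even_cycle_decomposable H.
Proof.
move=> /allP ok e; have u : uniq (flatten (map cedges cs)) by rewrite (perm_uniq e) elist_uniq.
have memE F : (F \in edges H) = (F \in flatten (map cedges cs)).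
  by rewrite (perm_mem e) mem_enum inE subsetT andbT.
exists [set C in [seq [set F in cedges c] | c <- cs]]; split; last first.
  move=> C; rewrite inE => /mapP[c cc ->]; have /andP[/andP[uc sc] ec] := ok c cc.
  exists c; split=> //; last first.
    by rewrite /cycle_edges cycle_edgesE.
  by rewrite /ucycle uc andbT cycle_cedges; apply/allP=> F Fc; rewrite /= memE; apply/flatten_mapP; exists c.
apply/and3P; split.
- apply/eqP/setP=> F; rewrite memE; apply/bigcupP/flatten_mapP.
    by case=> C; rewrite inE => /mapP[c cs_c ->]; rewrite inE; exists c.
  by case=> c cs_c Fc; exists [set F in cedges c]; rewrite inE // (map_f (fun c => [set F in cedges c])).
- apply/trivIsetP=> C C'; rewrite !inE => /mapP[c cc ->] /mapP[c' cc' ->]; apply: contraR => /pred0Pn[F].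
  rewrite /= !inE => /andP[Fc Fc'].
  by rewrite (uniq_flatten_inj u cc cc' Fc Fc').
rewrite inE; apply/mapP=> -[c /ok/andP[/andP[uc sc] _] /setP e0].
have [F Fc] : exists F, F \in cedges c.
  case: c {uc e0} sc => [|x [|y s]] // _; exists [set x; y]; exact: mem_head.
by have := e0 F; rewrite !inE Fc.
Qed.

Lemma even_cycle_decomposable_dec : even_cycle_decomposable H ->
  exists2 cs, all (fun c => cyc c && ~~ odd (size c)) cs &
    perm_eq (flatten (map cedges cs)) (elist [set: H]).
Proof.
case=> P [/and3P[/eqP cov /trivIsetP triv _] ok].
have [cs e okc] : exists2 cs : seq (seq H), [seq [set F in cedges c] | c <- cs] = enum P &
    all (fun c => cyc c && ~~ odd (size c)) cs.
  have : {subset enum P <= P} by move=> C; rewrite mem_enum.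
  elim: (enum P) => [|C l IH] sub; first by exists [::].
  have [|cs <- okc] := IH; first by move=> D Dl; apply: sub; rewrite inE Dl orbT.
  have [c [sc /andP[_ uc] ec ->]] := ok C (sub C (mem_head _ _)).
  by exists (c :: cs); rewrite /= /cyc ?uc ?sc ?ec // /cycle_edges cycle_edgesE.
have ucs : uniq [seq [set F in cedges c] | c <- cs] by rewrite e enum_uniq.
have inP c : c \in cs -> [set F in cedges c] \in P.
  by move=> cc; rewrite -mem_enum -e; apply/mapP; exists c.
exists cs => //; apply: uniq_perm; first 1 last.
- exact: elist_uniq.
- move=> F; rewrite mem_enum inE subsetT andbT -cov; apply/flatten_mapP/bigcupP.
    by case=> c cc Fc; exists [set F in cedges c]; rewrite ?inP // inE.
  case=> C; rewrite -mem_enum -e => /mapP[c cc ->]; rewrite inE => Fc.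
  by exists c.
apply: uniq_flatten_map; first exact: map_uniq ucs.
  by move=> c /(allP okc)/andP[/uniq_cedges].
move=> c c' cc cc' F Fc Fc'; apply: (map_inj_mem ucs cc cc').
apply/eqP; apply: contraTT isT => ne.
have := triv _ _ (inP c cc) (inP c' cc') ne; move/pred0P/(_ F).
by rewrite /= !inE Fc Fc'.
Qed.

End Decomposition.

(** * From decompositions of a marked graph to its subdivisions *)

Section Lift.
Variables (G H : sgraph) (f : G -> H) (p : G -> G -> seq H).
Hypothesis f_inj : injective f.
Hypothesis p_rev : forall x y, x -- y -> p y x = rev (p x y).
Hypothesis p_uniq : forall x y, x -- y -> uniq (p x y) /\ forall z, f z \notin p x y.
Hypothesis p_disj : forall x y x' y' v, x -- y -> x' -- y' ->
  v \in p x y -> v \in p x' y' -> [set x; y] = [set x'; y'].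
Hypothesis H_edges : forall u v, u -- v <->
  exists x y, x -- y /\ infix [:: u; v] (f x :: rcons (p x y) (f y)).
Implicit Types (x y z : G) (E : {set G}).

Definition seg x y := walk_edges (f x) (rcons (p x y) (f y)).

Lemma seg_sym x y : x -- y -> perm_eq (seg y x) (seg x y).
Proof. by move=> xy; rewrite /seg p_rev //; apply: walk_edges_rev. Qed.

(** An edge is an unordered pair, so an orientation is picked arbitrarily; by [edge_segE] it matters
    only up to a permutation. *)
Definition edge_seg E : seq {set H} :=
  if [pick e : G * G | (E == [set e.1; e.2]) && e.1 -- e.2] is Some e then seg e.1 e.2 else [::].

Lemma edge_segE x y : x -- y -> perm_eq (edge_seg [set x; y]) (seg x y).
Proof.
move=> xy; rewrite /edge_seg; case: pickP => [[a b] /= /andP[/eqP e ab]|/(_ (x, y))]; last by rewrite /= eqxx xy.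
by case: (set2_eq e) => -[-> ->] //; apply: seg_sym; rewrite sedge_sym.
Qed.

Lemma uniq_seg x y : x -- y -> uniq (seg x y).
Proof.
move=> xy; apply: uniq_walk_edges; have [u n] := p_uniq xy.
rewrite /= rcons_uniq u n mem_rcons inE negb_or n !andbT.
by apply: contra (sedge_neq xy) => /eqP/f_inj->.
Qed.

Lemma mem_seg x y F : x -- y -> F \in seg x y ->
  (p x y = [::] /\ F = [set f x; f y]) \/ exists2 v, v \in p x y & v \in F.
Proof.
rewrite /seg => xy; case: (p x y) => [|v s] /=; first by rewrite inE => /eqP->; left.
rewrite inE walk_edges_rcons mem_rcons inE => /or3P[/eqP->|/eqP->|h]; right.
- by exists v; rewrite !inE eqxx ?orbT.
- by exists (last v s); rewrite ?mem_last // !inE eqxx.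
by case/mem_walk_edges: h => a [b [-> ha _]]; exists a; rewrite // !inE eqxx.
Qed.

Lemma seg_disj x y x' y' F : x -- y -> x' -- y' -> F \in seg x y -> F \in seg x' y' ->
  [set x; y] = [set x'; y'].
Proof.
have key a b a' b' : a -- b -> a' -- b' -> F \in seg a' b' ->
    (exists2 v, v \in p a b & v \in F) -> [set a; b] = [set a'; b'].
  move=> ab ab' /mem_walk_edges[c [d [-> hc hd]]] [v vp vF].
  apply: (p_disj ab ab' vp); have nf z : v != f z.
    by apply: contraTneq vp => ->; case: (p_uniq ab).
  have : v \in f a' :: rcons (p a' b') (f b').
    by move: vF; rewrite !inE => /orP[/eqP->//|/eqP->]; rewrite hd orbT.
  by rewrite inE mem_rcons inE !(negbTE (nf _)).
move=> xy xy' h h'; case: (mem_seg xy h) => [[_ e]|]; last exact: key xy xy' h'.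
case: (mem_seg xy' h') => [[_ e']|h2]; last by apply/esym; apply: key xy' xy h h2.
by move: e; rewrite e' => /set2_eq[] [/f_inj-> /f_inj->] //; rewrite setUC.
Qed.

Lemma elist_seg : perm_eq (flatten (map edge_seg (elist [set: G]))) (elist [set: H]).
Proof.
have adj E : E \in elist [set: G] -> exists x y, E = [set x; y] /\ x -- y.
  by case/elistP=> x [y [-> xy _ _]]; exists x, y.
apply: uniq_perm; [|exact: elist_uniq|].
  apply: uniq_flatten_map; first exact: elist_uniq.
    by move=> E /adj[x [y [-> xy]]]; rewrite (perm_uniq (edge_segE xy)) uniq_seg.
  move=> E E' /adj[x [y [-> xy]]] /adj[x' [y' [-> xy']]] F.
  by rewrite (perm_mem (edge_segE xy)) (perm_mem (edge_segE xy')); apply: seg_disj.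
move=> F; apply/flatten_mapP/elistP => [[E /adj[x [y [-> xy]]]]|[u [v [-> uv _ _]]]].
  rewrite (perm_mem (edge_segE xy)) => /walk_edgesP[a [b [-> h]]].
  by exists a, b; split; rewrite ?inE //; apply/H_edges; exists x, y.
have [x [y [xy h]]] := (proj1 (H_edges u v)) uv.
exists [set x; y]; first by rewrite mem_elist xy !inE.
by rewrite (perm_mem (edge_segE xy)); apply/walk_edgesP; exists u, v.
Qed.

(** With this marking the number of marked edges of a cycle has the parity of the length of the
    lifted cycle. *)
Definition seg_odd : pred {set G} := fun E => odd (size (edge_seg E)).

Lemma odd_size_flatten (l : seq {set G}) : odd (size (flatten (map edge_seg l))) = wodd seg_odd l.
Proof. by elim: l => //= E l IH; rewrite size_cat oddD IH wodd_cons. Qed.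

(** The last vertex is left out, so that a cycle, given as a closed walk, lifts to a cyclic sequence
    without repetition. *)
Fixpoint lift_walk x (s : seq G) : seq H :=
  if s is y :: s' then f x :: p x y ++ lift_walk y s' else [::].

Definition lift_cycle (c : seq G) : seq H := if c is x :: s then lift_walk x (rcons s x) else [::].

(** [rcons] restores the end that [lift_walk] omits, and [behead] drops the start, which
    [walk_edges] takes as a separate argument. *)
Lemma lift_walk_edges x s : path sedge x s ->
  perm_eq (walk_edges (f x) (behead (rcons (lift_walk x s) (f (last x s)))))
    (flatten (map edge_seg (walk_edges x s))).
Proof.
elim: s x => //= y s IH x /andP[xy ps]; rewrite ?rcons_cat.
have {IH} := IH y ps; case: s ps => [|z s] ps /= IH.
  by rewrite cats0 cats1 perm_sym; apply: edge_segE.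
rewrite -cat_rcons walk_edges_cat last_rcons -/(seg x y).
by apply: perm_cat => //; rewrite perm_sym; apply: edge_segE.
Qed.

Lemma lift_cycle_edges c : cycle sedge c ->
  perm_eq (cedges (lift_cycle c)) (flatten (map edge_seg (cedges c))).
Proof.
case: c => // x s; rewrite [cycle _ _]/= => /lift_walk_edges; rewrite last_rcons.
by case: s => [|y s].
Qed.

Fixpoint steps x (s : seq G) : seq (G * G) := if s is y :: s' then (x, y) :: steps y s' else [::].

Lemma lift_walkE x s : lift_walk x s = flatten [seq f e.1 :: p e.1 e.2 | e <- steps x s].
Proof. by elim: s x => //= y s IH x; rewrite IH. Qed.

Lemma steps_edges x s : walk_edges x s = [seq [set e.1; e.2] | e <- steps x s].
Proof. by elim: s x => //= y s IH x; rewrite IH. Qed.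

Lemma steps_fst x s y : [seq e.1 | e <- steps x (rcons s y)] = x :: s.
Proof. by elim: s x => //= z s IH x; rewrite IH. Qed.

Lemma steps_path x s e : path sedge x s -> e \in steps x s -> e.1 -- e.2.
Proof.
elim: s x => //= y s IH x /andP[xy ps]; rewrite inE => /orP[/eqP->|] //.
exact: IH.
Qed.

(** Different steps start at different vertices and use different edges, whose paths in [H] have
    disjoint interiors. *)
Lemma uniq_lift_cycle c : uniq c -> uniq (cedges c) -> cycle sedge c -> uniq (lift_cycle c).
Proof.
case: c => // x s us ue ps; rewrite /lift_cycle lift_walkE.
rewrite [cedges _]/= steps_edges in ue.
have uf : uniq [seq e.1 | e <- steps x (rcons s x)] by rewrite steps_fst.
have adj e : e \in steps x (rcons s x) -> e.1 -- e.2 by apply: steps_path.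
apply: uniq_flatten_map; first exact: map_uniq uf.
  by move=> e /adj a; have [u n] := p_uniq a; rewrite /= u n.
move=> e e' he he' v; have [_ n] := p_uniq (adj e he); have [_ n'] := p_uniq (adj e' he').
rewrite !inE => /orP[/eqP->|vp] /orP[/eqP|vp'].
- by move/f_inj; apply: map_inj_mem uf he he'.
- by rewrite (negbTE (n' _)) in vp'.
- by move=> ev; rewrite ev (negbTE (n _)) in vp.
by apply: (map_inj_mem ue he he'); apply: p_disj vp vp'; exact: adj.
Qed.

Lemma size_lift_walk x s : size s <= size (lift_walk x s).
Proof.
elim: s x => //= y s IH x; rewrite ltnS size_cat.
by apply: leq_trans (IH y) (leq_addl _ _).
Qed.

Lemma secd_lift : secd [set: G] -> ~~ odd #|edges H| -> even_cycle_decomposable H.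
Proof.
move=> sG ev; have eH := elist_seg.
have szH : size (elist [set: H]) = #|edges H|.
  by rewrite -cardE; apply: eq_card => F; rewrite inE subsetT andbT.
have [|cs ok e] := sG seg_odd.
  by rewrite -odd_size_flatten (perm_size eH) szH.
have ecs l : flatten (map edge_seg (flatten l)) = flatten (map (fun l' => flatten (map edge_seg l')) l).
  by elim: l => //= a l <-; rewrite map_cat flatten_cat.
have cyc_ok c : c \in cs -> [/\ uniq c, 2 < size c, cycle sedge c, uniq (cedges c) & ~~ wodd seg_odd (cedges c)].
  move=> cc; have /andP[/andP[uc sc] ec] := allP ok c cc; split=> //.
    rewrite cycle_cedges; apply/allP=> F Fc; have : F \in elist [set: G].
      by rewrite -(perm_mem e); apply/flatten_mapP; exists c.
    by rewrite mem_enum !inE => /andP[].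
  by apply: uniq_cedges; rewrite /cyc uc sc.
apply: (@dec_even_cycle_decomposable H (map lift_cycle cs)).
  rewrite all_map; apply/allP=> c /cyc_ok[uc sc pc uec ec] /=.
  rewrite /cyc uniq_lift_cycle //=; apply/andP; split.
    by case: c sc {uc pc uec ec} => // x s sc; apply: leq_trans (size_lift_walk x _); rewrite size_rcons.
  by rewrite -size_cedges (perm_size (lift_cycle_edges pc)) odd_size_flatten.
apply: perm_trans eH; have := perm_flatten (perm_map edge_seg e).
apply: perm_trans; rewrite ecs -!map_comp.
elim: cs {ok e} cyc_ok => //= c cs IH cyc_ok; apply: perm_cat.
  by apply: lift_cycle_edges; have [] := cyc_ok c (mem_head _ _).
by apply: IH => d dc; apply: cyc_ok; rewrite inE dc orbT.
Qed.

End Lift.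

(** * From decompositions of a subdivision to the marked graph *)

Section Subdivide.
Variables (G : sgraph) (S : {set {set G}}).
Hypothesis S_edges : S \subset edges G.
Implicit Types (x y z : G) (E : {set G}).

Definition sub_edge := {E : {set G} | E \in S}.

Definition subdiv_rel (a b : G + sub_edge) := match a, b with
  | inl x, inl y => x -- y && ([set x; y] \notin S)
  | inl x, inr E | inr E, inl x => x \in val E
  | inr _, inr _ => false
  end.

Lemma subdiv_sym : symmetric subdiv_rel.
Proof. by move=> [x|E] [y|F] //=; rewrite sedge_sym setUC. Qed.

Lemma subdiv_irrefl : irreflexive subdiv_rel.
Proof. by move=> [x|E] //=; rewrite sedge_irrefl. Qed.

(** The edges in [S] become paths of length 2, and all others keep length 1; this realizes every
    choice of parities. *)
Definition subdiv : sgraph := SGraph subdiv_sym subdiv_irrefl.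

Definition sub_vertex x : subdiv := inl x.

Definition sub_path x y : seq subdiv :=
  if insub [set x; y] is Some E then [:: inr E : subdiv] else [::].

Lemma sub_edgeP (E : sub_edge) : exists x y, x -- y /\ val E = [set x; y].
Proof. by have /(subsetP S_edges)/edgesP[x [y [e xy]]] := valP E; exists x, y. Qed.

Lemma sub_vertex_inj : injective sub_vertex.
Proof. by move=> x y []. Qed.

Lemma sub_path_rev x y : x -- y -> sub_path y x = rev (sub_path x y).
Proof. by rewrite /sub_path setUC; case: insubP. Qed.

Lemma mem_sub_path x y v : v \in sub_path x y -> exists2 E : sub_edge, v = inr E & val E = [set x; y].
Proof. by rewrite /sub_path; case: insubP => // E _ eE; rewrite inE => /eqP->; exists E. Qed.

Lemma sub_path_uniq x y : x -- y -> uniq (sub_path x y) /\ forall z, sub_vertex z \notin sub_path x y.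
Proof. by rewrite /sub_path; case: insubP. Qed.

Lemma sub_path_disj x y x' y' v : x -- y -> x' -- y' ->
  v \in sub_path x y -> v \in sub_path x' y' -> [set x; y] = [set x'; y'].
Proof. by move=> _ _ /mem_sub_path[E -> <-] /mem_sub_path[E' [->] <-]. Qed.

Lemma subdiv_edges (u v : subdiv) : u -- v <->
  exists x y, x -- y /\ infix [:: u; v] (sub_vertex x :: rcons (sub_path x y) (sub_vertex y)).
Proof.
have val2 (E : sub_edge) x y : val E = [set x; y] -> sub_path x y = [:: inr E].
  by move=> e; rewrite /sub_path -e valK.
split=> [|[x [y [xy]]]].
- case: u v => [x|E] [y|F] //=.
  + case/andP=> xy nS; exists x, y; split=> //.
    by rewrite /sub_path insubN // /= !eqxx.
  + have [a [b [ab e]]] := sub_edgeP F; rewrite e !inE => /orP[]/eqP->.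
      by exists a, b; rewrite (val2 F) //= !eqxx.
    by exists b, a; rewrite sedge_sym (val2 F) ?e 1?setUC //= !eqxx.
  have [a [b [ab e]]] := sub_edgeP E; rewrite e !inE => /orP[]/eqP->.
    by exists b, a; rewrite sedge_sym (val2 E) ?e 1?setUC //= !eqxx ?orbT.
  by exists a, b; rewrite (val2 E) //= !eqxx ?orbT.
rewrite /sub_path; case: insubP => [E _ eE|nS] /=.
  case/or4P=> [/and3P[/eqP-> /eqP-> _]|/and3P[/eqP-> /eqP-> _]|/andP[]|/eqP] //=.
    by rewrite eE !inE eqxx.
  by rewrite eE !inE eqxx orbT.
by case/or3P=> [/and3P[/eqP-> /eqP-> _]|/andP[]|/eqP] //=; rewrite xy.
Qed.

Lemma subdivision_subdiv : subdivision G subdiv.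
Proof.
exists sub_vertex, sub_path; split.
- exact: sub_vertex_inj.
- exact: sub_path_rev.
- exact: sub_path_uniq.
- exact: sub_path_disj.
split; last exact: subdiv_edges.
case=> [x|E]; [by left; exists x | right].
have [x [y [xy e]]] := sub_edgeP E; exists x, y; split=> //.
by rewrite /sub_path -e valK inE.
Qed.

Notation esegs := (edge_seg sub_vertex sub_path).

Lemma subdiv_elist : perm_eq (flatten (map esegs (elist [set: G]))) (elist [set: subdiv]).
Proof.
by apply: elist_seg; [exact: sub_vertex_inj | exact: sub_path_rev | exact: sub_path_uniq
  | exact: sub_path_disj | exact: subdiv_edges].
Qed.

Lemma esegsE x y : x -- y -> perm_eq (esegs [set x; y]) (seg sub_vertex sub_path x y).
Proof. by apply: edge_segE; exact: sub_path_rev. Qed.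

Lemma seg_odd_subdiv E : E \in edges G -> seg_odd sub_vertex sub_path E = (E \notin S).
Proof.
case/edgesP=> x [y [-> xy]]; rewrite /seg_odd (perm_size (esegsE xy)) /seg /sub_path.
by case: insubP => [F -> _|/negbTE->].
Qed.

Definition trace (s : seq subdiv) : seq G := pmap (fun v : subdiv => if v is inl x then Some x else None) s.

(** A walk that enters a subdividing vertex leaves it towards the other end of the edge, since
    turning back would repeat an edge. So it runs through whole segments. *)
Lemma walk_trace s x y : path sedge (sub_vertex x) (rcons s (sub_vertex y)) ->
  uniq (walk_edges (sub_vertex x) (rcons s (sub_vertex y))) ->
  path sedge x (rcons (trace s) y) /\
  perm_eq (walk_edges (sub_vertex x) (rcons s (sub_vertex y)))
    (flatten (map esegs (walk_edges x (rcons (trace s) y)))).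
Proof.
have direct a b : sub_vertex a -- sub_vertex b -> a -- b /\ perm_eq [:: [set sub_vertex a; sub_vertex b]] (esegs [set a; b]).
  case/andP=> ab nS; split=> //; rewrite perm_sym; apply: perm_trans (esegsE ab) _.
  by rewrite /seg /sub_path insubN.
have via a (E : sub_edge) b : sub_vertex a -- inr E -> (inr E : subdiv) -- sub_vertex b ->
    [set sub_vertex a; inr E] != [set inr E; sub_vertex b] ->
    a -- b /\ perm_eq [:: [set sub_vertex a; inr E]; [set inr E; sub_vertex b]] (esegs [set a; b]).
  move=> aE bE ne; have nab : a != b by apply: contraNneq ne => ->; rewrite setUC.
  have [c [d [cd e]]] := sub_edgeP E.
  have eE : val E = [set a; b] /\ a -- b.
    move: aE bE nab; rewrite /= e !inE => /orP[]/eqP-> /orP[]/eqP->; rewrite ?eqxx //.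
    by rewrite setUC sedge_sym.
  case: eE => eE ab; split=> //; rewrite perm_sym; apply: perm_trans (esegsE ab) _.
  by rewrite /seg /sub_path -eE valK.
(* Induction on the length, because passing a subdividing vertex consumes two entries. *)
elim: {s}(size s) {-2}s (leqnn (size s)) x => [|n IH] s sn x.
  by case: s sn => // _ /=; rewrite andbT cats0 => /direct[-> ->].
case: s sn => [|[z|E] s] sn; first by move=> /=; rewrite andbT cats0 => /direct[-> ->].
  rewrite /= => /andP[/direct[xz pz] pp] /andP[_ uu].
  have [-> h] := IH s sn z pp uu; rewrite xz; split=> //.
  by rewrite -cat1s; apply: perm_cat.
case: s sn => [|[z|F] s] sn; last by move=> /= /andP[].
  move=> /= /and3P[xE Ey _] /andP[]; rewrite inE => ne _.
  by rewrite cats0 andbT; apply: via.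
move=> /= /and3P[xE Ez pp] /and3P[ne _ uu].
have {ne} ne : [set sub_vertex x; inr E] != [set inr E; sub_vertex z].
  by move: ne; rewrite inE negb_or => /andP[].
have [xz pz] := via _ _ _ xE Ez ne.
have [|-> h] := IH s _ z pp uu; first exact: ltnW.
rewrite xz; split=> //.
by rewrite -[_ :: _ :: _]/([:: _; _] ++ _); apply: perm_cat.
Qed.

Lemma esegs_neq0 E : E \in edges G -> exists F, F \in esegs E.
Proof.
case/edgesP=> x [y [-> xy]]; have := esegsE xy; rewrite /seg.
case: (sub_path x y) => [|v s] /= e; first by exists [set sub_vertex x; sub_vertex y]; rewrite (perm_mem e) mem_head.
by exists [set sub_vertex x; v]; rewrite (perm_mem e) mem_head.
Qed.

Lemma uniq_flatten_esegs l : all [in edges G] l -> uniq (flatten (map esegs l)) -> uniq l.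
Proof.
elim: l => //= E l IH /andP[EG lG]; rewrite cat_uniq => /and3P[_ /hasPn h u].
rewrite IH // andbT; apply/negP=> El; have [F FE] := esegs_neq0 EG.
by have := h F; rewrite /= FE => /(_ _)/negP; apply=> //; apply/flatten_mapP; exists E.
Qed.

(** Subdividing vertices are pairwise nonadjacent, so the cycle meets a vertex of [G], from which it
    is traced. The trace repeats no edge and contains no loop, hence has length at least 3. *)
Lemma cyc_trace (c : seq subdiv) : cyc c -> cycle sedge c ->
  exists c', [/\ cyc c', all [in edges G] (cedges c')
    & perm_eq (cedges c) (flatten (map esegs (cedges c')))].
Proof.
move=> cc pc; have [x xc] : exists x, sub_vertex x \in c.
  case: c cc pc => [|[x|E] [|[y|F] s]] //= _ _; first by exists x; rewrite inE eqxx.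
    by exists x; rewrite inE eqxx.
  by exists y; rewrite !inE eqxx orbT.
have [s [cs es _]] := cyc_rot_cons cc xc.
have us := uniq_cedges cs.
have ps : cycle sedge (sub_vertex x :: s).
  by move: pc; rewrite !cycle_cedges (perm_all _ es).
have [pt et] := walk_trace ps us.
have gt : all [in edges G] (cedges (x :: trace s)) by rewrite -cycle_cedges.
have ee : perm_eq (cedges c) (flatten (map esegs (cedges (x :: trace s)))).
  by apply: perm_trans et; rewrite perm_sym.
exists (x :: trace s); split=> //.
have ut : uniq (cedges (x :: trace s)).
  by apply: uniq_flatten_esegs => //; rewrite -(perm_uniq ee) uniq_cedges.
have /andP[ux _] := cs; apply/andP; split.
  have : uniq (trace (sub_vertex x :: s)).
    by apply: (@pmap_uniq _ _ _ sub_vertex) => //; case.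
  by [].
case: (trace s) ut pt => [|y [|z t]] //=; first by rewrite sedge_irrefl.
by rewrite inE setUC eqxx.
Qed.

End Subdivide.

Theorem strongly_secd (G : sgraph) : strongly_even_cycle_decomposable G -> secd [set: G].
Proof.
(* The unmarked edges are subdivided, so that a segment has odd length exactly if its edge is
   marked. *)
move=> strong w ev; pose S : {set {set G}} := [set E in edges G | ~~ w E].
have S_edges : S \subset edges G by apply/subsetP=> E; rewrite inE => /andP[].
have inG E : E \in elist [set: G] -> E \in edges G by rewrite mem_enum inE => /andP[].
pose esegs := edge_seg (@sub_vertex G S) (@sub_path G S).
have eH := subdiv_elist S_edges.
have wE E : E \in edges G -> w E = seg_odd (@sub_vertex G S) (@sub_path G S) E.
  by move=> EG; rewrite seg_odd_subdiv // inE EG /= negbK.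
have [|cs ok e] := even_cycle_decomposable_dec (strong _ (subdivision_subdiv S_edges) _).
  have <- : size (elist [set: subdiv S]) = #|edges (subdiv S)|.
    by rewrite -cardE; apply: eq_card => F; rewrite inE subsetT andbT.
  rewrite -(perm_size eH) odd_size_flatten; move: ev; congr (~~ _).
  by apply: eq_wodd => E /inG/wE.
have in_e c F : c \in cs -> F \in cedges c -> F \in edges (subdiv S).
  move=> cc Fc; have : F \in elist [set: subdiv S] by rewrite -(perm_mem e); apply/flatten_mapP; exists c.
  by rewrite mem_enum inE => /andP[].
have [cs' ok' [eG e']] : exists2 cs' : seq (seq G),
    all (fun c => cyc c && ~~ wodd w (cedges c)) cs' &
    all [in edges G] (flatten (map cedges cs')) /\
    perm_eq (flatten (map cedges cs)) (flatten (map esegs (flatten (map cedges cs')))).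
  elim: cs ok {e} in_e => [|c cs IH] /=; first by exists [::].
  case/andP=> /andP[cc ec] ok in_e.
  have [|cs' ok' [eG e']] := IH ok; first by move=> d F dc; apply: in_e; rewrite inE dc orbT.
  have [|c' [cc' cG ec']] := cyc_trace S_edges cc.
    by rewrite cycle_cedges; apply/allP=> F; apply: in_e; rewrite mem_head.
  exists (c' :: cs'); rewrite /= ?cc' ?ok' ?andbT /=.
    rewrite (eq_wodd (w' := seg_odd (@sub_vertex G S) (@sub_path G S))) -?odd_size_flatten.
      by rewrite -(perm_size ec') size_cedges.
    by move=> E /(allP cG)/wE.
  by rewrite all_cat cG eG map_cat flatten_cat; split=> //; apply: perm_cat.
exists cs' => //; move: (flatten (map cedges cs')) eG e' => l lG el.
have ee : perm_eq (flatten (map esegs l)) (flatten (map esegs (elist [set: G]))).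
  apply: perm_trans (_ : perm_eq _ (elist [set: subdiv S])) _; last by rewrite perm_sym.
  by apply: perm_trans e; rewrite perm_sym.
have uG : uniq (flatten (map esegs (elist [set: G]))) by rewrite (perm_uniq eH) elist_uniq.
apply: uniq_perm; rewrite ?elist_uniq //.
  by apply: (@uniq_flatten_esegs _ S _ lG); rewrite (perm_uniq ee).
have elE E : E \in edges G -> E \in elist [set: G] by move=> EG; rewrite mem_enum inE EG subsetT.
move=> E; apply/idP/idP => [/(allP lG)/elE //|El].
have [F FE] := esegs_neq0 S (inG E El).
have : F \in flatten (map esegs l) by rewrite (perm_mem ee); apply/flatten_mapP; exists E.
case/flatten_mapP=> E' E'l FE'; rewrite -(uniq_flatten_inj uG (elE _ (allP lG _ E'l)) El FE' FE).
exact: E'l.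
Qed.

(** * Necessity, and the two exceptions *)

Section Necessity.
Variable G : sgraph.
Hypothesis sG : secd [set: G].
Implicit Types (x y z a b : G) (E : {set G}).

Lemma cyc_degree (T : finType) (x : T) c : cyc c -> ~~ wodd (fun E : {set T} => x \in E) (cedges c).
Proof.
move=> cc; have [xc|xc] := boolP (x \in c); last first.
  rewrite /wodd (eq_in_count (a2 := pred0)) ?count_pred0 // => E Ec.
  by apply/negbTE; apply: contra xc; apply: mem_cedges_sub Ec.
have [s [cs es _]] := cyc_rot_cons cc xc; rewrite -(wodd_perm _ es).
case/andP: cs => /=; case: s {es} => [|y s] //= /andP[xs _] _.
rewrite wodd_cons walk_edges_rcons -cats1 wodd_cat [wodd _ [:: _]]wodd_cons !inE !eqxx orbT /= addbT.
rewrite /wodd (eq_in_count (a2 := pred0)) ?count_pred0 // => E.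
case/mem_walk_edges=> a [b [-> ha hb]] /=; apply/negbTE; rewrite !inE.
by apply: contra xs => /orP[]/eqP->; rewrite // inE hb orbT.
Qed.

Lemma count_degree x : count (fun E : {set G} => x \in E) (elist [set: G]) = degree x.
Proof.
rewrite -size_filter /degree -(card_imset _ (f := fun y => [set x; y])); last first.
  by move=> y z /set2_eq[][] // -> ->.
rewrite cardE; apply: perm_size; apply: uniq_perm.
- by rewrite filter_uniq ?elist_uniq.
- exact: enum_uniq.
move=> E; rewrite mem_filter [RHS]mem_enum; apply/andP/imsetP => [[xE /elistP[a [b [eE ab _ _]]]]|[y]].
  move: xE; rewrite eE !inE => /orP[]/eqP->; first by exists b; rewrite ?inE.
  by exists a; rewrite ?inE 1?sedge_sym // setUC.
by rewrite inE => xy ->; rewrite mem_elist xy !inE eqxx.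
Qed.

Lemma secd_eulerian : eulerian G.
Proof.
move=> x; rewrite -count_degree; apply: (@dec_even _ (fun E : {set G} => x \in E)).
have [|cs ok e] := sG (w := pred0); first by rewrite /wodd count_pred0.
exists cs => //; apply/allP=> c /(allP ok)/andP[cc _].
by rewrite cc cyc_degree.
Qed.

Lemma secd_common_cycle E1 E2 : E1 \in edges G -> E2 \in edges G -> E1 != E2 ->
  exists c, [/\ cyc c, cycle sedge c, E1 \in cedges c & E2 \in cedges c].
Proof.
move=> h1 h2 ne; pose w E := (false (+) (E == E1)) (+) (E == E2).
have wE l : uniq l -> wodd w l = (E1 \in l) (+) (E2 \in l).
  move=> ul; rewrite (wodd_toggle (fun E => false (+) (E == E1))) // (wodd_toggle pred0) //.
  by rewrite /wodd count_pred0.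
have inL E : E \in edges G -> E \in elist [set: G] by move=> h; rewrite mem_enum inE h subsetT.
have [|cs ok e] := sG (w := w); first by rewrite wE ?elist_uniq // !inL.
have : E1 \in flatten (map cedges cs) by rewrite (perm_mem e) inL.
case/flatten_mapP=> c cc h; have /andP[cyc_c] := allP ok c cc.
rewrite wE ?uniq_cedges // h /= negbK => hc; exists c; split=> //.
rewrite cycle_cedges; apply/allP=> F Fc.
have : F \in elist [set: G] by rewrite -(perm_mem e); apply/flatten_mapP; exists c.
by rewrite mem_enum inE => /andP[].
Qed.

(** An edge at [a] and an edge at [b], if different, lie on a common cycle. One of its two arcs
    between [a] and [b] avoids [X], which has at most one vertex. *)
Lemma secd_connected_without (X : {set G}) : no_isolated_vertex G -> #|X| < 2 -> connected_without X.
Proof.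
move=> iso X1 a b aX bX; set r := (X in connect X).
have r_sym : symmetric r by move=> u v; rewrite /r /= sedge_sym andbCA.
have [->|nab] := eqVneq a b; first exact: connect0.
have edge z : exists z', z -- z'.
  by have := iso z; rewrite /degree card_gt0 => /set0Pn[z']; rewrite inE; exists z'.
have [a' aa'] := edge a; have [b' bb'] := edge b.
have [/set2_eq[[e _]|[_ e]]|ne] := eqVneq [set a; a'] [set b; b'].
- by rewrite e connect0.
- by apply: connect1; rewrite /r /= aX bX -e.
have [c [cc pc h1 h2]] := secd_common_cycle (introT (edgesP _) (ex_intro _ a (ex_intro _ a' (conj erefl aa'))))
  (introT (edgesP _) (ex_intro _ b (ex_intro _ b' (conj erefl bb')))) ne.
have ac : a \in c by apply: mem_cedges_sub h1 _; rewrite !inE eqxx.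
have bc : b \in c by apply: mem_cedges_sub h2 _; rewrite !inE eqxx.
have [P [Q [cPQ ePQ _]]] := cyc_split cc ac bc nab.
have := pc; rewrite cycle_cedges -(perm_all _ ePQ) cedges_split all_cat -!path_walk => /andP[pP pQ].
have arc x s y : x \notin X -> y \notin X -> {in s, forall z, z \notin X} ->
    path sedge x (rcons s y) -> connect r x y.
  move=> + yX; elim: s x => [|z s IH] x xX sX /=.
    by rewrite andbT => xy; apply: connect1; rewrite /r /= xX yX.
  case/andP=> xz pz; have zX : z \notin X by apply: sX; rewrite mem_head.
  apply: connect_trans (IH z zX _ pz); first by apply: connect1; rewrite /r /= xX zX.
  by move=> t ts; apply: sX; rewrite inE ts orbT.
have [/hasP[p pP' pX]|/hasPn PX] := boolP (has [in X] P); last exact: arc pP.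
rewrite (sym_connect_sym r_sym); apply: arc pQ => // q qQ; apply/negP=> qX.
have qp := card_le1_eqP X1 _ _ qX pX; rewrite -qp in qQ.
by case/andP: cPQ; rewrite /= cat_uniq => /andP[_ /and3P[_ /hasPn/(_ p)]]; rewrite inE qQ orbT pP' => /(_ isT).
Qed.

Lemma secd_two_connected : 0 < #|G| -> no_isolated_vertex G -> k_connected 2 G.
Proof.
move=> /card_gt0P[x _] iso; split; last by move=> X; apply: secd_connected_without.
have d2 : 1 < degree x by have := iso x; have := secd_eulerian x; case: (degree x) => [|[]].
apply: leq_trans (_ : #|x |: [set y | x -- y]| <= _); last exact: max_card.
by rewrite cardsU1 inE sedge_irrefl.
Qed.

(** All cycles of an even partition then have the same weight [n]. In both exceptions [n] is 4 while
    the total weight is 10. *)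
Lemma secd_dvd4 w n : ~~ wodd w (elist [set: G]) ->
  (forall c, cyc c -> cycle sedge c -> ~~ wodd w (cedges c) -> count w (cedges c) = n) ->
  n %| count w (elist [set: G]).
Proof.
move=> ev h; have [cs ok e] := sG ev; rewrite -(permP e w).
have {}e c F : c \in cs -> F \in cedges c -> F \in edges G.
  move=> cc Fc; have : F \in elist [set: G] by rewrite -(perm_mem e); apply/flatten_mapP; exists c.
  by rewrite mem_enum inE => /andP[].
elim: cs ok e => //= c cs IH /andP[/andP[cc ec] ok] e.
rewrite count_cat h //; last by rewrite cycle_cedges; apply/allP=> F; apply: e; rewrite mem_head.
by rewrite dvdn_addr //; apply: IH => // d F dc; apply: e; rewrite inE dc orbT.
Qed.

End Necessity.

(** * Labellings of the two exceptional graphs *)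

Section Labelled.
Variables (G K : sgraph) (x0 : G) (El : seq (nat * nat)) (pos : nat -> K) (n : nat).
Hypothesis pos_inj : {in gtn n &, injective pos}.
Hypothesis card_K : #|K| = n.
Hypothesis pos_adj : forall i j, i < n -> j < n -> pos i -- pos j = label_adj El i j.

Lemma iso_labels : isomorphic G K -> exists xs, size xs = n /\ labels x0 [set: G] El xs.
Proof.
case=> f [[g fK gK] fe]; pose s := map pos (iota 0 n).
have us : uniq s by rewrite map_inj_in_uniq ?iota_uniq // => i j; rewrite !mem_iota; apply: pos_inj.
have szs : size s = n by rewrite size_map size_iota.
exists (map g s); rewrite size_map; split=> //; split.
- by rewrite map_inj_uniq //; apply: can_inj gK.
- move=> x; rewrite inE -[x]fK; apply/esym/map_f.
  have sub : {subset s <= enum K} by move=> k _; rewrite mem_enum.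
  have szK : size (enum K) <= size s by rewrite szs -card_K cardE.
  by have [_ ->] := uniq_min_size us sub szK; rewrite mem_enum.
move=> i j; rewrite size_map szs => hi hj.
rewrite !(nth_map (f x0)) ?szs // -fe !gK !(nth_map 0) ?size_iota // !nth_iota //.
exact: pos_adj.
Qed.

Lemma labels_iso xs : size xs = n -> labels x0 [set: G] El xs -> isomorphic G K.
Proof.
move=> sz [ux Vx adj]; have inx x : x \in xs by rewrite -Vx inE.
have ind x : index x xs < n by rewrite -sz index_mem.
exists (fun x => pos (index x xs)); split; last first.
  by move=> x y; rewrite pos_adj // -adj ?sz // !nth_index.
apply: inj_card_bij; last first.
  rewrite card_K -sz -cardsT (eq_card Vx); by have /card_uniqP-> := ux.
by move=> x y /pos_inj e; rewrite -(nth_index x0 (inx x)) e ?nth_index // inE.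
Qed.

End Labelled.

Definition K5_pos (i : nat) : K5 := inord i.

Lemma K5_pos_inj : {in gtn 5 &, injective K5_pos}.
Proof. by move=> i j hi hj /(congr1 val); rewrite /= !inordK. Qed.

Lemma K5_adj i j : i < 5 -> j < 5 -> K5_pos i -- K5_pos j = label_adj K5_labels i j.
Proof.
move=> hi hj; rewrite /= /complete_rel -val_eqE /= !inordK //.
by case: i j hi hj => [|[|[|[|[|?]]]]] [|[|[|[|[|?]]]]].
Qed.

Definition K5s_pos (i : nat) : K5_subdivided := if i < 5 then Some (inord i) else None.

Lemma K5s_pos_inj : {in gtn 6 &, injective K5s_pos}.
Proof.
move=> i j; rewrite !inE /K5s_pos => hi hj; case: ltnP => i5; case: ltnP => j5 //.
  by case=> /(congr1 val); rewrite /= !inordK.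
by move=> _; apply/eqP; rewrite eqn_leq (leq_trans _ j5) // (leq_trans _ i5).
Qed.

Lemma K5s_adj i j : i < 6 -> j < 6 -> K5s_pos i -- K5s_pos j = label_adj K5s_labels i j.
Proof.
have set2 (x y a b : 'I_5) : ([set x; y] == [set a; b]) = (x == a) && (y == b) || (x == b) && (y == a).
  apply/eqP/orP => [/set2_eq[][-> ->]|[]/andP[/eqP-> /eqP->] //]; rewrite ?eqxx; auto.
  by rewrite setUC.
have adj k l : k < 5 -> l < 5 -> K5s_pos k -- K5s_pos l =
    (k != l) && ~~ ((k == 0) && (l == 4) || (k == 4) && (l == 0)).
  by move=> hk hl; rewrite /K5s_pos hk hl /= set2 /complete_rel -!val_eqE /= !inordK.
have adjN k : k < 5 -> K5s_pos k -- K5s_pos 5 = (k == 0) || (k == 4).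
  by move=> hk; rewrite /K5s_pos hk /= -!val_eqE /= inordK.
rewrite !ltnS leq_eqVlt => /orP[/eqP->|hi]; rewrite leq_eqVlt => /orP[/eqP->|hj].
- by rewrite sedge_irrefl.
- by rewrite sedge_sym adjN //; case: j hj => [|[|[|[|[|?]]]]].
- by rewrite adjN //; case: i hi => [|[|[|[|[|?]]]]].
by rewrite adj //; case: i j hi hj => [|[|[|[|[|?]]]]] [|[|[|[|[|?]]]]].
Qed.

Lemma card_K5 : #|K5| = 5. Proof. exact: card_ord. Qed.

Lemma card_K5s : #|K5_subdivided| = 6. Proof. by rewrite card_option card_ord. Qed.

Section Exceptions.
Variable G : sgraph.
Implicit Types (x y z : G).

Lemma label_size (x0 : G) El xs : labels x0 [set: G] El xs ->
  all (fun E => E.1 < E.2 < size xs) El -> uniq El -> size (elist [set: G]) = size El.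
Proof. by move=> lab h u; rewrite -(perm_size (labels_elist lab h u)) size_map. Qed.

Lemma size_cyc_card (c : seq G) : cyc c -> size c <= #|G|.
Proof. by case/andP=> /card_uniqP <- _; exact: max_card. Qed.

(* An even cycle of [K5] has length 4, but [K5] has 10 edges. *)
Lemma K5_not_secd : 0 < #|G| -> isomorphic G K5 -> ~ secd [set: G].
Proof.
move=> /card_gt0P[x0 _] iso sG.
have [xs [sz lab]] := iso_labels x0 K5_pos_inj card_K5 K5_adj iso.
have cG : #|G| = 5 by case: iso => f [bf _]; rewrite (bij_eq_card bf) card_K5.
have e10 : size (elist [set: G]) = 10 by apply: label_size lab _ _; rewrite ?sz.
suff : 4 %| 10 by [].
rewrite -e10 -(count_predT (elist _)); apply: (secd_dvd4 sG).
  by rewrite /wodd count_predT e10.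
move=> c cc _; rewrite /wodd !count_predT size_cedges.
have := size_cyc_card cc; rewrite cG; case/andP: cc => _.
by case: (size c) => [|[|[|[|[|[|]]]]]].
Qed.

(* Weigh the edges so that one of the two halves of the subdivided edge counts for 0: an even cycle
   then has weight 4, but the total weight is 10. *)
Lemma K5_subdivided_not_secd : 0 < #|G| -> isomorphic G K5_subdivided -> ~ secd [set: G].
Proof.
move=> /card_gt0P[x0 _] iso sG.
have cG : #|G| = 6 by case: iso => f [bf _]; rewrite (bij_eq_card bf) card_K5s.
have [xs [sz lab]] := iso_labels x0 K5s_pos_inj card_K5s K5s_adj iso.
have [ux Vx adj] := lab; rewrite sz in adj.
pose s := nth x0 xs 5; pose a := nth x0 xs 0; pose b := nth x0 xs 4.
have nbs y : s -- y -> y = a \/ y = b.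
  have : y \in xs by rewrite -Vx inE.
  move=> /(nthP x0)[i]; rewrite sz => hi <-; rewrite /s adj //.
  by case: i hi => [|[|[|[|[|[|]]]]]] //; auto.
have ab : ~~ a -- b by rewrite adj.
have sa : s -- a by rewrite adj.
pose E0 := [set s; a]; pose w E := true (+) (E == E0).
have e11 : size (elist [set: G]) = 11 by apply: label_size lab _ _; rewrite ?sz.
have wE l : uniq l -> count w l = size l - (E0 \in l).
  move=> ul; rewrite -(count_predC w l) -(count_uniq_mem _ ul).
  rewrite [X in _ + X - _](eq_count (a2 := pred1 E0)) ?addnK // => E.
  by rewrite /= /w; case: eqP.
have E0l : E0 \in elist [set: G] by rewrite mem_elist sa !inE.
have c10 : count w (elist [set: G]) = 10 by rewrite wE ?elist_uniq // E0l e11.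
suff : 4 %| 10 by [].
rewrite -c10; apply: (secd_dvd4 sG); first by rewrite /wodd c10.
move=> c cc pc; rewrite /wodd wE ?uniq_cedges // size_cedges.
have c6 := size_cyc_card cc; rewrite cG in c6; have /andP[uc c3] := cc.
(* A cycle that avoids [s] has 3 to 5 edges, all of weight 1, so even weight means 4. *)
have [sc|sc] := boolP (s \in c); last first.
  have -> : (E0 \in cedges c) = false.
    by apply/negbTE; apply: contra sc => /mem_cedges_sub; apply; rewrite !inE eqxx.
  have c5 : size c <= 5.
    rewrite -ltnS -cG; apply: leq_trans (_ : #|s |: [set y in c]| <= _); last exact: max_card.
    by rewrite cardsU1 inE sc add1n ltnS; have /card_uniqP <- := uc; rewrite cardsE.
  by rewrite subn0; case: (size c) c3 c5 => [|[|[|[|[|[|]]]]]].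
have [t [ct et mt]] := cyc_rot_cons cc sc.
have szt : size c = (size t).+1 by rewrite -size_cedges -(perm_size et) size_cedges.
have pt : cycle sedge (s :: t) by move: pc; rewrite !cycle_cedges (perm_all _ et).
have /andP[ut _] := ct.
case: t ut pt szt et {ct mt} => [|y t]; first by move=> _ _ szt; rewrite szt in c3.
case: (lastP t) => {t} [|t z] ut pt szt et; first by rewrite szt in c3.
have [sy pyt zs] : [/\ s -- y, path sedge y (rcons t z) & z -- s].
  by move: pt; rewrite /= rcons_path last_rcons => /and3P[].
have yz : y != z.
  by move: ut => /= /and3P[_ + _]; rewrite mem_rcons inE negb_or => /andP[].
have sz' : s -- z by rewrite sedge_sym.
have E0c : E0 \in cedges c.
  have h : [set s; y] \in cedges c /\ [set z; s] \in cedges c.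
    rewrite -!(perm_mem et) [cedges _]/= walk_edges_rcons last_rcons.
    by rewrite !inE !mem_rcons !inE !eqxx orbT.
  have [ey|ey] := nbs y sy; first by rewrite /E0 -ey; case: h.
  have [ez|ez] := nbs z sz'; first by rewrite /E0 -ez setUC; case: h.
  by rewrite ey ez eqxx in yz.
(* The neighbours [a] and [b] of [s] are nonadjacent, so a cycle through [s] has length 4 to 6.
   Exactly one of its edges counts for 0, and again even weight means 4. *)
have t0 : 0 < size t.
  case: t pyt {ut pt szt et} => //=; rewrite andbT => h.
  have [ey|ey] := nbs y sy; have [ez|ez] := nbs z sz'; move: yz h ab.
  - by rewrite ey ez eqxx.
  - by rewrite ey ez => _ ->.
  - by rewrite ey ez sedge_sym => _ ->.
  - by rewrite ey ez eqxx.
rewrite E0c; move: szt c6 t0; rewrite /= size_rcons => ->.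
by case: (size t) => [|[|[|[|]]]].
Qed.

Lemma exceptional_iso (x0 : G) : exceptional x0 [set: G] -> isomorphic G K5 \/ isomorphic G K5_subdivided.
Proof.
case=> -[xs sz lab]; [left | right].
  exact: (labels_iso K5_pos_inj card_K5 K5_adj sz lab).
exact: (labels_iso K5s_pos_inj card_K5s K5s_adj sz lab).
Qed.

Lemma connected_without_connS (X : {set G}) : connected_without X -> connS (~: X).
Proof.
move=> cX A sA /set0Pn[a aA] nA.
have [b [bX bA]] : exists b, b \in ~: X /\ b \notin A.
  have /subsetPn[b] : ~~ (~: X \subset A) by apply: contra nA => h; rewrite eqEsubset sA.
  by exists b.
have := cX a b; have := subsetP sA a aA; rewrite !inE in bX * => aX /(_ aX bX)/connectP[s ps eb].
elim: s a aA aX ps eb => [|z s IH] a aA aX /=; first by move=> _ e; rewrite e aA in bA.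
case/andP=> /and3P[_ zX az] ps eb; case: (boolP (z \in A)) => zA; first exact: IH zA zX ps eb.
by exists a, z; rewrite inE.
Qed.

Lemma k_connected_two_conn : k_connected 2 G -> two_conn [set: G].
Proof.
case=> c2 h; split; first by rewrite cardsT.
  by rewrite -setC0; apply: connected_without_connS; apply: h; rewrite cards0.
move=> x _; rewrite setTD; apply: connected_without_connS; apply: h.
by rewrite cards1.
Qed.

Lemma eulerian_euler : eulerian G -> euler [set: G].
Proof.
move=> eu x _; rewrite (_ : nbr _ x = [set y | x -- y]); first exact: eu.
by apply/setP=> y; rewrite !inE.
Qed.

End Exceptions.

Theorem corollary8p1 (G : sgraph) (G_nonempty : 0 < #|G|)
    (G_cograph : cograph G) (G_no_isolated : no_isolated_vertex G) :
  strongly_even_cycle_decomposable G <->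
  [/\ k_connected 2 G, eulerian G,
      ~ isomorphic G K5 & ~ isomorphic G K5_subdivided].
Proof.
split=> [/strongly_secd sG|[c2 eu nK5 nK5s] H [f [p [f_inj p_rev p_uniq p_disj [_ H_edges]]]] ev].
  split; [exact: secd_two_connected | exact: secd_eulerian | |] => iso.
    exact: (K5_not_secd G_nonempty iso).
  exact: (K5_subdivided_not_secd G_nonempty iso).
have /card_gt0P[x0 _] := G_nonempty.
have [/exceptional_iso[]//|sG] := two_conn_good x0 G_cograph (k_connected_two_conn c2) (eulerian_euler eu).
exact: (secd_lift f_inj p_rev p_uniq p_disj H_edges sG ev).
Qed.
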